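(* Let $d\ge 4$ and let $E\subset\mathbb{R}^d$ be a bounded measurable set of positive Lebesgue measure. Then a set of the form $rE+x$, where $r\ge 1$ and $x\in\mathbb{R}^d$, can be reconstructed using $d+1$ sets; that is, there are measurable sets $T_1,\dots,T_{d+1}\subset\mathbb{R}^d$ such that if $(x,r)\neq(x',r')$, $x,x'\in\mathbb{R}^d$, $r,r'\ge 1$, then $\lambda^d((rE+x)\cap T_i)\neq\lambda^d((r'E+x')\cap T_i)$ for some $i\in\{1,\dots,d+1\}$.
   Context: $\lambda^d$ denotes Lebesgue measure on $\mathbb{R}^d$. *)

(* Defs.v *)
From HB Require Import structures.
From mathcomp Require Import all_boot all_order all_algebra.
From mathcomp Require Import all_classical all_reals all_analysis.
Set Implicit Arguments.
Unset Strict Implicit.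
Unset Printing Implicit Defensive.
Import Order.TTheory GRing.Theory Num.Theory.
Import numFieldNormedType.Exports.
Local Open Scope classical_set_scope.
Local Open Scope ring_scope.
Local Open Scope ereal_scope.

(* Lebesgue measure on Borel sets of n-tuples: the n-fold product of the
   one-dimensional [lebesgue_measure], transported along
   R * R^n ~ R^(n+1), (x, t) |-> x :: t. *)
Section lebesgue_tuple.
Variable R : realType.
Local Notation mR := (measurableTypeR R).

Definition tuple_cons n (p : mR * n.-tuple mR) : n.+1.-tuple mR :=
  [the n.+1.-tuple mR of p.1 :: p.2].

Definition lebesgue_tuple_succ n (m : set (n.-tuple mR) -> \bar R) :
    set (n.+1.-tuple mR) -> \bar R :=
  pushforward (@lebesgue_measure R \x m) (@tuple_cons n).

Section succ_measure.
Variables (n : nat) (m : {sigma_finite_measure set (n.-tuple mR) -> \bar R}).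

Lemma measurable_tuple_cons : measurable_fun [set: mR * n.-tuple mR]
  (@tuple_cons n).
Proof. exact: measurable_cons. Qed.

Lemma tuple_cons_preimage (A : set (n.+1.-tuple mR)) :
  measurable A -> measurable (@tuple_cons n @^-1` A).
Proof.
by move=> mA; rewrite -[X in measurable X]setTI; exact: measurable_tuple_cons.
Qed.

Let succ0 : lebesgue_tuple_succ m set0 = 0.
Proof. by rewrite /lebesgue_tuple_succ /pushforward preimage_set0 measure0. Qed.

Let succ_ge0 A : 0 <= lebesgue_tuple_succ m A.
Proof. exact: (measure_ge0 (@lebesgue_measure R \x m)). Qed.

Let succ_sigma_additive : semi_sigma_additive (lebesgue_tuple_succ m).
Proof.
move=> F mF tF mUF; rewrite /lebesgue_tuple_succ /pushforward preimage_bigcup.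
apply: measure_semi_sigma_additive.
- by move=> k; exact: tuple_cons_preimage.
- apply/trivIsetP => /= i j _ _ ij; rewrite -preimage_setI.
  by move/trivIsetP : tF => /(_ _ _ _ _ ij) ->//; rewrite preimage_set0.
- by rewrite -preimage_bigcup; exact: tuple_cons_preimage.
Qed.

HB.instance Definition _ := isMeasure.Build _ _ _ (lebesgue_tuple_succ m)
  succ0 succ_ge0 succ_sigma_additive.

Let succ_sigma_finite : sigma_finite setT (lebesgue_tuple_succ m).
Proof.
have /sigma_finiteP[F [TF ndF Foo]] := sigma_finiteT (@lebesgue_measure R).
have /sigma_finiteP[G [TG ndG Goo]] := sigma_finiteT m.
pose u (t : n.+1.-tuple mR) : mR * n.-tuple mR :=
  (tnth t ord0, [tuple of behead t]).
have mu : measurable_fun setT u.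
  apply/measurable_fun_pairP; split; [exact: measurable_tnth|].
  exact: measurable_behead.
exists (fun k => u @^-1` (F k `*` G k)).
  rewrite -preimage_bigcup; apply/seteqP; split=> // t _ /=.
  have [i _ Fi] : (\bigcup_i F i) (u t).1 by rewrite -TF.
  have [j _ Gj] : (\bigcup_j G j) (u t).2 by rewrite -TG.
  exists (maxn i j) => //; split.
    by move: Fi; exact/subsetPset/ndF/leq_maxl.
  by move: Gj; exact/subsetPset/ndG/leq_maxr.
move=> k; have [mF Fk] := Foo k; have [mG Gk] := Goo k; split.
  rewrite -[X in measurable X]setTI; apply: mu => //; exact: measurableX.
rewrite /lebesgue_tuple_succ /pushforward -comp_preimage.
rewrite (_ : u \o _ = id); last first.
  by apply/funext => -[x t]; rewrite /u/=; congr pair; exact/val_inj.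
by rewrite preimage_id product_measure1E// lte_mul_pinfty// ge0_fin_numE.
Qed.

HB.instance Definition _ := Measure_isSigmaFinite.Build _ _ _
  (lebesgue_tuple_succ m) succ_sigma_finite.
End succ_measure.

Fixpoint lebesgue_tuple n : {sigma_finite_measure set (n.-tuple mR) -> \bar R} :=
  match n with
  | 0%N => @dirac _ (0.-tuple mR) [tuple] R
  | n'.+1 => lebesgue_tuple_succ (lebesgue_tuple n')
  end.

End lebesgue_tuple.

Section lebesgue_rV.
Variables (R : realType) (d : nat).
Local Notation mR := (measurableTypeR R).

Definition rV_of_tuple (t : d.-tuple mR) : 'rV[R]_d := \row_i tnth t i.

(* d-dimensional Lebesgue outer measure. It is used both for the measure
   lambda^d and, through Caratheodory's criterion, for its completed
   sigma-algebra: a set A is Lebesgue measurable iff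
   [lebesgue_rV.-cara.-measurable A], and then [lebesgue_rV A] is its
   measure. *)
Definition lebesgue_rV (A : set 'rV[R]_d) : \bar R :=
  ((lebesgue_tuple R d)^*)%mu (rV_of_tuple @^-1` A).

Let lebesgue_rV0 : lebesgue_rV set0 = 0.
Proof. by rewrite /lebesgue_rV preimage_set0 outer_measure0. Qed.

Let lebesgue_rV_ge0 A : 0 <= lebesgue_rV A.
Proof. exact: outer_measure_ge0. Qed.

Let le_lebesgue_rV : {homo lebesgue_rV : A B / A `<=` B >-> A <= B}.
Proof. by move=> A B AB; apply: le_outer_measure => t; exact: AB. Qed.

Let lebesgue_rV_sigma_subadditive : sigma_subadditive lebesgue_rV.
Proof.
move=> F; rewrite /lebesgue_rV preimage_bigcup.
exact: outer_measure_sigma_subadditive.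
Qed.

HB.instance Definition _ := isOuterMeasure.Build R 'rV[R]_d lebesgue_rV
  lebesgue_rV0 lebesgue_rV_ge0 le_lebesgue_rV lebesgue_rV_sigma_subadditive.

End lebesgue_rV.
Arguments lebesgue_rV {R d} A.

Lemma measurable_tuple_rect (R : realType) n
    (A : 'I_n -> set (measurableTypeR R)) : (forall i, measurable (A i)) ->
  measurable [set t : n.-tuple (measurableTypeR R) | forall i, A i (tnth t i)].
Proof.
move=> mA; rewrite (_ : mkset _ =
    \bigcap_(i in [set: 'I_n]) ((fun t => tnth t i) @^-1` A i)).
  apply: fin_bigcap_measurable => // i _; rewrite -[X in measurable X]setTI.
  exact: measurable_tnth.
by apply/seteqP; split=> t /= h i; [move=> _|]; exact: h.
Qed.

Lemma lebesgue_tuple_rect (R : realType) n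
    (A : 'I_n -> set (measurableTypeR R)) : (forall i, measurable (A i)) ->
  lebesgue_tuple R n [set t | forall i, A i (tnth t i)] =
  \prod_(i < n) lebesgue_measure (A i).
Proof.
elim: n A => [|n IHn] A mA /=.
  rewrite big_ord0 (_ : mkset _ = setT) ?diracT//.
  by apply/seteqP; split=> // t _ [].
rewrite /lebesgue_tuple_succ /pushforward big_ord_recl -IHn; last by move=> i; exact: mA.
rewrite -product_measure1E//; last first.
  exact: (@measurable_tuple_rect R n (fun i => A (lift ord0 i)) (fun i => mA _)).
congr (_ _); apply/seteqP; split=> -[x t] /=.
  move=> h; split=> [|i]; first exact: (h ord0).
  by have := h (lift ord0 i); rewrite tnthS.
by move=> [hx ht] i; case: (unliftP ord0 i) => [j|] -> //; rewrite tnthS.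
Qed.

Lemma lebesgue_rV_rect (R : realType) d
    (A : 'I_d -> set (measurableTypeR R)) : (forall i, measurable (A i)) ->
  lebesgue_rV [set x : 'rV[R]_d | forall i, A i (x ord0 i)] =
  \prod_(i < d) lebesgue_measure (A i).
Proof.
move=> mA; rewrite -lebesgue_tuple_rect// -(@measurable_mu_extE _ _ _ (lebesgue_tuple R d));
  last exact: (measurable_tuple_rect mA).
congr (mu_ext _ _); apply/seteqP; split=> t /= h i.
  by have := h i; rewrite mxE.
by rewrite mxE.
Qed.

Definition homothetic (R : realType) (d : nat) (E : set 'rV[R]_d)
    (r : R) (x : 'rV[R]_d) : set 'rV[R]_d :=
  [set (r *: e + x)%R | e in E].

(* Main.v *)
Require Import Defs.
From HB Require Import structures.
From mathcomp Require Import all_boot all_order all_algebra.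
From mathcomp Require Import all_classical all_reals all_analysis.
From mathcomp Require Import measurable_realfun ring lra zify.
Set Implicit Arguments.
Unset Strict Implicit.
Unset Printing Implicit Defensive.
Import Order.TTheory GRing.Theory Num.Theory.
Import numFieldNormedType.Exports.
Local Open Scope classical_set_scope.
Local Open Scope ring_scope.

(* Take [T_0 = R^d], which determines [r], and [T_i = {y | <y, th_i> in S_i}] for [d]
   linearly independent directions [th_i] and suitable Borel sets [S_i] of reals. It is
   enough that, for each [i] and each [r >= 1], the measure of
   [{e in E | t + r <e, th_i> in S_i}] be strictly increasing in [t], since then equal
   measures force [<x, th_i> = <x', th_i>] for all [i].

   Smoothing. For [th = (1, w, 0, ..., 0) + const] with [w] in [[0,1]^3], let [f_w] be the
   density of the image of the restriction of Lebesgue measure to [E] under [<., th>].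
   The energy of the second difference of [f_w] with step [h] is the integral, over pairs
   of a point of [E] and a point of a slice, of a fourth difference of an indicator
   function; averaging over [w] absorbs one difference per coordinate of [w], so the mean
   energy is [O(h^3 log^3 (1/h))]. As [8 > 25/4], some [w] has energy [O((4/25)^n)] for all
   the steps [h = 2^-n] at once: this is what the hypothesis [d >= 4] is for.

   Test sets. [S] is built from a bounded increasing function [g] of slope about
   [|s|^(-11/10)] by filling each cell of a fine partition of the line with the mass that
   [g] prescribes. Replacing [g] by the indicator of [S] is an error that the smoothing
   estimate controls: rescaled first differences at two dyadic scales differ by
   [O((4/5)^n)], so that the error at all small scales is governed by the one at a fixed
   scale, which the fineness of the partition makes smaller than the growth of [g]. *)

(** * Bounded functions, product measures and affine changes of variables *)

(** The rate 25/4 comes from the end of the argument. Rescaling first differences by [2^n] turns a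
    second-difference bound [q^n] into errors [(2q)^n], summable only if [q < 1/2]. Second
    differences are tested against bounded functions, so [q] is the square root of the energy rate,
    and the energy must beat [4^-n]. Averaging over [j] parameters yields [2^(-jn)] up to powers of
    [n]: two parameters are borderline, three suffice, and [q = 2/5] lies between [8^(-1/2)] and
    [1/2]. The fourth coordinate, with coefficient 1, carries the density.

    One [S] must serve every [r >= 1], and this fixes the slope. For a slope [|s|^(-1-beta)] the
    growth rate near [t = 0] is about [r^(-beta)], and the mass error allowed in a window is a
    multiple of [r] times the tenth power of that rate, [r^(1 - 10 beta)]. It stays away from 0 for
    large [r] only if [beta <= 1/10].

    Since [w] is only known to exist, the directions cannot be prescribed: linear independence has
    to hold for every choice of the [w]'s in the cube, one for each direction, and a large multiple
    of a basis vector ensures it. *)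

Section bounded_integral.
Context d (T : measurableType d) (R : realType).
Variable mu : {measure set T -> \bar R}.
Implicit Types (D : set T) (f g : T -> R).

Lemma bounded_integrable D f (M : R) : measurable D -> (mu D < +oo)%E ->
  measurable_fun setT f -> (forall x, D x -> `|f x| <= M) ->
  mu.-integrable D (EFin \o f).
Proof.
move=> mD Doo mf fM; apply: measurable_bounded_integrable => //.
  exact: measurable_funTS.
exists M; split; first exact: num_real.
by move=> x Mx y Dy; rewrite /= (le_trans (fM _ Dy))// ltW.
Qed.

Lemma normr_Rintegral_le D f (M : R) : measurable D -> (mu D < +oo)%E ->
  measurable_fun setT f -> (forall x, D x -> `|f x| <= M) ->
  `|\int[mu]_(x in D) f x| <= M * fine (mu D).
Proof.
move=> mD Doo mf fM; have intf := bounded_integrable mD Doo mf fM.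
apply: le_trans (le_normr_Rintegral mD intf) _.
rewrite -Rintegral_cst//; apply: le_Rintegral => //.
- exact: integrable_norm.
- by apply: bounded_integrable => // x _; exact: lexx.
Qed.

Lemma Rintegral_indic D (A : set T) : measurable D -> measurable A ->
  \int[mu]_(x in D) \1_A x = fine (mu (A `&` D)).
Proof. by move=> mD mA; rewrite /Rintegral integral_indic. Qed.

End bounded_integral.

Section prod_measure.
Context d1 d2 (T1 : measurableType d1) (T2 : measurableType d2) (R : realType).
Variables (m1 : {sigma_finite_measure set T1 -> \bar R})
  (m2 : {sigma_finite_measure set T2 -> \bar R}).

(* The library's instances let [m1 \x m2] be inferred sigma-finite only when
   the factors are finite. *)
Definition prod_measure : set (T1 * T2) -> \bar R := (m1 \x m2)%E.

HB.instance Definition _ := Measure.copy prod_measure (m1 \x m2)%E.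

Let prod_measure_sigma_finite : sigma_finite setT prod_measure.
Proof.
have /sigma_finiteP[F [TF ndF Foo]] := sigma_finiteT m1.
have /sigma_finiteP[G [TG ndG Goo]] := sigma_finiteT m2.
exists (fun n => F n `*` G n).
  rewrite -setXTT TF TG; apply/seteqP; split=> -[x y].
    move=> [/= [n _ Fnx] [k _ Gky]]; exists (maxn n k) => //; split.
    - by move: x Fnx; exact/subsetPset/ndF/leq_maxl.
    - by move: y Gky; exact/subsetPset/ndG/leq_maxr.
  by move=> [n _ []/= ? ?]; split; exists n.
move=> k; have [? ?] := Foo k; have [? ?] := Goo k.
split; first exact: measurableX.
by rewrite /prod_measure product_measure1E// lte_mul_pinfty// ge0_fin_numE.
Qed.

HB.instance Definition _ := Measure_isSigmaFinite.Build _ _ _ prod_measure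
  prod_measure_sigma_finite.

Lemma prod_measureE (D1 : set T1) (D2 : set T2) : measurable D1 -> measurable D2 ->
  prod_measure (D1 `*` D2) = (m1 D1 * m2 D2)%E.
Proof. by move=> mD1 mD2; rewrite /prod_measure product_measure1E. Qed.

Lemma prod_measure_lty (D1 : set T1) (D2 : set T2) :
  measurable D1 -> measurable D2 -> (m1 D1 < +oo)%E -> (m2 D2 < +oo)%E ->
  (prod_measure (D1 `*` D2) < +oo)%E.
Proof.
move=> mD1 mD2 D1oo D2oo.
by rewrite prod_measureE// lte_mul_pinfty// ge0_fin_numE.
Qed.

End prod_measure.

Section Rfubini.
Context d1 d2 (T1 : measurableType d1) (T2 : measurableType d2) (R : realType).
Variables (m1 : {sigma_finite_measure set T1 -> \bar R})
  (m2 : {sigma_finite_measure set T2 -> \bar R}).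
Variables (D1 : set T1) (D2 : set T2) (f : T1 * T2 -> R) (M : R).
Hypotheses (mD1 : measurable D1) (mD2 : measurable D2).
Hypotheses (D1oo : (m1 D1 < +oo)%E) (D2oo : (m2 D2 < +oo)%E).
Hypotheses (mf : measurable_fun setT f).
Hypothesis fM : forall z, (D1 `*` D2) z -> `|f z| <= M.

Let g := (fun z => (f z)%:E) \_ (D1 `*` D2).

Let intg : (m1 \x m2)%E.-integrable setT g.
Proof.
apply/(integrable_mkcond _ _).1; first exact: measurableX.
apply: (@bounded_integrable _ _ _ _ _ _ M) => //; first exact: measurableX.
exact: prod_measure_lty.
Qed.

Let gE x y : g (x, y) = (((fun y => (f (x, y))%:E) \_ D2) y * (\1_D1 x)%:E)%E.
Proof.
rewrite /g /patch indicE in_setX /= andbC; case: ifPn => /= [/andP[-> ->]|].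
  by rewrite mule1.
rewrite negb_and; case: (y \in D2) => //= [/negbTE->|]; first by rewrite mule0.
by rewrite mul0e.
Qed.

Let FE x : (\int[m2]_y g (x, y) =
  (fun x => (\int[m2]_(y in D2) f (x, y))%:E) \_ D1 x)%E.
Proof.
under eq_integral do rewrite gE.
rewrite /patch; case: ifPn; rewrite ?(notin_setE,in_setE) => Dx.
  under eq_integral do rewrite indicE [in X in (_ * X)%E]mem_set//= mule1.
  rewrite -integral_mkcond /Rintegral fineK//.
  apply: integrable_fin_num => //; apply: (@bounded_integrable _ _ _ _ _ _ M) => //.
    exact: measurableT_comp.
  by move=> y Dy; apply: fM.
have D1x : \1_D1 x = 0 :> R by rewrite indicE memNset.
under eq_integral do rewrite D1x mule0.
exact: integral0.
Qed.

Let GE y : (\int[m1]_x g (x, y) =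
  (fun y => (\int[m1]_(x in D1) f (x, y))%:E) \_ D2 y)%E.
Proof.
have gE' x : g (x, y) = (((fun x => (f (x, y))%:E) \_ D1) x * (\1_D2 y)%:E)%E.
  rewrite gE /patch !indicE; case: ifPn => _; case: ifPn => //= _;
    by rewrite ?(mul0e,mule0).
under eq_integral do rewrite gE'.
rewrite /patch; case: ifPn; rewrite ?(notin_setE,in_setE) => Dy.
  under eq_integral do rewrite indicE [in X in (_ * X)%E]mem_set//= mule1.
  rewrite -integral_mkcond /Rintegral fineK//.
  apply: integrable_fin_num => //; apply: (@bounded_integrable _ _ _ _ _ _ M) => //.
    exact: measurableT_comp.
  by move=> x Dx; apply: fM.
have D2y : \1_D2 y = 0 :> R by rewrite indicE memNset.
under eq_integral do rewrite D2y mule0.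
exact: integral0.
Qed.

Lemma Rfubini1 : \int[prod_measure m1 m2]_(z in D1 `*` D2) f z =
  \int[m1]_(x in D1) \int[m2]_(y in D2) f (x, y).
Proof.
rewrite /Rintegral integral_mkcond -[in LHS](integral12_prod_meas1 intg).
rewrite [in RHS]integral_mkcond; congr fine.
by apply: eq_integral => x _; rewrite /fubini_F FE.
Qed.

Lemma Rfubini2 : \int[prod_measure m1 m2]_(z in D1 `*` D2) f z =
  \int[m2]_(y in D2) \int[m1]_(x in D1) f (x, y).
Proof.
rewrite /Rintegral integral_mkcond -[in LHS](integral21_prod_meas1 intg).
rewrite [in RHS]integral_mkcond; congr fine.
by apply: eq_integral => x _; rewrite /fubini_G GE.
Qed.

End Rfubini.

Lemma measurable_Rintegral d1 d2 (T1 : measurableType d1)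
    (T2 : measurableType d2) (R : realType)
    (m2 : {sigma_finite_measure set T2 -> \bar R}) (D2 : set T2)
    (f : T1 * T2 -> R) (M : R) :
    measurable D2 -> (m2 D2 < +oo)%E -> measurable_fun setT f ->
    (forall x y, D2 y -> `|f (x, y)| <= M) ->
  measurable_fun setT (fun x => \int[m2]_(y in D2) f (x, y)).
Proof.
move=> mD2 D2oo mf fM.
(* [f] is bounded only over [D2], so the shift by [M] is clamped at 0 and cut off outside [D2]; the
   result is nonnegative on the whole product, and Tonelli applies. *)
pose g (z : T1 * T2) : \bar R := (Num.max (f z + M) 0 * \1_D2 z.2)%:E.
have mg : measurable_fun setT g.
  apply/measurable_EFinP; apply: measurable_funM.
    by apply: measurable_maxr => //; exact: measurable_funD.
  by apply: (measurableT_comp _ measurable_snd); exact: measurable_indic.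
have g0 z : (0 <= g z)%E by rewrite lee_fin mulr_ge0// le_max lexx orbT.
have mG := measurable_fun_fubini_tonelli_F (m2 := m2) g mg g0.
have mfx x : measurable_fun setT (fun y => f (x, y)) by exact: measurableT_comp.
have GE x : \int[m2]_(y in D2) f (x, y) =
    fine (fubini_F m2 g x) - M * fine (m2 D2).
  have ifx : m2.-integrable D2 (EFin \o (fun y => f (x, y))).
    by apply: (@bounded_integrable _ _ _ _ _ _ M) => // y; exact: fM.
  have iM : m2.-integrable D2 (EFin \o (fun=> M)).
    by apply: (@bounded_integrable _ _ _ _ _ _ `|M|) => // y.
  rewrite -Rintegral_cst//.
  transitivity (\int[m2]_(y in D2) (f (x, y) + M) - \int[m2]_(x in D2) M).
    by rewrite RintegralD// addrK.
  congr (fine _ - _); rewrite /fubini_F integral_mkcond; apply: eq_integral => y _.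
  rewrite /g /patch indicE /=; case: ifPn => yD; rewrite ?mulr0// mulr1 max_l//.
  by have := fM x y; rewrite inE in yD => /(_ yD); rewrite ler_norml; lra.
under eq_fun do rewrite GE.
by apply: measurable_funB => //; exact: measurableT_comp.
Qed.

Definition image_measure d d' (T1 : measurableType d) (T2 : measurableType d')
    (R : realFieldType) (m : {measure set T1 -> \bar R}) (f : T1 -> T2)
    (mf : measurable_fun [set: T1] f) : {measure set T2 -> \bar R} :=
  measure_function_pushforward__canonical__measure_function_Measure m mf.

Section lebesgue_affine.
Context (R : realType).
Notation mu := (@lebesgue_measure R).

Lemma measurable_affine (r c : R) :
  measurable_fun [set: measurableTypeR R] (fun x : measurableTypeR R => r * x + c : measurableTypeR R).
Proof. by apply: measurable_funD => //; exact: measurable_funM. Qed.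

Lemma lebesgue_measure_affine (r c : R) (A : set (measurableTypeR R)) :
  0 < r -> measurable A ->
  mu ((fun x => r * x + c) @^-1` A) = (r^-1%:E * mu A)%E.
Proof.
move=> r0 mA; have rn0 : r != 0 by rewrite gt_eqF.
(* By uniqueness of Lebesgue measure it is enough that [r] times the image measure has the right
   value on half-open intervals. *)
pose p : {measure set (measurableTypeR R) -> \bar R} :=
  mscale (NngNum (ltW r0)) (image_measure mu (measurable_affine r c)).
have -> : mu A = p A.
  apply: lebesgue_measure_unique => // _ [[a b] _ <-].
  rewrite /p /= /mscale /= /pushforward /=.
  have -> : (fun x => r * x + c) @^-1` `]a, b] =
      `](a - c) / r, (b - c) / r]%classic.
    apply/seteqP; split=> x /=; rewrite !in_itv/= ltr_pdivrMr// ler_pdivlMr//;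
      by rewrite mulrC ltrBlDr lerBrDr.
  rewrite !lebesgue_measure_itv/= !lte_fin ltr_pM2r ?invr_gt0//.
  rewrite ltrD2r; case: ifPn => _; last by rewrite mule0.
  rewrite -EFinB -EFinM; congr EFin; rewrite -mulrBl mulrCA divff//; lra.
rewrite /p /= /mscale /= /pushforward muleA -EFinM mulVf// mul1e //.
Qed.

Lemma Rintegral_shift (D : set R) (f : R -> R) (c : R) : measurable D ->
  measurable_fun [set: measurableTypeR R] f ->
  \int[mu]_(x in (fun x => x + c) @^-1` D) f (x + c) = \int[mu]_(x in D) f x.
Proof.
move=> mD mf; rewrite /Rintegral; congr fine.
pose phi : {mfun measurableTypeR R >-> measurableTypeR R} :=
  mfun_Sub (mem_set (measurable_affine 1 c)).
have muE : forall A, measurable A -> A `<=` D -> mu A = pushforward mu phi A.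
  move=> A mA _; rewrite /pushforward /phi/=.
  by rewrite lebesgue_measure_affine// invr1 mul1e.
have mF : measurable_fun D (EFin \o f).
  by apply/measurable_EFinP; exact: measurable_funTS.
rewrite [RHS](eq_measure_integral (pushforward mu phi))//.
have -> : (fun x : R => x + c) = phi by apply/funext => x /=; rewrite mul1r.
rewrite [RHS]integralE [LHS]integralE.
rewrite !ge0_integral_pushforward//.
- congr (_ - _)%E; apply: eq_integral => x _ /=;
    by rewrite ?funeposE ?funenegE /= ?mul1r.
- exact: measurable_funeneg.
- exact: measurable_funepos.
Qed.

Lemma Rintegral_supp (D : set R) (f : R -> R) :
  (forall x, ~ D x -> f x = 0) -> \int[mu]_(x in D) f x = \int[mu]_x f x.
Proof.
move=> f0; rewrite Rintegral_mkcond; apply: eq_Rintegral => x _.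
rewrite /patch; case: ifPn => //; rewrite notin_setE => /f0 ->.
by rewrite /point.
Qed.

(** Translation invariance over a fixed window: both the function and its shift vanish outside [D],
    so nothing is lost at the boundary. *)
Lemma Rintegral_supp_shift (D : set R) (f : R -> R) (c : R) :
  measurable D -> measurable_fun [set: measurableTypeR R] f ->
  (forall x, ~ D x -> f x = 0) -> (forall x, ~ D x -> f (x + c) = 0) ->
  \int[mu]_(x in D) f (x + c) = \int[mu]_(x in D) f x.
Proof.
move=> mD mf f0 fc0.
rewrite (@Rintegral_supp D (fun x => f (x + c)))// (@Rintegral_supp D f)//.
by rewrite -(@Rintegral_shift setT f c).
Qed.

Lemma lebesgue_itv_lty (a b : R) (x y : bool) :
  (mu [set` Interval (BSide x a) (BSide y b)] < +oo)%E.
Proof. by rewrite lebesgue_measure_itv/=; case: ifP => _; rewrite ltry. Qed.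

Lemma fine_lebesgue_itv (a b : R) (x y : bool) : a <= b ->
  fine (mu [set` Interval (BSide x a) (BSide y b)]) = b - a.
Proof.
move=> ab; rewrite lebesgue_measure_itv/= lte_fin; case: ltP => //= ba.
by rewrite (le_anti (introT andP (conj ab ba))) subrr.
Qed.

(* The two windows overlap except on a set of measure at most [4 delta]. *)
Lemma Rintegral01_shift (psi : R -> R) (M s h z delta : R) :
  measurable_fun [set: measurableTypeR R] psi -> (forall x, `|psi x| <= M) ->
  0 <= h -> 0 <= delta -> h <= `|z| * delta \/ 1 <= delta ->
  `|\int[mu]_(v in `[0, 1]) (psi (s + h + z * v) - psi (s + z * v))| <=
    4 * M * delta.
Proof.
move=> mpsi psiM h0 d0 hd.
have M0 : 0 <= M := le_trans (normr_ge0 _) (psiM 0).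
have I1 : fine (mu (`[0, 1]%classic : set R)) = 1.
  by rewrite lebesgue_measure_itv/= lte_fin ltr01 /= subr0.
have maff a b : measurable_fun [set: measurableTypeR R]
    (fun v : measurableTypeR R => psi (a + b * v)).
  apply: measurableT_comp => //.
  by apply: measurable_funD => //; exact: measurable_funM.
have [d1|d1] := leP 1 delta.
  apply: (@le_trans _ _ (2 * M * 1)).
    rewrite -[X in _ * X]I1; apply: normr_Rintegral_le => //.
    - by rewrite lebesgue_itv_lty.
    - by apply: measurable_funB; exact: maff.
    - by move=> v _; rewrite (le_trans (ler_normB _ _))// mulr_natl mulr2n lerD.
  by rewrite -mulrA -[leRHS]mulrA mulr1; nra.
case: hd => hd; last by rewrite leNgt d1 in hd.
have [z0|z0] := eqVneq z 0.
  have -> : h = 0 by move: hd; rewrite z0 normr0 mul0r; lra.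
  under eq_Rintegral do rewrite addr0 subrr.
  by rewrite Rintegral_cst// mul0r normr0 !mulr_ge0.
(* A shift of the argument by [h] is a shift of [v] by [h / z]; for [z = 0] the hypothesis leaves
   only [h = 0]. *)
pose e := h / z.
have ed : `|e| <= delta.
  by rewrite /e normrM normfV ler_pdivrMr ?normr_gt0// mulrC ger0_norm.
pose chi v := psi (s + z * v).
have mchi : measurable_fun [set: measurableTypeR R] chi by exact: maff.
have int01 a b (x y : bool) (f : R -> R) : measurable_fun [set: measurableTypeR R] f ->
   (forall x, `|f x| <= M) ->
   mu.-integrable [set` Interval (BSide x a) (BSide y b)] (EFin \o f).
  move=> mf fM; apply: (bounded_integrable (M := M)) => //; exact: lebesgue_itv_lty.
rewrite RintegralB//; [|exact: int01..].
have -> : \int[mu]_(v in `[0, 1]) psi (s + h + z * v) = \int[mu]_(v in `[e, 1 + e]) chi v.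
  rewrite -(@Rintegral_shift _ chi e)//.
  have -> : (fun x : R => x + e) @^-1` `[e, 1 + e] = `[0, 1]%classic.
    by apply/seteqP; split=> x /=; rewrite !in_itv/=; lra.
  apply: eq_Rintegral => v _; rewrite /chi /e; congr psi.
  by field.
pose W : set (measurableTypeR R) := `[- delta, 1 + delta]%classic.
have mW : measurable W by exact: measurable_itv.
have Woo : (mu W < +oo)%E := lebesgue_itv_lty _ _ _ _.
have WE (A : set (measurableTypeR R)) : A `<=` W -> measurable A ->
    \int[mu]_(v in A) chi v = \int[mu]_(v in W) (chi v * \1_A v).
  move=> AW mA; rewrite -{1}(setIidr AW) Rintegral_mkcondr; apply: eq_Rintegral => v _.
  by rewrite /patch indicE; case: ifPn => _; rewrite ?mulr1 ?mulr0.
have mA (A : set (measurableTypeR R)) : measurable A -> measurable_fun [set: measurableTypeR R] (fun v => chi v * \1_A v).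
  by move=> mA; apply: measurable_funM => //; exact: measurable_indic.
have Ale (A : set (measurableTypeR R)) v : `|chi v * \1_A v| <= M.
  rewrite normrM indicE; case: (v \in A); rewrite ?normr1 ?mulr1 ?normr0 ?mulr0//.
  exact: psiM.
have := ed; rewrite ler_norml => /andP[ed1 ed2].
rewrite WE//; last by move=> v; rewrite /W /= !in_itv/=; lra.
rewrite [X in _ - X]WE//; last by move=> v; rewrite /W /= !in_itv/=; lra.
rewrite -RintegralB//; last 2 first.
- by apply: (bounded_integrable (M := M)) => //; exact: mA.
- by apply: (bounded_integrable (M := M)) => //; exact: mA.
pose C1 : set (measurableTypeR R) := `[- delta, delta]%classic.
pose C2 : set (measurableTypeR R) := `[1 - delta, 1 + delta]%classic.
have mC1 : measurable C1 by exact: measurable_itv.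
have mC2 : measurable C2 by exact: measurable_itv.
have iC (A : set (measurableTypeR R)) : measurable A -> mu.-integrable W (EFin \o (fun v => M * \1_A v)).
  move=> mA'; apply: (bounded_integrable (M := M)) => //.
    by apply: measurable_funM => //; exact: measurable_indic.
  move=> v _; rewrite normrM indicE ger0_norm//; case: (v \in A); rewrite ?normr1 ?mulr1 ?normr0 ?mulr0//.
apply: (@le_trans _ _ (\int[mu]_(v in W) (M * \1_C1 v + M * \1_C2 v))).
  have mAB (A B : set (measurableTypeR R)) : measurable A -> measurable B ->
      measurable_fun [set: measurableTypeR R] (fun v => chi v * \1_A v - chi v * \1_B v).
    by move=> mA1 mB; apply: measurable_funB; exact: mA.
  have iAB (A B : set (measurableTypeR R)) : measurable A -> measurable B ->
      mu.-integrable W (EFin \o (fun v => chi v * \1_A v - chi v * \1_B v)).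
    move=> mA1 mB; apply: (bounded_integrable (M := M + M)) => //; first exact: mAB.
    by move=> v _; rewrite (le_trans (ler_normB _ _))// lerD.
  apply: le_trans (le_normr_Rintegral _ _) _ => //; first exact: iAB.
  apply: le_Rintegral => //.
  - by apply: integrable_norm; exact: iAB.
  - exact: (integrableD mW (iC C1 mC1) (iC C2 mC2)).
  - move=> v; rewrite /W/= in_itv/= => /andP[v1 v2].
    rewrite -mulrBr normrM -mulrDr; apply: ler_pM => //; first exact: psiM.
    rewrite !indicE !mem_setE /C1 /C2 !in_itv/=.
    (* A point in exactly one of the two windows is within [delta] of an end point of [[0, 1]],
       because [e] is at most [delta] in absolute value. *)
    have C12 : (e <= v <= 1 + e) != (0 <= v <= 1) ->
        (1 : R) <= (- delta <= v <= delta)%R%:R + (1 - delta <= v <= 1 + delta)%R%:R.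
      have [vd _|vd] := leP v delta; first by rewrite v1/= lerDl.
      rewrite (_ : (1 - delta <= v <= 1 + delta) = (1 - delta <= v)); last first.
        by rewrite v2 andbT.
      rewrite andbF add0r; case: (leP (1 - delta) v) => [_ _//|vd1].
      have -> : e <= v <= 1 + e.
        by rewrite (le_trans ed2 (ltW vd))/= (le_trans (ltW vd1))// lerD2l.
      have -> : 0 <= v <= 1.
        by rewrite (le_trans d0 (ltW vd))/= (le_trans (ltW vd1))// lerBlDr lerDl.
      by rewrite eqxx.
    have [/eqP ->|ne] := boolP ((e <= v <= 1 + e) == (0 <= v <= 1)).
      by rewrite subrr normr0 addr_ge0.
    apply: le_trans (C12 _) => //.
    by case: (e <= v <= _); case: (0 <= v <= _); rewrite ?subrr ?subr0 ?sub0r ?normrN ?normr1 ?normr0.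
rewrite RintegralD//; [|exact: iC mC1|exact: iC mC2].
rewrite !RintegralZl//; last 2 first.
- by apply: (bounded_integrable (M := 1)) => // v _; rewrite indicE; case: (_ \in _); rewrite ?normr1 ?normr0.
- by apply: (bounded_integrable (M := 1)) => // v _; rewrite indicE; case: (_ \in _); rewrite ?normr1 ?normr0.
rewrite !Rintegral_indic// !setIidl; last 2 first.
- by move=> v; rewrite /W /C2/= !in_itv/=; lra.
- by move=> v; rewrite /W /C1/= !in_itv/=; lra.
have -> : fine (mu C1) = delta - - delta by apply: fine_lebesgue_itv; clear -d0; lra.
have -> : fine (mu C2) = 1 + delta - (1 - delta).
  by apply: fine_lebesgue_itv; clear -d0; lra.
by clear; lra.
Qed.

End lebesgue_affine.

(** * A set of reals of prescribed slowly increasing density *)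

Section ramp.
Context (R : realType).

Definition root10 (x : R) : R := (1 + x) `^ 10^-1.

Lemma root10X (x : R) : 0 <= x -> root10 x ^+ 10 = 1 + x.
Proof.
move=> x0; rewrite -powR_mulrn ?powR_ge0// /root10 -powRrM mulVf ?powRr1//.
by rewrite addr_ge0.
Qed.

Lemma le_root10 (x y : R) : 0 <= x -> x <= y -> root10 x <= root10 y.
Proof.
move=> x0 xy; apply: ge0_ler_powR; rewrite ?invr_ge0 ?nnegrE ?lerD2l//.
- by rewrite addr_ge0.
- by rewrite addr_ge0// (le_trans x0).
Qed.

Lemma root10_ge1 (x : R) : 0 <= x -> 1 <= root10 x.
Proof.
move=> x0; have -> : 1 = 1 `^ 10^-1 :> R by rewrite powR1.
apply: ge0_ler_powR; rewrite ?invr_ge0 ?nnegrE//; first by rewrite addr_ge0.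
by rewrite lerDl.
Qed.

Lemma root10V_incr (x y q : R) : 0 <= x -> x <= y -> root10 y <= q ->
  (y - x) / (10 * q ^+ 11) <= (root10 x)^-1 - (root10 y)^-1 <= y - x.
Proof.
move=> x0 xy yq; have y0 := le_trans x0 xy.
have := root10_ge1 x0; have := le_root10 x0 xy.
have -> : y - x = root10 y ^+ 10 - root10 x ^+ 10 by rewrite !root10X//; lra.
move: (root10 x) (root10 y) yq => a b bq ab a1.
have a0 : 0 < a by apply: lt_le_trans a1.
have b0 : 0 < b by apply: lt_le_trans ab.
have q0 : 0 < q by apply: lt_le_trans bq.
have -> : a^-1 - b^-1 = (b - a) / (a * b) by field; rewrite !gt_eqF.
rewrite subrXX; set s := \sum_(i < 10) _.
have s1 : 1 <= s.
  rewrite /s big_ord_recl/= expr0 mulr1 -[leLHS]addr0 lerD//.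
    by rewrite exprn_ege1// (le_trans a1).
  by apply: sumr_ge0 => i _; rewrite mulr_ge0 ?exprn_ge0 ?ltW.
have s10 : s <= 10 * q ^+ 9.
  have -> : 10 * q ^+ 9 = \sum_(i < 10) q ^+ 9.
    by rewrite sumr_const card_ord mulr_natl.
  apply: ler_sum => i _; have -> : q ^+ 9 = q ^+ (9 - i) * q ^+ i.
    by rewrite -exprD subnK// -ltnS.
  have [a0' b0' q0'] := And3 (ltW a0) (ltW b0) (ltW q0).
  apply: ler_pM; [exact: exprn_ge0|exact: exprn_ge0| |].
    by rewrite lerXn2r ?nnegrE.
  by rewrite lerXn2r ?nnegrE// (le_trans ab).
apply/andP; split.
- rewrite ler_pdivrMr ?mulr_gt0 ?exprn_gt0// mulrAC ler_pdivlMr ?mulr_gt0//.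
  rewrite -mulrA ler_wpM2l ?subr_ge0//.
  apply: (@le_trans _ _ (10 * q ^+ 9 * (q * q))); last first.
    by rewrite -mulrA -expr2 -exprD.
  apply: ler_pM; [exact: le_trans s1|by rewrite ltW// mulr_gt0|by []|].
  by apply: ler_pM => //; [exact: ltW|exact: ltW|exact: le_trans bq].
- rewrite ler_pdivrMr ?mulr_gt0// -mulrA ler_peMr ?subr_ge0//.
  by rewrite -[leLHS]mulr1 ler_pM// -[leLHS]mulr1 ler_pM// (le_trans a1).
Qed.

(* A slowly saturating sigmoid: its slope decays like [|s|^(-11/10)]. *)
Definition ramp (s : R) : R :=
  (1 - (root10 (Num.max s 0))^-1 + (root10 (Num.max (- s) 0))^-1) / 2.

Let ramp_aux (s : R) : 0 <= (root10 (Num.max s 0))^-1 <= 1.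
Proof.
have h : 1 <= root10 (Num.max s 0) by rewrite root10_ge1// le_max lexx orbT.
by rewrite invr_ge0 (le_trans _ h)//= invf_le1// (lt_le_trans _ h).
Qed.

Lemma ramp_ge0 s : 0 <= ramp s.
Proof. by rewrite /ramp; have := ramp_aux s; have := ramp_aux (- s); lra. Qed.

Lemma ramp_le1 s : ramp s <= 1.
Proof. by rewrite /ramp; have := ramp_aux s; have := ramp_aux (- s); lra. Qed.

Lemma measurable_ramp : measurable_fun [set: measurableTypeR R] ramp.
Proof.
have inv (f : measurableTypeR R -> R) : measurable_fun [set: measurableTypeR R] f ->
    measurable_fun [set: measurableTypeR R] (fun x => (root10 (f x))^-1).
  move=> mf; under eq_fun do rewrite /root10 -powRN.
  apply: (measurableT_comp (measurable_powR _)) => //.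
  exact: measurable_funD.
have mm (f : measurableTypeR R -> R) : measurable_fun [set: measurableTypeR R] f ->
    measurable_fun [set: measurableTypeR R] (fun x => Num.max (f x) 0).
  by move=> mf; exact: measurable_maxr.
apply: measurable_funM => //; apply: measurable_funD.
  by apply: measurable_funB => //; exact: (inv _ (mm _ (@measurable_id _ _ _))).
by apply: (inv (fun x => Num.max (- x) 0)); apply: (mm (fun x => - x)); exact: oppr_measurable.
Qed.

(** Positive and negative parts of [s] and [t] are treated separately by [root10V_incr]; the
    division by 2 in [ramp] turns the 10 into 20. *)
Lemma ramp_incr (rho s t : R) : s <= t -> `|s| <= rho -> `|t| <= rho ->
  (t - s) / (20 * root10 rho ^+ 11) <= ramp t - ramp s <= t - s.
Proof.
move=> st sr tr; have r0 : 0 <= rho := le_trans (normr_ge0 _) sr.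
have q1 := root10_ge1 r0.
have H1 : root10 (Num.max t 0) <= root10 rho.
  by apply: le_root10; rewrite ?le_max ?lexx ?orbT// ge_max r0 (le_trans (ler_norm _)).
have H2 : root10 (Num.max (- s) 0) <= root10 rho.
  by apply: le_root10; rewrite ?le_max ?lexx ?orbT// ge_max r0 (le_trans (ler_norm _))// normrN.
have h0 (u : R) : 0 <= Num.max u 0 by rewrite le_max lexx orbT.
have mon (u v : R) : u <= v -> Num.max u 0 <= Num.max v 0.
  by move=> uv; rewrite ge_max !le_max uv lexx !orbT.
have E (u : R) : Num.max u 0 - Num.max (- u) 0 = u.
  by case: (leP 0 u) => ?; case: (leP 0 (- u)) => ?; lra.
have := root10V_incr (h0 s) (mon _ _ st) H1.
have := @root10V_incr (Num.max (- t) 0) (Num.max (- s) 0) _ (h0 _) (mon _ _ _) H2.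
rewrite lerN2 => /(_ st).
have -> : 20 * root10 rho ^+ 11 = 2 * (10 * root10 rho ^+ 11) by ring.
have : 0 < 10 * root10 rho ^+ 11 by rewrite mulr_gt0// exprn_gt0//; lra.
have Ets : t - s = (Num.max t 0 - Num.max (- t) 0) - (Num.max s 0 - Num.max (- s) 0).
  by rewrite !E.
move=> k0 h1 h2; have h3 : 0 <= t - s by rewrite subr_ge0.
move: k0 h1 h2 h3; rewrite /ramp Ets => {Ets E mon h0 H1 H2}.
set k := 10 * _; have -> : (2 * k)^-1 = 2^-1 * k^-1 by rewrite invfM.
set a : R := Num.max t 0; set b : R := Num.max (- t) 0.
set c : R := Num.max s 0; set e : R := Num.max (- s) 0.
move: (root10 a)^-1 (root10 b)^-1 (root10 c)^-1 (root10 e)^-1 => ra rb rc re.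
move: a b c e k^-1 => a b c e i _ /andP[h1 h2] /andP[h3 h4] h0.
by clear -h0 h1 h2 h3 h4; apply/andP; split; lra.
Qed.
End ramp.

(** * Prescribing the mass of a set cell by cell *)

Section cells.
Context (R : realType).
Notation mu := (@lebesgue_measure R).
Variables (g : R -> R) (N : int -> nat).
Hypothesis mg : measurable_fun [set: measurableTypeR R] g.
Hypothesis g0 : forall x, 0 <= g x.
Hypothesis g1 : forall x, g x <= 1.
Hypothesis N0 : forall j, (0 < N j)%N.

Let len (j : int) : R := (N j)%:R^-1.
Let pt (j : int) (k : nat) : R := j%:~R + k%:R * len j.
Let idx (s : R) : nat := Num.truncn ((s - (Num.floor s)%:~R) * (N (Num.floor s))%:R).
Let lo (s : R) : R := pt (Num.floor s) (idx s).
Let mass (j : int) (k : nat) : R := \int[mu]_(x in `[pt j k, pt j k.+1[) g x.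
(** In each cell [S] is an initial segment whose length is the mass of [g] there, which fits because
    [g <= 1]. Segments closed on the left and open on the right make the indicator locally constant
    to the right. *)
Let S : set (measurableTypeR R) := [set s | s < lo s + mass (Num.floor s) (idx s)].
Let w (x : R) : R := \1_S x - g x.
Let Z (a b : R) : R := \int[mu]_(x in `[a, b[) w x.

Let NR0 j : 0 < (N j)%:R :> R. Proof. by rewrite ltr0n. Qed.

Let len_gt0 j : 0 < len j. Proof. by rewrite invr_gt0. Qed.

Let ptS j k : pt j k.+1 = pt j k + len j.
Proof. by rewrite /pt -addrA mulrSr mulrDl mul1r. Qed.

Let pt0 j : pt j 0 = j%:~R. Proof. by rewrite /pt mul0r addr0. Qed.

Let ptN j : pt j (N j) = (j + 1)%:~R.
Proof. by rewrite /pt /len divff ?gt_eqF// intrD. Qed.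

Let frac_bounds (s : R) : 0 <= s - (Num.floor s)%:~R < 1.
Proof. by have := floor_itv s; rewrite intrD; lra. Qed.

Let idx_lt s : (idx s < N (Num.floor s))%N.
Proof.
have /andP[h0 h1] := frac_bounds s.
by rewrite truncn_lt_nat ?mulr_ge0// gtr_pMl.
Qed.

Let lo_bounds s : lo s <= s < lo s + len (Num.floor s).
Proof.
have /andP[h0 h1] := frac_bounds s.
have := @truncn_itv _ ((s - (Num.floor s)%:~R) * (N (Num.floor s))%:R).
rewrite mulr_ge0// => /(_ isT) /andP[h2 h3].
rewrite /lo -ptS /pt -lerBrDl ler_pdivrMr// h2/= -ltrBlDl.
by rewrite ltr_pdivlMr.
Qed.

Let cell_lo j k x : (k < N j)%N -> pt j k <= x < pt j k.+1 ->
  Num.floor x = j /\ idx x = k.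
Proof.
move=> kN /andP[h1 h2].
have fx : Num.floor x = j.
  apply: floor_def; apply/andP; split.
    by apply: le_trans h1; rewrite /pt lerDl mulr_ge0// ltW.
  apply: lt_le_trans h2 _; rewrite -ptN /pt lerD2l ler_wpM2r ?ler_nat//.
  exact: ltW.
split=> //; rewrite /idx fx; apply: truncn_def.
move: h1 h2; rewrite /pt -lerBrDl -ltrBlDl.
by rewrite ler_pdivrMr// ltr_pdivlMr// => -> ->.
Qed.

Let mitv (a b : R) : measurable (`[a, b[%classic : set (measurableTypeR R)).
Proof. exact: measurable_itv. Qed.

Let gM D : measurable D -> (mu D < +oo)%E -> mu.-integrable D (EFin \o g).
Proof.
move=> mD Doo; apply: (bounded_integrable (M := 1)) => // x _.
by rewrite ger0_norm.
Qed.

Let mass_bounds j k : 0 <= mass j k <= len j.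
Proof.
rewrite Rintegral_ge0//=.
have -> : len j = 1 * fine (mu `[pt j k, pt j k.+1[).
  rewrite fine_lebesgue_itv ptS ?lerDl ?ltW//; first by rewrite mul1r addrC addKr.
rewrite -Rintegral_cst//; apply: le_Rintegral => //.
- by apply: gM => //; exact: lebesgue_itv_lty.
- apply: (bounded_integrable (M := 1)) => //; first exact: lebesgue_itv_lty.
  by move=> x _; rewrite normr1.
Qed.

Let cellS j k : (k < N j)%N ->
  S `&` `[pt j k, pt j k.+1[ = `[pt j k, pt j k + mass j k[%classic.
Proof.
move=> kN; have /andP[m0 ml] := mass_bounds j k.
apply/seteqP; split=> x /=; rewrite !in_itv/=.
  move=> [Sx xc]; have [fx ix] := cell_lo kN xc.
  by move: Sx; rewrite /S/= /lo fx ix => ->; case/andP: xc => ->.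
move=> /andP[h1 h2].
have xc : pt j k <= x < pt j k.+1 by rewrite h1 (lt_le_trans h2)// ptS lerD2l.
by split=> //; have [fx ix] := cell_lo kN xc; rewrite /S/= /lo fx ix.
Qed.

Let measurable_S : measurable S.
Proof.
pose F (p : int * nat) : set (measurableTypeR R) :=
  if (p.2 < N p.1)%N then `[pt p.1 p.2, pt p.1 p.2 + mass p.1 p.2[%classic
  else set0.
have -> : S = \bigcup_p F p.
  apply/seteqP; split=> [x Sx|x [[j k] _]].
    exists (Num.floor x, idx x) => //; rewrite /F idx_lt/= in_itv/=.
    by have /andP[-> _] := lo_bounds x.
  by rewrite /F/=; case: ifPn => // kN; rewrite -cellS// => -[].
apply: countable_bigcupT_measurable => // -[j k]; rewrite /F.
by case: ifPn.
Qed.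

Let mw : measurable_fun [set: measurableTypeR R] w.
Proof. by apply: measurable_funB => //; exact: measurable_indic. Qed.

Let wM x : `|w x| <= 1.
Proof.
rewrite /w ler_norml indicE; have := g0 x; have := g1 x.
by case: (_ \in _) => /=; lra.
Qed.

Let wint (a b : R) : mu.-integrable `[a, b[ (EFin \o w).
Proof.
by apply: (bounded_integrable (M := 1)) => //; exact: lebesgue_itv_lty.
Qed.

Let ZD (a b c : R) : a <= b -> b <= c -> Z a c = Z a b + Z b c.
Proof.
move=> ab bc; rewrite /Z (@itv_bndbnd_setU _ _ _ (BLeft b)) ?bnd_simp//.
rewrite Rintegral_setU//.
  by rewrite -itv_bndbnd_setU ?bnd_simp//; exact: wint.
apply/disj_setPS => x /= []; rewrite !in_itv/= => /andP[_ xb] /andP[bx _].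
by move: (le_lt_trans bx xb); rewrite ltxx.
Qed.

Let Zle (a b : R) : a <= b -> `|Z a b| <= b - a.
Proof.
move=> ab; rewrite -[leRHS]mul1r -(fine_lebesgue_itv true true ab).
by apply: normr_Rintegral_le => //; exact: lebesgue_itv_lty.
Qed.

Let Z0 (a : R) : Z a a = 0.
Proof. by apply/normr0_eq0/le_anti; rewrite normr_ge0 (le_trans (Zle _))// subrr. Qed.

Let Zcell j k : (k < N j)%N -> Z (pt j k) (pt j k.+1) = 0.
Proof.
move=> kN; rewrite /Z /w RintegralB//; last 2 first.
- apply: (bounded_integrable (M := 1)) => //; first exact: lebesgue_itv_lty.
  by move=> x _; rewrite indicE; case: (_ \in _); rewrite ?normr1 ?normr0.
- by apply: gM => //; exact: lebesgue_itv_lty.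
rewrite Rintegral_indic// cellS// fine_lebesgue_itv.
  by rewrite (addrC (pt j k)) addrK subrr.
by have /andP[m0 _] := mass_bounds j k; rewrite lerDl.
Qed.

Let pt_le j k : j%:~R <= pt j k.
Proof. by rewrite /pt lerDl mulr_ge0// ltW. Qed.

Let Zpt j k : (k <= N j)%N -> Z j%:~R (pt j k) = 0.
Proof.
elim: k => [_|k IH kN]; first by rewrite pt0 Z0.
rewrite (@ZD _ (pt j k))// ?IH ?Zcell ?addr0//; first exact: ltnW.
by rewrite ptS lerDl ltW.
Qed.

Let Zint j (n : nat) : Z j%:~R (j + n%:Z)%:~R = 0.
Proof.
elim: n => [|n IH]; first by rewrite addr0 Z0.
rewrite (@ZD _ (j + n%:Z)%:~R) ?ler_int ?IH; [|lia..].
have -> : j + n.+1%:Z = j + n%:Z + 1 by lia.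
by rewrite -ptN Zpt// addr0.
Qed.

(** Every complete cell between [j] and [s] has error zero, so only the cell containing [s]
    contributes, whatever the base point [j]. *)
Let Zlo (j : int) s : j <= Num.floor s -> Z j%:~R s = Z (lo s) s.
Proof.
move=> js; have /andP[h1 h2] := lo_bounds s.
rewrite (@ZD _ (Num.floor s)%:~R) ?ler_int ?floor_le//.
have -> : Num.floor s = j + `|Num.floor s - j|%N%:Z by lia.
rewrite Zint add0r.
have <- : Num.floor s = j + `|Num.floor s - j|%N%:Z by lia.
rewrite (@ZD _ (lo s))//; last exact: pt_le.
by rewrite Zpt ?add0r// ltnW.
Qed.

Let Zlo_le s : `|Z (lo s) s| <= len (Num.floor s).
Proof.
have /andP[h1 h2] := lo_bounds s.
by rewrite (le_trans (Zle _))// lerBlDl ltW.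
Qed.

Let Zbound s s' : s <= s' -> `|Z s s'| <= len (Num.floor s) + len (Num.floor s').
Proof.
move=> ss'.
have -> : Z s s' = Z (lo s') s' - Z (lo s) s.
  rewrite -(@Zlo (Num.floor s) s)// -(@Zlo (Num.floor s) s') ?le_floor//.
  by rewrite (@ZD (Num.floor s)%:~R s s') ?floor_le// addrAC subrr add0r.
by rewrite (le_trans (ler_normB _ _))// addrC lerD.
Qed.

Let S_rcont s : exists2 delta, 0 < delta &
  forall v, 0 <= v < delta -> \1_S (s + v) = \1_S s :> R.
Proof.
have /andP[h1 h2] := lo_bounds s.
have key v : 0 <= v -> s + v < lo s + len (Num.floor s) ->
    Num.floor (s + v) = Num.floor s /\ idx (s + v) = idx s.
  move=> v0 hv; apply: cell_lo; first exact: idx_lt.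
  by rewrite ptS hv andbT (le_trans h1)// lerDl.
have [Ss|nSs] := pselect (S s).
  exists (lo s + mass (Num.floor s) (idx s) - s); first by rewrite subr_gt0.
  move=> v /andP[v0 vd]; rewrite !indicE !mem_set//.
  have := mass_bounds (Num.floor s) (idx s) => /andP[m0 m1].
  have [f1 f2] : Num.floor (s + v) = Num.floor s /\ idx (s + v) = idx s.
    by apply: key => //; lra.
  by rewrite /S/= /lo f1 f2; rewrite -/(lo s); lra.
exists (lo s + len (Num.floor s) - s); first by rewrite subr_gt0.
move=> v /andP[v0 vd]; rewrite !indicE !memNset// => Sv; apply: nSs.
have [f1 f2] : Num.floor (s + v) = Num.floor s /\ idx (s + v) = idx s.
  by apply: key => //; lra.
move: Sv; rewrite /S/= /lo f1 f2; rewrite -/(lo s); lra.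
Qed.

(* In each cell of length [1 / N j] of the interval [[j, j + 1[] the set has
   the mass prescribed by [g], so the errors do not accumulate. *)
Lemma cell_set : exists A : set (measurableTypeR R), [/\ measurable A,
  forall s, exists2 delta, 0 < delta &
    forall v, 0 <= v < delta -> \1_A (s + v) = \1_A s :> R &
  forall s s', s <= s' -> `|\int[mu]_(x in `[s, s'[) (\1_A x - g x)| <=
    (N (Num.floor s))%:R^-1 + (N (Num.floor s'))%:R^-1].
Proof. by exists S; split. Qed.

End cells.

Lemma density_set (R : realType) (g : R -> R) (e : R) (n : nat) :
  measurable_fun [set: measurableTypeR R] g ->
  (forall x, 0 <= g x) -> (forall x, g x <= 1) -> 0 < e ->
  exists A : set (measurableTypeR R), [/\ measurable A,
    forall s, exists2 delta, 0 < delta &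
      forall v, 0 <= v < delta -> \1_A (s + v) = \1_A s :> R &
    forall s s', s <= s' ->
      `|\int[lebesgue_measure]_(x in `[s, s'[) (\1_A x - g x)| <=
      e / (1 + `|s|) ^+ n + e / (1 + `|s'|) ^+ n].
Proof.
move=> mg g0 g1 e0; pose L := (Num.truncn e^-1).+1.
(* Since [x] is less than 1 away from its floor, [1 + |x|] is at most 2 plus the absolute value of
   the floor; the factor [L], larger than [1/e], provides the [e] of the bound. *)
pose N (j : int) := (L * (2 + `|j|) ^ n)%N.
have N0 j : (0 < N j)%N by rewrite muln_gt0/= expn_gt0.
have [A [mA rA AZ]] := cell_set mg g0 g1 N0; exists A; split=> // s s' ss'.
apply: le_trans (AZ _ _ ss') _.
suff len_le x : (N (Num.floor x))%:R^-1 <= e / (1 + `|x|) ^+ n by rewrite lerD.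
have x1 : 0 < 1 + `|x| by rewrite ltr_pwDl.
have L1 : e^-1 <= L%:R by rewrite ltW// truncnS_gt.
rewrite -[e]invrK -invfM lef_pV2 ?posrE ?mulr_gt0 ?invr_gt0 ?exprn_gt0 ?ltr0n//.
have e0' : 0 <= e^-1 by rewrite invr_ge0 ltW.
have x0' := ltW x1.
rewrite /N natrM natrX; apply: ler_pM => //.
rewrite lerXn2r ?nnegrE// natrD natr_absz.
have := floor_itv x; rewrite intrD intr_norm.
set f := (Num.floor x)%:~R; clear; move=> /andP[h1 h2].
have -> : 2 = 1 + 1 :> R by ring.
rewrite -addrA lerD2l.
rewrite ler_norml; have := ler_norm f; have := ler_norm (- f); rewrite normrN; lra.
Qed.

(** * Strictly increasing test functions from a smoothing estimate *)

Lemma lt_quarter_half (R : realFieldType) (x y z : R) :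
  x <= z / 4 -> y <= z / 2 -> 0 < z -> x + y < z.
Proof. by lra. Qed.

Lemma lt_of_perturbation (R : realFieldType) (f f' p p' x y : R) :
  - x <= f' - p' - (f - p) -> y <= p' - p -> x < y -> f < f'.
Proof. by lra. Qed.

(** * Right continuity and the passage from dyadic steps to all shifts *)

Section right_continuity.
Context (R : realType).
Implicit Types (Q : R -> R).

(** The sequential form is the one that dominated convergence transfers to averages. *)
Definition right_continuous Q := forall t (x : nat -> R),
  (forall n, 0 <= x n) -> x @ \oo --> (0 : R) -> (fun n => Q (t + x n)) @ \oo --> Q t.

Lemma right_continuousB Q1 Q2 : right_continuous Q1 -> right_continuous Q2 ->
  right_continuous (fun t => Q1 t - Q2 t).
Proof. by move=> h1 h2 t x x0 xl; apply: cvgB; [exact: h1|exact: h2]. Qed.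

Lemma right_continuousN Q : right_continuous Q -> right_continuous (fun t => - Q t).
Proof. by move=> h t x x0 xl; apply: cvgN; exact: h. Qed.

Lemma lipschitz_right_continuous Q :
  (forall s t, s <= t -> `|Q t - Q s| <= t - s) -> right_continuous Q.
Proof.
move=> lipQ t x x0 xl; apply/cvgrPdist_le => e e0.
move/cvgrPdist_le : xl => /(_ _ e0); apply: filterS => n.
rewrite sub0r normrN => xe; rewrite distrC (le_trans (lipQ _ _ _)) ?lerDl//.
by rewrite addrAC subrr add0r (le_trans (ler_norm _)).
Qed.

Lemma locally_constant_right_continuous Q :
  (forall s, exists2 delta, 0 < delta & forall v, 0 <= v < delta -> Q (s + v) = Q s) ->
  right_continuous Q.
Proof.
move=> h t x x0 xl; apply/cvgrPdist_le => e e0.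
have [delta d0 hd] := h t.
move/cvgrPdist_lt : xl => /(_ _ d0); apply: filterS => n.
rewrite sub0r normrN => xe.
have -> : Q (t + x n) = Q t by rewrite hd// x0/= (le_lt_trans (ler_norm _)).
by rewrite subrr normr0 ltW.
Qed.

Lemma cvg_expV2 (c : R) : (fun n => c * 2^-1 ^+ n) @ \oo --> (0 : R).
Proof.
rewrite -[X in _ --> X](mulr0 c); apply: cvgM; first exact: cvg_cst.
by apply: cvg_expr; rewrite ger0_norm ?invr_ge0// invf_lt1// ltr1n.
Qed.

(* The end point is approached from the right by multiples of the step. *)
Lemma dyadic_increments Q (a b c r : R) (m0 : nat) :
  right_continuous Q -> 0 < r ->
  (forall t m, a <= t -> t <= b -> (m0 <= m)%N ->
    Q (t + r * 2^-1 ^+ m) <= Q t + c * 2^-1 ^+ m) ->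
  forall t v, 0 <= v -> a <= t -> t + v <= b -> Q (t + v) <= Q t + c * (v / r).
Proof.
move=> rQ r0 hQ t v v0 at_ tvb.
pose h (m : nat) : R := 2^-1 ^+ m.
have h0 m : 0 < h m by rewrite exprn_gt0.
(* The successor makes the last multiple overshoot [v], by at most one step; the hypothesis is used
   only at the earlier multiples, which do not pass [b]. *)
pose k m := (Num.truncn (v / (r * h m))).+1.
have kbounds m : (k m)%:R * (r * h m) - r * h m <= v <= (k m)%:R * (r * h m).
  have rh0 : 0 < r * h m by rewrite mulr_gt0.
  have := @truncn_itv _ (v / (r * h m)).
  rewrite (divr_ge0 v0 (ltW rh0)) => /(_ isT) /andP[].
  rewrite ler_pdivlMr// ltr_pdivrMr// => h1 h2.
  by rewrite (ltW h2) andbT /k mulrSr mulrDl mul1r addrK.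
have step m : (m0 <= m)%N -> forall i, (i <= k m)%N ->
    Q (t + i%:R * (r * h m)) <= Q t + c * (i%:R * h m).
  move=> m0m; elim => [_|i IH ik]; first by rewrite !mul0r mulr0 !addr0.
  have tib : t + i%:R * (r * h m) <= b.
    apply: le_trans tvb; rewrite lerD2l.
    have /andP[h1 _] := kbounds m; apply: le_trans h1.
    rewrite lerBrDr -[X in _ + X]mul1r -mulrDl natr1 ler_wpM2r ?ler_nat//.
    by rewrite mulr_ge0// ltW.
  have ati : a <= t + i%:R * (r * h m).
    by rewrite (le_trans at_)// lerDl !mulr_ge0// ltW.
  have := hQ _ m ati tib m0m; have := IH (ltnW ik).
  have -> : t + i.+1%:R * (r * h m) = t + i%:R * (r * h m) + r * 2^-1 ^+ m.
    by rewrite -natr1 /h; ring.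
  have -> : c * (i.+1%:R * h m) = c * (i%:R * h m) + c * 2^-1 ^+ m.
    by rewrite -natr1 /h; ring.
  lra.
pose x m := (k (m + m0)%N)%:R * (r * h (m + m0)%N) - v.
have x0 m : 0 <= x m by have := kbounds (m + m0)%N; rewrite /x; lra.
have hl : (fun m => r * h (m + m0)%N) @ \oo --> (0 : R).
  have -> : (fun m => r * h (m + m0)%N) = (fun m => r * 2^-1 ^+ m0 * 2^-1 ^+ m).
    by apply/funext => m; rewrite /h exprD; ring.
  exact: cvg_expV2.
have xl : x @ \oo --> (0 : R).
  apply: (@squeeze_cvgr _ _ _ _ (fun=> 0) (fun m => r * h (m + m0)%N)) => //.
    apply: nearW => m; rewrite x0/=.
    by have := kbounds (m + m0)%N; rewrite /x; lra.
  exact: cvg_cst.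
have Ql := rQ (t + v) x x0 xl.
have Rl : (fun m => Q t + c * ((v + x m) / r)) @ \oo --> Q t + c * (v / r).
  apply: cvgD; first exact: cvg_cst.
  apply: cvgM; first exact: cvg_cst.
  apply: cvgM; last exact: cvg_cst.
  rewrite -[X in _ --> X]addr0; apply: cvgD => //; exact: cvg_cst.
apply: (ler_cvg_to Ql Rl); apply: nearW => m.
have := step (m + m0)%N (leq_addl _ _) _ (leqnn _).
rewrite /x; have -> : t + v + ((k (m + m0)%N)%:R * (r * h (m + m0)%N) - v) = t + (k (m + m0)%N)%:R * (r * h (m + m0)%N) by ring.
move=> /le_trans; apply; rewrite le_eqVlt; apply/orP; left; apply/eqP.
by congr (_ + c * _); field; rewrite gt_eqF.
Qed.

End right_continuity.

(** * Averages against the image of a finite measure under a bounded function *)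

Section one_dim.
Context d (X : measurableType d) (R : realType).
Variables (mu : {sigma_finite_measure set X -> \bar R}) (D : set X) (l : X -> R).
Variable C : R.
Hypotheses (mD : measurable D) (Doo : (mu D < +oo)%E).
Hypothesis ml : measurable_fun [set: X] (l : X -> measurableTypeR R).
Hypothesis lC : forall x, D x -> `|l x| <= C.
Local Notation lam := (@lebesgue_measure R).
Local Notation mR := (measurableTypeR R).

Let M := fine (mu D).
Let P (phi : R -> R) := \int[mu]_(x in D) phi (l x).
Let bm (phi : R -> R) := measurable_fun [set: mR] phi /\ exists K, forall x, `|phi x| <= K.

Let M0 : 0 <= M. Proof. by rewrite fine_ge0. Qed.

Let Pint phi : bm phi -> mu.-integrable D (EFin \o (fun x => phi (l x))).
Proof.
move=> [mphi [K hK]]; apply: (bounded_integrable (M := K)) => //.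
exact: (measurableT_comp mphi ml).
Qed.

Let bmB phi psi : bm phi -> bm psi -> bm (fun x => phi x - psi x).
Proof.
move=> [m1 [K1 h1]] [m2 [K2 h2]]; split; first exact: measurable_funB.
by exists (K1 + K2) => x; rewrite (le_trans (ler_normB _ _))// lerD.
Qed.

Let bmZ c phi : bm phi -> bm (fun x => c * phi x).
Proof.
move=> [m1 [K1 h1]]; split; first exact: measurable_funM.
by exists (`|c| * K1) => x; rewrite normrM ler_wpM2l.
Qed.

Let bm_affine phi a b : bm phi -> bm (fun x => phi (a + b * x)).
Proof.
move=> [m1 [K1 h1]]; split; last by exists K1.
apply: (measurableT_comp m1).
by apply: measurable_funD => //; exact: measurable_funM.
Qed.

Let bm_shift phi a : bm phi -> bm (fun x => phi (x + a)).
Proof.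
move=> /(@bm_affine _ a 1); congr bm; apply/funext => x; congr phi; ring.
Qed.

Let PB phi psi : bm phi -> bm psi -> P (fun x => phi x - psi x) = P phi - P psi.
Proof. by move=> h1 h2; rewrite /P RintegralB//; exact: Pint. Qed.

Let PZ c phi : bm phi -> P (fun x => c * phi x) = c * P phi.
Proof. by move=> h1; rewrite /P RintegralZl//; exact: Pint. Qed.

Let Pnorm phi K : bm phi -> (forall x, `|x| <= C -> `|phi x| <= K) -> `|P phi| <= K * M.
Proof.
move=> [m1 _] hK; apply: normr_Rintegral_le => //; first exact: (measurableT_comp m1 ml).
by move=> x /lC /hK.
Qed.

Let Pge phi c : bm phi -> (forall x, `|x| <= C -> c <= phi x) -> c * M <= P phi.
Proof.
move=> h hc; rewrite -Rintegral_cst//; apply: le_Rintegral => //; last first.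
- by move=> x /lC /hc.
- exact: Pint.
- by apply: (bounded_integrable (M := `|c|)).
Qed.

Let P_rc phi r : bm phi -> right_continuous phi ->
  right_continuous (fun t => P (fun s => phi (t + r * s))).
Proof.
move=> bphi rphi t x x0 xl.
have [mphi [K hK]] := bphi.
pose f_ n y := (phi (t + x n + r * l y))%:E.
pose f y := (phi (t + r * l y))%:E.
have mf_ n : measurable_fun D (f_ n).
  have [m1 _] := bm_affine (t + x n) r bphi.
  by apply/measurable_EFinP/measurable_funTS/(measurableT_comp m1 ml).
have mf : measurable_fun D f.
  have [m1 _] := bm_affine t r bphi.
  by apply/measurable_EFinP/measurable_funTS/(measurableT_comp m1 ml).
have [] := @dominated_convergence _ _ _ mu D mD f_ f (fun=> K%:E).
- by [].
- by [].
- apply: aeW => y Dy; apply/cvg_EFin; first exact: nearW.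
  rewrite /f_ /f /=.
  have -> : fine \o (fun n => (phi (t + x n + r * l y))%:E) = fun n => phi (t + r * l y + x n).
    by apply/funext => n /=; congr phi; ring.
  exact: rphi.
- apply: (bounded_integrable (M := `|K|)) => //.
- by apply: aeW => y n Dy; rewrite lee_fin.
move=> if_ _ cvP.
have -> : (fun n => P (fun s => phi (t + x n + r * s))) = (fun n => fine (\int[mu]_(y in D) f_ n y)%E) by [].
apply: fine_cvg; rewrite fineK//.
exact: integrable_fin_num.
Qed.

Variable A : R.
Hypothesis A0 : 0 <= A.
(** The ratio 2/5 is below the ratio 1/2 of the steps, which makes rescaled first differences
    converge. Uniformity in [phi] allows dilated and translated functions, with [A] independent of
    the dilation. *)
Hypothesis Reg : forall (n : nat) (phi : R -> R), measurable_fun [set: mR] phi ->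
  (forall x, `|phi x| <= 1) ->
  `|P (fun s => phi (s + 2 * 2^-1 ^+ n) - 2 * phi (s + 2^-1 ^+ n) + phi s)| <= A * (2 / 5) ^+ n.

Section first_difference.
Variable phi : R -> R.
Hypothesis mphi : measurable_fun [set: mR] phi.
Hypothesis phi1 : forall x, `|phi x| <= 1.

Let bphi : bm phi. Proof. by split=> //; exists 1. Qed.

Let delta n := P (fun s => phi (s + 2^-1 ^+ n) - phi s).

(** The left side is the second difference with half the step, up to the rearrangement of three
    values of [phi]. *)
Let delta_step n : `|delta n - 2 * delta n.+1| <= A * (2 / 5) ^+ n.+1.
Proof.
apply: le_trans (Reg n.+1 mphi phi1).
rewrite /delta -PZ; last by apply: bmB => //; exact: bm_shift.
rewrite -PB; [|by apply: bmB => //; exact: bm_shift|by apply/bmZ/bmB => //; exact: bm_shift].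
rewrite le_eqVlt; apply/orP; left; apply/eqP; congr `|P _|; apply/funext => s.
have -> : 2 * 2^-1 ^+ n.+1 = 2^-1 ^+ n :> R by rewrite exprS mulrA divff// mul1r.
ring.
Qed.

(** Telescoping: after multiplication by [2^j], consecutive scales differ by at most [A (4/5)^j],
    and 5 is the sum of the powers of 4/5. *)
Lemma first_difference_tail n m : (n <= m)%N ->
  `|2 ^+ m * delta m - 2 ^+ n * delta n| <= 5 * A * (4 / 5) ^+ n.
Proof.
move=> /subnKC <-; move: (m - n)%N => k {m}.
(* The subtracted power makes the induction close, as [5 ((4/5)^j - (4/5)^(j+1)) = (4/5)^j]. *)
suff H : `|2 ^+ (n + k) * delta (n + k) - 2 ^+ n * delta n| <=
    5 * A * ((4 / 5) ^+ n - (4 / 5) ^+ (n + k)).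
  apply: le_trans H _; rewrite ler_wpM2l ?mulr_ge0// gerBl exprn_ge0//.
elim: k => [|k IH]; first by rewrite !addn0 !subrr normr0 mulr0.
set u := 2 ^+ (n + k) * delta (n + k) in IH.
apply: (le_trans (ler_distD u _ _)).
have : `|2 ^+ (n + k.+1) * delta (n + k.+1) - u| <= A * (4 / 5) ^+ (n + k).
  rewrite /u addnS distrC exprS -mulrA (mulrCA 2) -mulrBr normrM ger0_norm ?exprn_ge0//.
  apply: (@le_trans _ _ (2 ^+ (n + k) * (A * (2 / 5) ^+ (n + k).+1))).
    by rewrite ler_wpM2l ?exprn_ge0// delta_step.
  have -> : 2 ^+ (n + k) * (A * (2 / 5) ^+ (n + k).+1) = (2 / 5) * (A * (4 / 5) ^+ (n + k)).
    have -> : (4 / 5 : R) = 2 * (2 / 5) by field.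
    rewrite [in RHS]exprMn [in LHS]exprS.
    by move: (2 ^+ (n + k)) ((2 / 5) ^+ (n + k)) => x y; ring.
  have : 0 <= A * (4 / 5) ^+ (n + k) by rewrite mulr_ge0 ?exprn_ge0.
  by move=> h; rewrite ler_piMl//; lra.
have -> : (4 / 5 : R) ^+ (n + k.+1) = 4 / 5 * (4 / 5) ^+ (n + k) by rewrite addnS exprS.
move: IH; set v := (4 / 5) ^+ (n + k); set v0 := (4 / 5) ^+ n.
nra.
Qed.

(** Comparison with the scale 0, where the trivial bound [2 M] is available: translates of the image
    measure depend on the shift in a Lipschitz way. *)
Lemma first_difference_le n : `|delta n| <= (2 * M + 5 * A) * 2^-1 ^+ n.
Proof.
have := first_difference_tail (leq0n n); rewrite !expr0 mul1r mulr1 => h.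
have d0 : `|delta 0| <= 2 * M.
  apply: Pnorm; first by apply: bmB => //; exact: bm_shift.
  by move=> x _; rewrite (le_trans (ler_normB _ _))// -[2]/(1 + 1) lerD.
rewrite exprVn ler_pdivlMr ?exprn_gt0// mulrC -[X in X * _ <= _]ger0_norm ?exprn_ge0//.
rewrite -normrM -[X in `|X|](subrK (delta 0)) (le_trans (ler_normD _ _))//.
by rewrite addrC lerD.
Qed.

End first_difference.

Section test_set_error.
Variables (w : R -> R) (r : R).
Hypothesis mw : measurable_fun [set: mR] w.
Hypothesis w1 : forall x, `|w x| <= 1.
Hypothesis rw : right_continuous w.
Hypothesis r1 : 1 <= r.

Let r0 : 0 < r. Proof. exact: lt_le_trans r1. Qed.
Let L := 2 * M + 5 * A.
Let H (t : R) := P (fun s => w (t + r * s)).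

Let bw : bm w. Proof. by split=> //; exists 1. Qed.

Let bwt t : bm (fun s => w (t + r * s)). Proof. exact: bm_affine. Qed.

(** A step [r * 2^-1 ^+ n] of [t] is a step [2^-1 ^+ n] of the value of [l], so the estimates for
    [phi] apply to [w] dilated by [r] without loss. *)
Let H_dyadic t n : H (t + r * 2^-1 ^+ n) - H t =
  P (fun s => w (t + r * (s + 2^-1 ^+ n)) - w (t + r * s)).
Proof.
rewrite /H -PB//; congr P; apply/funext => s; congr (w _ - _); ring.
Qed.

Let H_lipschitz t v : 0 <= v -> `|H (t + v) - H t| <= L * (v / r).
Proof.
move=> v0.
have rH : right_continuous H by exact: P_rc.
have dH s m : `|H (s + r * 2^-1 ^+ m) - H s| <= L * 2^-1 ^+ m.
  rewrite H_dyadic; have [mws _] := bwt s.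
  by apply: (@first_difference_le (fun x => w (s + r * x)) mws) => x.
have tv : t + v <= t + v by [].
rewrite ler_norml; apply/andP; split.
- rewrite lerNl opprB lerBlDr addrC.
  suff: - H (t + v) <= - H t + L * (v / r) by lra.
  apply: (@dyadic_increments R (fun x => - H x) t (t + v) L r 0) => //.
  + exact: right_continuousN.
  + by move=> s m _ _ _; have := dH s m; rewrite ler_norml => /andP[]; lra.
- rewrite lerBlDl.
  apply: (@dyadic_increments R H t (t + v) L r 0) => //.
  by move=> s m _ _ _; have := dH s m; rewrite ler_norml => /andP[]; lra.
Qed.

(** After Fubini the inner integral is that of [w] over a window of length [v], where the errors of
    the test set cancel. *)
Let H_average t v e : 0 < v ->
  (forall s, `|s - t| <= r * C -> `|\int[lam]_(x in `[s, s + v[) w x| <= e) ->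
  `|\int[lam]_(x in `[0, v[) H (t + x)| <= e * M.
Proof.
move=> v0 he; have mI : measurable (`[0, v[%classic : set mR) by exact: measurable_itv.
pose f (z : mR * X) : R := w (t + z.1 + r * l z.2).
have mf : measurable_fun [set: mR * X] f.
  apply: (measurableT_comp mw); apply: measurable_funD.
    by apply: measurable_funD => //; exact: measurable_fst.
  apply: measurable_funM => //.
  exact: (measurableT_comp ml measurable_snd).
have Ioo : (lam (`[0%R, v[%classic : set mR) < +oo)%E by exact: lebesgue_itv_lty.
have E1 := @Rfubini1 _ _ _ _ _ lam mu _ D f 1 mI mD Ioo Doo mf (fun z _ => w1 _).
have E2 := @Rfubini2 _ _ _ _ _ lam mu _ D f 1 mI mD Ioo Doo mf (fun z _ => w1 _).
have -> : \int[lam]_(x in `[0, v[) H (t + x) =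
    \int[mu]_(y in D) \int[lam]_(x in `[0, v[) f (x, y) by rewrite -E2 E1.
apply: normr_Rintegral_le => //.
  pose f' (z : X * mR) : R := f (z.2, z.1).
  apply: (@measurable_Rintegral _ _ _ _ _ lam _ f' 1) => //.
    rewrite /f' /f; apply: (measurableT_comp mw); apply: measurable_funD.
      by apply: measurable_funD => //; exact: measurable_snd.
    apply: measurable_funM => //.
    exact: (measurableT_comp ml measurable_fst).
  by move=> x y _; exact: w1.
move=> y Dy; apply: le_trans (he (t + r * l y) _); last first.
  by rewrite addrAC subrr add0r normrM gtr0_norm// ler_wpM2l ?lC// ltW.
have -> : \int[lam]_(x in `[0, v[) f (x, y) =
   \int[lam]_(x in (fun x => x + (t + r * l y)) @^-1` `[t + r * l y, t + r * l y + v[) w (x + (t + r * l y)).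
  have -> : (fun x => x + (t + r * l y)) @^-1` `[t + r * l y, t + r * l y + v[ = `[0, v[%classic.
    apply/seteqP; split=> x /=; rewrite !in_itv/=;
      by rewrite lerDr addrC ltrD2l.
  by apply: eq_Rintegral => x _; rewrite /f/=; congr w; ring.
by rewrite Rintegral_shift//; exact: measurable_itv.
Qed.

(** [H] varies by at most [L * (v / r)] over the window, so its value is close to its average there.
    A short window helps the second term and hurts the first. *)
Let H_small t v e : 0 < v ->
  (forall s, `|s - t| <= r * C -> `|\int[lam]_(x in `[s, s + v[) w x| <= e) ->
  `|H t| <= e * M / v + L * (v / r).
Proof.
move=> v0 he; have := H_average v0 he.
have mI : measurable (`[0, v[%classic : set mR) by exact: measurable_itv.
have Ioo : (lam (`[0%R, v[%classic : set mR) < +oo)%E by exact: lebesgue_itv_lty.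
have mH : measurable_fun [set: mR] (fun x : mR => H (t + x)).
  pose f (z : mR * X) : R := w (t + z.1 + r * l z.2).
  apply: (@measurable_Rintegral _ _ _ _ _ mu D f 1) => //; last first.
    by move=> x y _; exact: w1.
  apply: (measurableT_comp mw); apply: measurable_funD.
    by apply: measurable_funD => //; exact: measurable_fst.
  apply: measurable_funM => //.
  exact: (measurableT_comp ml measurable_snd).
have HM x : `|H x| <= 1 * M by apply: Pnorm.
have iH : lam.-integrable `[0, v[ (EFin \o (fun x : mR => H (t + x))).
  by apply: (bounded_integrable (M := 1 * M)) => // x _; exact: HM.
have iHt : lam.-integrable `[0, v[ (EFin \o (fun x : mR => H t)).
  by apply: (bounded_integrable (M := 1 * M)) => // x _; exact: HM.
have vE : fine (lam (`[0, v[%classic : set mR)) = v.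
  by rewrite (fine_lebesgue_itv true true (ltW v0)) subr0.
have : `|\int[lam]_(x in `[0, v[) (H (t + x) - H t)| <= L * (v / r) * v.
  rewrite -[X in _ <= _ * X]vE; apply: normr_Rintegral_le => //.
    by apply: measurable_funB.
  move=> x /=; rewrite in_itv/= => /andP[x0 xv].
  rewrite (le_trans (H_lipschitz t x0))// ler_wpM2l//.
    by rewrite addr_ge0// mulr_ge0.
  by rewrite ler_wpM2r ?invr_ge0 ?(ltW r0)// ltW.
rewrite RintegralB// Rintegral_cst// vE => h1 h2.
rewrite -[X in _ <= _ + X](mulfK (lt0r_neq0 v0)) -mulrDl ler_pdivlMr//.
rewrite -[X in _ * X <= _](gtr0_norm v0) -normrM.
set I := \int[lam]_(x in `[0, v[) H (t + x) in h1 h2.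
rewrite -[H t * v](subrK I) addrC (le_trans (ler_normD _ _))//.
by rewrite lerD// distrC.
Qed.

(** At the scale [n] the first difference is bounded by twice the supremum [B]; going from there to
    the finer scale [m] costs only the tail of the telescoping sum. Hence the rate at all fine
    scales is controlled by one coarse scale. *)
Lemma oscillation_increment (t v e B : R) (n m : nat) : 0 < v -> (n <= m)%N ->
  e * M / v + L * (v / r) <= B ->
  (forall s, `|s - t| <= r * (C + 1) -> `|\int[lam]_(x in `[s, s + v[) w x| <= e) ->
  `|H (t + r * 2^-1 ^+ m) - H t| <=
    2^-1 ^+ m * (2 ^+ n * (2 * B) + 5 * A * (4 / 5) ^+ n).
Proof.
move=> v0 nm hB he.
have h1 k : 0 <= (2^-1 ^+ k : R) <= 1.
  by rewrite exprn_ge0//= exprn_ile1 ?invr_ge0// invf_le1// ler1n.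
have HB k : `|H (t + r * 2^-1 ^+ k)| <= B.
  apply: le_trans (H_small v0 _) hB => s hs; apply: he.
  have -> : s - t = (s - (t + r * 2^-1 ^+ k)) + r * 2^-1 ^+ k by ring.
  rewrite (le_trans (ler_normD _ _))// mulrDr lerD// normrM gtr0_norm//.
  have /andP[h2 h3] := h1 k.
  by rewrite ger0_norm// ler_wpM2l// ltW.
have HB0 : `|H t| <= B.
  apply: le_trans (H_small v0 _) hB => s hs; apply: he.
  by rewrite (le_trans hs)// ler_wpM2l ?(ltW r0)// lerDl.
rewrite H_dyadic; have [mws _] := bwt t.
have w1t x : `|w (t + r * x)| <= 1 by [].
have := @first_difference_tail (fun x => w (t + r * x)) mws w1t n m nm.
rewrite -!H_dyadic; set dm := H _ - H t; set dn := H _ - H t => hd.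
have -> : 2^-1 ^+ m = (2 ^+ m)^-1 :> R by rewrite exprVn.
rewrite ler_pdivlMl ?exprn_gt0// -[X in X * _ <= _]ger0_norm ?exprn_ge0// -normrM.
rewrite -[X in `|X|](subrK (2 ^+ n * dn)) addrC (le_trans (ler_normD _ _))// lerD//.
rewrite normrM ger0_norm ?exprn_ge0// ler_wpM2l ?exprn_ge0//.
by rewrite /dn (le_trans (ler_normB _ _))// mulr_natl mulr2n lerD.
Qed.

End test_set_error.

Hypothesis M_gt0 : 0 < M.
Hypothesis C0 : 0 <= C.

(* [K t r * h] bounds from below the growth of [ramp] on [t + r [-C, C]] over a shift
   by [r h]; with [e0] as the size of the cells near 0, and with the window length [v] of
   [F_increment], the error made at the scale [n] of [scale] is at most a quarter of
   that growth. *)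
Let L := 2 * M + 5 * A.
Let a := 13 * A + M.
Let C1 := C + 2.
Let rho (t r : R) := `|t| + r * C1.
Let K (t r : R) := r / (20 * root10 (rho t r) ^+ 11).
(** The value for which the two terms of [H_small] both become a quarter of the [b] chosen in
    [F_increment]. *)
Let c1 := M ^+ 9 / (16 ^+ 2 * a ^+ 8 * L).
Let e0 := c1 / 20 ^+ 10 / (2 * (1 + 2 * C1) ^+ 11).

Let L_gt0 : 0 < L. Proof. by rewrite ltr_wpDr ?mulr_ge0// mulr_gt0. Qed.
Let a_gt0 : 0 < a. Proof. by rewrite ltr_wpDl ?mulr_ge0. Qed.
Let C1_ge0 : 0 <= C1. Proof. by rewrite addr_ge0. Qed.
Let c1_gt0 : 0 < c1.
Proof.
apply: divr_gt0; first exact: exprn_gt0.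
apply: mulr_gt0 => //; apply: mulr_gt0; exact: exprn_gt0.
Qed.
Let e0_gt0 : 0 < e0.
Proof.
apply: divr_gt0; first by apply: divr_gt0 => //; exact: exprn_gt0.
apply: mulr_gt0 => //; apply: exprn_gt0; rewrite ltr_pwDl// mulr_ge0//.
Qed.

Let rho_ge0 t r : 0 <= r -> 0 <= rho t r.
Proof. by move=> r0; rewrite addr_ge0// mulr_ge0. Qed.

Let q_gt0 t r : 0 <= r -> 0 < root10 (rho t r).
Proof. by move=> r0; apply: lt_le_trans (root10_ge1 (rho_ge0 _ r0)). Qed.

Let K_gt0 t r : 0 < r -> 0 < K t r.
Proof.
move=> r0; rewrite divr_gt0// mulr_gt0// exprn_gt0// q_gt0// ltW//.
Qed.

Let K_le1 t r : 1 <= r -> K t r <= 1.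
Proof.
move=> r1; have r0 : 0 <= r := le_trans ler01 r1.
have q1 := root10_ge1 (rho_ge0 t r0).
rewrite ler_pdivrMr ?mul1r; last by rewrite mulr_gt0// exprn_gt0// q_gt0.
have rr : r <= 1 + rho t r.
  have h1 : r * 1 <= r * C1 by rewrite ler_wpM2l// /C1 ler_wpDl// ler1n.
  rewrite mulr1 in h1; rewrite (le_trans h1)// /rho addrA lerDr addr_ge0//.
apply: (le_trans rr); rewrite -root10X// ?rho_ge0//.
apply: (@le_trans _ _ (root10 (rho t r) ^+ 11)).
  by rewrite [leRHS]exprSr ler_peMr// exprn_ge0// (le_trans ler01).
by rewrite ler_peMl ?exprn_ge0 ?(le_trans ler01)// ler1n.
Qed.

Let K_anti t t' r : 0 <= r -> `|t| <= `|t'| -> K t' r <= K t r.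
Proof.
move=> r0 tt'; have q0 := q_gt0 t r0; have q0' := q_gt0 t' r0.
rewrite ler_wpM2l// lef_pV2 ?posrE ?mulr_gt0 ?exprn_gt0//.
rewrite ler_wpM2l// lerXn2r ?nnegrE ?(ltW q0) ?(ltW q0')//.
by apply: le_root10; rewrite ?rho_ge0// lerD2r.
Qed.

(** The window estimate involves the tenth power of [K]. The tenth root in [ramp] turns it into a
    rational function, and one more factor [r] makes it a multiple of the eleventh power of
    [r / (1 + rho)]. *)
Let K10 t r : 0 <= r -> K t r ^+ 10 = r ^+ 10 / (20 ^+ 10 * (1 + rho t r) ^+ 11).
Proof.
move=> r0; rewrite /K expr_div_n exprMn -(root10X (rho_ge0 t r0)).
by rewrite -!exprM.
Qed.

Let geometric_small (c eps : R) : 0 < eps -> exists n, c * (4 / 5) ^+ n <= eps.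
Proof.
move=> eps0.
have h : (fun n => c * (4 / 5) ^+ n) @ \oo --> (0 : R).
  rewrite -[X in _ --> X](mulr0 c); apply: cvgM; first exact: cvg_cst.
  by apply: cvg_expr; rewrite ger0_norm; lra.
move/cvgrPdist_le : h => /(_ _ eps0) [N _ hN]; exists N.
by have := hN N (leqnn N); rewrite /= sub0r normrN; apply: le_trans; exact: ler_norm.
Qed.

(* The tail of the first differences beyond [n] is negligible, while [2 ^ n] remains
   polynomially bounded. *)
Let scale (t r : R) (n : nat) :=
  (5 * A * (4 / 5) ^+ n <= M * K t r / 2) && (2 ^+ n <= (a / (M * K t r)) ^+ 4).

Let scale_exists (t r : R) (N : nat) : 1 <= r ->
  5 * A * (4 / 5) ^+ N <= M * K t r / 2 -> exists2 n, (n <= N)%N & scale t r n.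
Proof.
move=> r1 hN; have r0 : 0 < r := lt_le_trans ltr01 r1.
have MK0 : 0 < M * K t r by rewrite mulr_gt0// K_gt0.
have ex : exists n, 5 * A * (4 / 5) ^+ n <= M * K t r / 2 by exists N.
case: (ex_minnP ex) => n hn nmin; exists n; first exact: nmin.
rewrite /scale hn/=.
(* By minimality the condition fails one index earlier, so [(5/4)^n] times [M K] is less than
   [10 A * 5/4 = 12.5 A]; this is rounded up to the 13 of [a]. The summand [M] of [a] covers
   [n = 0]. *)
have h54 : (5 / 4) ^+ n <= a / (M * K t r).
  rewrite ler_pdivlMr//; case: n hn nmin => [|n] hn nmin.
    rewrite expr0 mul1r /a; have := ler_wpM2l M0 (K_le1 t r1).
    by rewrite mulr1; have := A0; lra.
  have : M * K t r / 2 < 5 * A * (4 / 5) ^+ n.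
    by rewrite ltNge; apply/negP => /nmin; rewrite ltnn.
  have p0 : 0 < (5 / 4 : R) ^+ n by rewrite exprn_gt0//; lra.
  rewrite -(ltr_pM2r p0) -[ltRHS]mulrA -exprMn.
  have -> : (4 / 5 * (5 / 4) : R) = 1 by field.
  rewrite expr1n mulr1 exprS.
  move: ((5 / 4) ^+ n) (M * K t r) A0 M0 => x y; rewrite /a; lra.
apply: (@le_trans _ _ (((5 / 4) ^+ n) ^+ 4)).
  (* This is the origin of the exponent 4 in [scale]. *)
  have h2 : (2 : R) <= (5 / 4) ^+ 4 by rewrite !exprS expr0; lra.
  by rewrite -exprM mulnC exprM lerXn2r ?nnegrE// (le_trans _ h2).
by rewrite lerXn2r ?nnegrE// ?exprn_ge0 ?divr_ge0 ?(ltW a_gt0) ?(ltW MK0)//; lra.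
Qed.

Section increments.
Variables (B0 : set mR) (r : R).
Hypothesis mB0 : measurable B0.
Hypothesis rB0 : right_continuous (\1_B0 : R -> R).
Hypothesis B0E : forall s s', s <= s' ->
  `|\int[lam]_(x in `[s, s'[) (\1_B0 x - ramp x)| <=
      e0 / (1 + `|s|) ^+ 11 + e0 / (1 + `|s'|) ^+ 11.
Hypothesis r1 : 1 <= r.

Let r0 : 0 < r. Proof. exact: lt_le_trans r1. Qed.
Let w (x : R) : R := \1_B0 x - ramp x.
Let F (t : R) := P (fun s => \1_B0 (t + r * s)).

Let ramp_bm : bm (@ramp R).
Proof.
split; first exact: measurable_ramp.
by exists 1 => x; rewrite ger0_norm ?ramp_ge0 ?ramp_le1.
Qed.

Let B0_bm : bm (\1_B0 : R -> R).
Proof.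
split; first exact: measurable_indic.
by exists 1 => x; rewrite indicE; case: (_ \in _); rewrite ?normr1 ?normr0.
Qed.

Let mw : measurable_fun [set: mR] w.
Proof. by apply: measurable_funB; [case: B0_bm|case: ramp_bm]. Qed.

Let w1 x : `|w x| <= 1.
Proof.
rewrite /w ler_norml indicE; have := @ramp_ge0 R x; have := @ramp_le1 R x.
by case: (_ \in _) => /=; lra.
Qed.

Let rw : right_continuous w.
Proof.
apply: right_continuousB => //; apply: lipschitz_right_continuous => s t st.
have /andP[h1 h2] := @ramp_incr R (Num.max `|s| `|t|) s t st
  ltac:(by rewrite le_max lexx) ltac:(by rewrite le_max lexx orbT).
rewrite ger0_norm//; apply: le_trans h1.
by rewrite divr_ge0 ?subr_ge0// mulr_ge0// exprn_ge0// (le_trans ler01)// root10_ge1.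
Qed.

Let ramp_increment t m :
  M * (2^-1 ^+ m * K t r) <= P (fun s => ramp (t + r * 2^-1 ^+ m + r * s)) - P (fun s => ramp (t + r * s)).
Proof.
rewrite -PB; [|exact: bm_affine..].
have h0 : 0 <= (2^-1 ^+ m : R) by rewrite exprn_ge0.
have h1 : (2^-1 ^+ m : R) <= 1 by rewrite exprn_ile1 ?invr_ge0// invf_le1// ler1n.
rewrite mulrC; apply: Pge; first by apply: bmB; exact: bm_affine.
move=> x xC.
have rx : `|r * x| <= r * C by rewrite normrM gtr0_norm// ler_wpM2l// ltW.
have b1 : `|t + r * x| <= rho t r.
  rewrite (le_trans (ler_normD _ _))// lerD2l (le_trans rx)// ler_wpM2l ?(ltW r0)//.
  by rewrite /C1 lerDl.
have b2 : `|t + r * 2^-1 ^+ m + r * x| <= rho t r.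
  rewrite (le_trans (ler_normD _ _))// (le_trans (lerD (ler_normD _ _) rx))//.
  rewrite -addrA lerD2l normrM gtr0_norm// ger0_norm// -mulrDr ler_wpM2l ?(ltW r0)//.
  by rewrite /C1; lra.
have le12 : t + r * x <= t + r * 2^-1 ^+ m + r * x.
  by rewrite addrAC lerDl mulr_ge0// ltW.
have /andP[h _] := ramp_incr le12 b1 b2.
apply: le_trans h; rewrite /K.
have -> : t + r * 2^-1 ^+ m + r * x - (t + r * x) = r * 2^-1 ^+ m by ring.
by rewrite mulrCA mulrA.
Qed.

(** Both end points of the window lie within [r (C + 2)] of [t], hence the 2 in [C1]; each is
    charged half of the bound, hence the 2 in [e0]. *)
Let window t s v : 0 <= v -> v <= r -> `|s - t| <= r * (C + 1) ->
  `|\int[lam]_(x in `[s, s + v[) w x| <= c1 * r * K t r ^+ 10.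
Proof.
move=> v0 vr st.
have side u : `|u - t| <= r * C1 -> e0 / (1 + `|u|) ^+ 11 <= c1 * r * K t r ^+ 10 / 2.
  move=> ut; rewrite K10 ?(ltW r0)//.
  have rp := rho_ge0 t (ltW r0).
  (* This product form makes the bound uniform in [r]: [r / (1 + rho)] is at least a constant over
     [1 + |u|], which is how the cells shrink. *)
  have key : 1 + rho t r <= (1 + 2 * C1) * r * (1 + `|u|).
    have : `|t| <= `|u| + r * C1.
      by rewrite -[t](subrK u) addrC (le_trans (ler_normD _ _))// lerD2l distrC.
    have h1 : `|u| <= r * `|u| by rewrite ler_peMl.
    have h2 : 0 <= r * C1 * `|u| by rewrite !mulr_ge0 ?(ltW r0).
    rewrite /rho; move: r1 h1 h2; move: `|u| `|t| (normr_ge0 u) => x y x0; nra.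
  have x0 : 0 < 1 + `|u| by rewrite ltr_pwDl.
  have y0 : 0 < 1 + rho t r by rewrite ltr_pwDl.
  have z0 : 0 < 1 + 2 * C1 by rewrite ltr_pwDl// mulr_ge0.
  have -> : c1 * r * (r ^+ 10 / (20 ^+ 10 * (1 + rho t r) ^+ 11)) / 2 =
      c1 / 20 ^+ 10 / 2 * (r / (1 + rho t r)) ^+ 11.
    rewrite expr_div_n [r ^+ 11]exprS; move: (r ^+ 10) => ?.
    by field; rewrite gt_eqF.
  have -> : e0 / (1 + `|u|) ^+ 11 =
      c1 / 20 ^+ 10 / 2 * (1 / ((1 + 2 * C1) * (1 + `|u|))) ^+ 11.
    rewrite /e0 expr_div_n expr1n exprMn.
    by field; rewrite !gt_eqF.
  have k0 : 0 <= c1 / 20 ^+ 10 / 2.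
    apply: divr_ge0 => //; apply: divr_ge0; [exact: ltW c1_gt0|exact: exprn_ge0].
  have k1 : 0 <= 1 / ((1 + 2 * C1) * (1 + `|u|)).
    by apply: divr_ge0 => //; apply: mulr_ge0; exact: ltW.
  have k2 : 0 <= r / (1 + rho t r) by apply: divr_ge0; exact: ltW.
  rewrite ler_wpM2l// lerXn2r ?nnegrE//.
  rewrite ler_pdivrMr ?mulr_gt0// mulrAC ler_pdivlMr// mul1r.
  by rewrite mulrA [r * _]mulrC.
have ss : s <= s + v by rewrite lerDl.
apply: (le_trans (B0E ss)).
rewrite [leRHS](splitr (c1 * r * K t r ^+ 10)); apply: lerD; apply: side.
- rewrite (le_trans st)// ler_wpM2l ?(ltW r0)// /C1; lra.
- rewrite addrAC (le_trans (ler_normD _ _))// (ger0_norm v0).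
  by apply: (le_trans (lerD st vr)); rewrite /C1; lra.
Qed.

Let F_increment t n m : scale t r n -> (n <= m)%N -> F t < F (t + r * 2^-1 ^+ m).
Proof.
move=> /andP[s1 s2] nm.
have k0 : 0 < K t r by rewrite K_gt0.
have MK0 : 0 < M * K t r by rewrite mulr_gt0.
have MKa : M * K t r <= a.
  have := ler_wpM2l M0 (K_le1 t r1); rewrite mulr1 /a => h.
  by rewrite (le_trans h)// lerDr mulr_ge0.
(* Chosen so that the bound on [2^n] from [scale] gives [2^n b <= M K / 4]. *)
pose b := (M * K t r) ^+ 5 / (4 * a ^+ 4).
have a4 : 0 < 4 * a ^+ 4 by apply: mulr_gt0 => //; exact: exprn_gt0.
have b0 : 0 < b by apply: divr_gt0 => //; exact: exprn_gt0.
have bMK : 4 * b <= M * K t r.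
  rewrite /b mulrA ler_pdivrMr// [(M * _) ^+ 5]exprS mulrCA.
  rewrite ler_pM2l// ler_pM2l//.
  by rewrite lerXn2r ?nnegrE// ltW.
(* With this length the Lipschitz term [L * (v / r)] is exactly [b / 4]. *)
pose v := r * b / (4 * L).
have v0 : 0 < v by apply: divr_gt0; apply: mulr_gt0.
have vr : v <= r.
  rewrite /v ler_pdivrMr ?mulr_gt0// ler_pM2l//.
  have := ler_wpM2l M0 (K_le1 t r1); rewrite mulr1 => h.
  by move: bMK h A0 M0; rewrite /L; move: (M * K t r) => ?; lra.
have hB : c1 * r * K t r ^+ 10 * M / v + (2 * M + 5 * A) * (v / r) <= b / 2.
  rewrite -/L le_eqVlt; apply/orP; left; apply/eqP.
  rewrite /c1 /v /b; field.
  by rewrite !gt_eqF.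
have HE u : P (fun s => w (u + r * s)) = F u - P (fun s => ramp (u + r * s)).
  by rewrite -PB; [|exact: bm_affine..].
have osc : `|P (fun s => w (t + r * 2^-1 ^+ m + r * s)) - P (fun s => w (t + r * s))| <=
    2^-1 ^+ m * (2 ^+ n * (2 * (b / 2)) + 5 * A * (4 / 5) ^+ n).
  apply: (@oscillation_increment w r mw w1 rw r1 t v (c1 * r * K t r ^+ 10) (b / 2) n m v0 nm hB).
  by move=> s; exact: (window (ltW v0) vr).
rewrite !HE in osc.
have b2 : 2 ^+ n * b <= M * K t r / 4.
  have -> : M * K t r / 4 = (a / (M * K t r)) ^+ 4 * b.
    rewrite /b; field; rewrite !gt_eqF//.
  by rewrite ler_wpM2r// ltW.
have h0 : 0 < (2^-1 ^+ m : R) by rewrite exprn_gt0.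
have inc := ramp_increment t m.
(* One quarter from the coarse scale and one half from the tail leave the total error strictly below
   the growth of the ramp. *)
have tot : 2^-1 ^+ m * (2 ^+ n * (2 * (b / 2)) + 5 * A * (4 / 5) ^+ n) < 2^-1 ^+ m * (M * K t r).
  rewrite ltr_pM2l//; have -> : 2 * (b / 2) = b by field.
  exact: lt_quarter_half b2 s1 MK0.
move: osc; rewrite ler_norml => /andP[osc _].
by apply: (lt_of_perturbation osc _ tot); rewrite mulrCA.
Qed.

Let F_rc : right_continuous F. Proof. exact: P_rc. Qed.

(** On the interval from [t] to [t'] one [N] makes all dyadic steps from [N] on increasing; right
    continuity then covers shifts that are not multiples of a step. *)
Lemma indic_window_increasing t t' : t < t' -> F t < F t'.
Proof.
move=> tt'; pose tau := `|t| + `|t'|.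
have tau0 : 0 <= tau by rewrite addr_ge0.
(* [K] decreases in the absolute value of its argument, so its value at [tau] is a lower bound on
   the whole interval. *)
have Kt : 0 < M * K tau r / 2 by rewrite divr_gt0// mulr_gt0// K_gt0.
have [N hN] := geometric_small (5 * A) Kt.
have step s m : t <= s -> s <= t' -> (N <= m)%N -> F s < F (s + r * 2^-1 ^+ m).
  move=> ts st' Nm.
  have sK : M * K tau r / 2 <= M * K s r / 2.
    rewrite ler_pM2r// ler_pM2l//; apply: K_anti; first exact: ltW.
    rewrite (ger0_norm tau0) /tau ler_norml.
    have := ler_norm t; have := ler_norm (- t); have := ler_norm t'; have := ler_norm (- t').
    rewrite !normrN; lra.
  have [n nN sn] := scale_exists r1 (le_trans hN sK).
  by apply: F_increment sn _; exact: leq_trans Nm.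
have d0 : 0 < t' - t by rewrite subr_gt0.
have [m Nm hm] : exists2 m, (N <= m)%N & r * 2^-1 ^+ m <= t' - t.
  have /cvgrPdist_le /(_ _ d0) [m _ hm] := @cvg_expV2 R r.
  exists (maxn N m); first exact: leq_maxl.
  by have := hm (maxn N m) (leq_maxr _ _); rewrite /= sub0r normrN; apply: le_trans; exact: ler_norm.
apply: lt_le_trans (step t m (lexx _) (ltW tt') Nm) _.
have rh0 : 0 <= r * 2^-1 ^+ m by rewrite mulr_ge0 ?exprn_ge0// ltW.
have E : t + r * 2^-1 ^+ m + (t' - (t + r * 2^-1 ^+ m)) = t' by ring.
suff: - F (t + r * 2^-1 ^+ m + (t' - (t + r * 2^-1 ^+ m))) <=
    - F (t + r * 2^-1 ^+ m) + 0 * ((t' - (t + r * 2^-1 ^+ m)) / r).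
  by rewrite E mul0r addr0 lerN2.
apply: (@dyadic_increments R (fun x => - F x) t t' 0 r N (right_continuousN F_rc) r0).
- by move=> s k ts st' Nk; rewrite mul0r addr0 lerN2 ltW// step.
- by rewrite subr_ge0 -lerBrDl.
- by rewrite lerDl.
- by rewrite E.
Qed.

End increments.

Lemma monotone_test_set : exists B : set mR, measurable B /\
  forall r t t', 1 <= r -> t < t' ->
    fine (mu (D `&` [set x | B (t + r * l x)])) <
    fine (mu (D `&` [set x | B (t' + r * l x)])).
Proof.
have [B [mB rB BE]] := density_set 11 (@measurable_ramp R) (@ramp_ge0 R) (@ramp_le1 R) e0_gt0.
exists B; split=> // r t t' r1 tt'.
have := indic_window_increasing mB (locally_constant_right_continuous rB) BE r1 tt'.
have mpre u : measurable [set x | B (u + r * l x)].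
  have : measurable_fun [set: X] (fun x => u + r * l x : mR).
    by apply: measurable_funD => //; exact: measurable_funM.
  by move=> /(_ measurableT _ mB); rewrite setTI.
have FE u : P (fun s => \1_B (u + r * s)) = fine (mu (D `&` [set x | B (u + r * l x)])).
  rewrite setIC -Rintegral_indic//; apply: eq_Rintegral => x _.
by rewrite -!FE.
Qed.

End one_dim.

(** * Smoothing along a generic direction *)

Definition lebesgue3 (R : realType) : {sigma_finite_measure set _ -> \bar R} :=
  prod_measure (@lebesgue_measure R)
    (prod_measure (@lebesgue_measure R) (@lebesgue_measure R)).

Definition fourth_difference (R : realType) (psi : R -> R) (h s : R) : R :=
  psi (s + 2 * h) - 4 * psi (s + h) + 6 * psi s - 4 * psi (s - h) + psi (s - 2 * h).

Lemma fourth_difference_le (R : realType) (psi : R -> R) (h s : R) :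
  (forall x, `|psi x| <= 1) -> `|fourth_difference psi h s| <= 16.
Proof.
move=> psi1; rewrite /fourth_difference.
have := psi1 (s + 2 * h); have := psi1 (s + h); have := psi1 s.
have := psi1 (s - h); have := psi1 (s - 2 * h); rewrite !ler_norml; lra.
Qed.

Lemma am_gm_bound (R : realFieldType) (x e : R) : 0 < e ->
  x <= e / 2 + (2 * e)^-1 * x ^+ 2.
Proof.
move=> e0; rewrite -subr_ge0.
have -> : e / 2 + (2 * e)^-1 * x ^+ 2 - x = (2 * e)^-1 * (x - e) ^+ 2.
  by field; rewrite gt_eqF.
by rewrite mulr_ge0 ?sqr_ge0// invr_ge0 mulr_ge0// ltW.
Qed.

Lemma cubic_geometric_sum (R : realFieldType) (k : nat) : exists2 c : R, 0 <= c &
  forall n, \sum_(i < n) (25 / 4) ^+ i * ((i + k).+1%:R ^+ 3 * (2^-1 ^+ i) ^+ 3) <= c.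
Proof.
pose r : R := 2197 / 2500; have r0 : 0 <= r by rewrite /r; lra.
have r1 : 0 < 1 - r by rewrite /r; lra.
have sumr n : \sum_(i < n) r ^+ i <= (1 - r)^-1.
  suff -> : \sum_(i < n) r ^+ i = (1 - r)^-1 * (1 - r ^+ n).
    by rewrite ler_piMr ?invr_ge0 ?(ltW r1)// gerBl exprn_ge0.
  elim: n => [|n IH]; first by rewrite big_ord0 subrr mulr0.
  by rewrite big_ord_recr/= IH exprS; field; rewrite gt_eqF.
have c0 : 0 <= (26 + k%:R) ^+ 3 :> R by rewrite exprn_ge0// addr_ge0.
exists ((26 + k%:R) ^+ 3 * (1 - r)^-1); first by rewrite mulr_ge0// invr_ge0 ltW.
move=> n; apply: (le_trans _ (ler_wpM2l c0 (sumr n))); rewrite mulr_sumr.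
apply: ler_sum => i _.
have bern j : j%:R + k%:R + 26 <= (26 + k%:R) * (26 / 25) ^+ j :> R.
  elim: j => [|j IH]; first by rewrite expr0 mulr1; lra.
  have j0 : 0 <= j%:R :> R by []. have k0 : 0 <= k%:R :> R by [].
  rewrite exprS mulrCA -natr1; move: IH; set y := (26 + k%:R) * _; lra.
have : (i + k).+1%:R ^+ 3 <= ((26 + k%:R) * (26 / 25) ^+ i) ^+ 3 :> R.
  apply: lerXn2r; rewrite ?nnegrE ?mulr_ge0 ?addr_ge0 ?exprn_ge0//.
  by apply: le_trans (bern i); rewrite -natr1 natrD; lra.
move=> h; rewrite mulrA.
apply: (@le_trans _ _ ((25 / 4) ^+ i * ((26 + k%:R) * (26 / 25) ^+ i) ^+ 3 * (2^-1 ^+ i) ^+ 3)).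
  by rewrite ler_wpM2r ?exprn_ge0// ler_wpM2l ?exprn_ge0.
have -> : r ^+ i = (25 / 4) ^+ i * ((26 / 25) ^+ i) ^+ 3 * (2^-1 ^+ i) ^+ 3.
  rewrite -!exprM !(mulnC i) !exprM -!exprMn; congr (_ ^+ i); by rewrite /r; field.
by rewrite le_eqVlt; apply/orP; left; apply/eqP; ring.
Qed.

Section averaging.
Context (R : realType).
Local Notation mR := (measurableTypeR R).
Local Notation lam := (@lebesgue_measure R).

Let U : set mR := `[0, 1]%classic.

Let mU : measurable U. Proof. exact: measurable_itv. Qed.
Let Uoo : (lam U < +oo)%E. Proof. exact: lebesgue_itv_lty. Qed.

Let bm (f : R -> R) (K : R) := measurable_fun [set: mR] f /\ forall x, `|f x| <= K.

Let maff (f : R -> R) a z : measurable_fun [set: mR] f ->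
  measurable_fun [set: mR] (fun v : mR => f (a + z * v)).
Proof.
move=> mf; apply: (measurableT_comp mf); apply: measurable_funD => //.
Qed.

Let intU (f : R -> R) K a z : bm f K -> lam.-integrable U (EFin \o (fun v : mR => f (a + z * v))).
Proof.
move=> [mf fK]; apply: (bounded_integrable (M := K)) => //; exact: maff.
Qed.

Let avg_diff (h z : R) (f : R -> R) (s : R) :=
  \int[lam]_(v in U) (f (s + h + z * v) - f (s + z * v)).

Let avg_diffE h z f s K : bm f K -> avg_diff h z f s =
  \int[lam]_(v in U) f (s + h + z * v) - \int[lam]_(v in U) f (s + z * v).
Proof. by move=> bf; rewrite /avg_diff RintegralB//; exact: intU bf. Qed.

Let avg_diff_bm h z f K delta : bm f K -> 0 <= h -> 0 <= delta ->
  h <= `|z| * delta \/ 1 <= delta -> bm (avg_diff h z f) (4 * K * delta).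
Proof.
move=> [mf fK] h0 d0 hd; split; last by move=> s; exact: Rintegral01_shift.
pose g (p : mR * mR) : R := f (p.1 + h + z * p.2) - f (p.1 + z * p.2).
apply: (@measurable_Rintegral _ _ _ _ _ lam U g (K + K)) => //.
  apply: measurable_funB; apply: (measurableT_comp mf).
    apply: measurable_funD; first by apply: measurable_funD => //; exact: measurable_fst.
    by apply: measurable_funM => //; exact: measurable_snd.
  apply: measurable_funD; first exact: measurable_fst.
  by apply: measurable_funM => //; exact: measurable_snd.
by move=> x y _; rewrite (le_trans (ler_normB _ _))// lerD.
Qed.

(* Averaging along a direction absorbs one of the four differences, at the cost
   of a factor [delta]. *)
Lemma average_fourth_difference (psi : R -> R) (c h z1 z2 z3 d1 d2 d3 : R) :
  measurable_fun [set: mR] psi -> (forall x, `|psi x| <= 1) -> 0 <= h ->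
  0 <= d1 -> 0 <= d2 -> 0 <= d3 ->
  h <= `|z1| * d1 \/ 1 <= d1 -> h <= `|z2| * d2 \/ 1 <= d2 ->
  h <= `|z3| * d3 \/ 1 <= d3 ->
  `|\int[lebesgue3 R]_(w in U `*` (U `*` U))
     fourth_difference psi h (c + z1 * w.1 + z2 * w.2.1 + z3 * w.2.2)| <= 128 * (d1 * d2 * d3).
Proof.
move=> mpsi psi1 h0 d10 d20 d30 hd1 hd2 hd3.
set D4 := fourth_difference psi h.
pose u s := psi (s - h) - psi (s - 2 * h).
have shift a : measurable_fun [set: mR] (fun x : mR => psi (x + a)).
  by apply: (measurableT_comp mpsi); exact: measurable_funD.
have bu : bm u 2.
  split; first by apply: measurable_funB; exact: shift.
  by move=> s; rewrite (le_trans (ler_normB _ _))// -[2]/(1 + 1) lerD.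
have b3 := avg_diff_bm bu h0 d30 hd3.
have b2 := avg_diff_bm b3 h0 d20 hd2.
have b1 := avg_diff_bm b2 h0 d10 hd1.
set T3 := avg_diff h z3 u in b3 b2 b1.
set T2 := avg_diff h z2 T3 in b2 b1.
have D4E s : D4 s = u (s + 3 * h) - 3 * u (s + 2 * h) + 3 * u (s + h) - u s.
  rewrite /D4 /fourth_difference /u.
  have -> : s + 3 * h - h = s + 2 * h by ring.
  have -> : s + 3 * h - 2 * h = s + h by ring.
  have -> : s + 2 * h - h = s + h by ring.
  have -> : s + 2 * h - 2 * h = s by ring.
  have -> : s + h - h = s by ring.
  have -> : s + h - 2 * h = s - h by ring.
  ring.
have mD4 : measurable_fun [set: mR] D4.
  rewrite /D4 /fourth_difference.
  have m2 : measurable_fun [set: mR] (fun x : mR => psi (x - 2 * h)) by exact: shift.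
  have m1 : measurable_fun [set: mR] (fun x : mR => psi (x - h)) by exact: shift.
  apply: measurable_funD => //; apply: measurable_funB; last exact: measurable_funM.
  apply: measurable_funD; last exact: measurable_funM.
  apply: measurable_funB; last by apply: measurable_funM => //; exact: shift.
  exact: shift.
have D4M s : `|D4 s| <= 16.
  exact: fourth_difference_le.
have int3 (f : R -> R) K s z : bm f K -> \int[lam]_(v in U)
   (f (s + 3 * h + z * v) - 3 * f (s + 2 * h + z * v) + 3 * f (s + h + z * v) - f (s + z * v)) =
   avg_diff h z f (s + 2 * h) - 2 * avg_diff h z f (s + h) + avg_diff h z f s.
  move=> bf; rewrite !(avg_diffE _ _ _ bf).
  have I a : lam.-integrable U (EFin \o (fun v : mR => f (a + z * v))) by exact: intU bf.
  have I3 a : lam.-integrable U (EFin \o (fun v : mR => 3 * f (a + z * v))).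
    by have := integrableZl mU 3 (I a).
  have I4 := integrableB mU (I (s + 3 * h)) (I3 (s + 2 * h)).
  have I5 := integrableD mU I4 (I3 (s + h)).
  rewrite RintegralB// RintegralD// RintegralB// !RintegralZl//.
  have -> : s + 2 * h + h = s + 3 * h by ring.
  have -> : s + h + h = s + 2 * h by ring.
  ring.
have int2 (f : R -> R) K s z : bm f K -> \int[lam]_(v in U)
   (f (s + 2 * h + z * v) - 2 * f (s + h + z * v) + f (s + z * v)) =
   avg_diff h z f (s + h) - avg_diff h z f s.
  move=> bf; rewrite !(avg_diffE _ _ _ bf).
  have I a : lam.-integrable U (EFin \o (fun v : mR => f (a + z * v))) by exact: intU bf.
  have I3 a : lam.-integrable U (EFin \o (fun v : mR => 2 * f (a + z * v))).
    by have := integrableZl mU 2 (I a).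
  have I4 := integrableB mU (I (s + 2 * h)) (I3 (s + h)).
  rewrite RintegralD// RintegralB// !RintegralZl//.
  have -> : s + h + h = s + 2 * h by ring.
  ring.
pose G (w : mR * (mR * mR)) : R := D4 (c + z1 * w.1 + z2 * w.2.1 + z3 * w.2.2).
have mG : measurable_fun [set: mR * (mR * mR)] G.
  apply: (measurableT_comp mD4); apply: measurable_funD; [apply: measurable_funD|].
  - apply: measurable_funD => //; apply: measurable_funM => //; exact: measurable_fst.
  - apply: measurable_funM => //; exact: (measurableT_comp measurable_fst measurable_snd).
  - apply: measurable_funM => //; exact: (measurableT_comp measurable_snd measurable_snd).
have UUoo : (prod_measure lam lam (U `*` U) < +oo)%E.
  exact: prod_measure_lty.
have mUU : measurable (U `*` U) by exact: measurableX.
rewrite (@Rfubini1 _ _ _ _ _ lam (prod_measure lam lam) U (U `*` U) G 16)//; last first.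
  by move=> w _; exact: D4M.
have inner x : \int[prod_measure lam lam]_(y in U `*` U) G (x, y) =
    T2 (c + z1 * x + h) - T2 (c + z1 * x).
  have mGx : measurable_fun [set: mR * mR] (fun y => G (x, y)) by exact: measurableT_comp.
  rewrite (@Rfubini1 _ _ _ _ _ lam lam U U (fun y => G (x, y)) 16)//; last first.
    by move=> w _; exact: D4M.
  rewrite -(int2 T3 _ _ _ b3); apply: eq_Rintegral => y _.
  have -> : c + z1 * x + 2 * h + z2 * y = c + z1 * x + z2 * y + 2 * h by ring.
  have -> : c + z1 * x + h + z2 * y = c + z1 * x + z2 * y + h by ring.
  rewrite /T3 -(int3 u _ _ _ bu); apply: eq_Rintegral => v _.
  rewrite /G D4E /=; set e := c + z1 * x + z2 * y.
  have -> : e + z3 * v + 3 * h = e + 3 * h + z3 * v by ring.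
  have -> : e + z3 * v + 2 * h = e + 2 * h + z3 * v by ring.
  by have -> : e + z3 * v + h = e + h + z3 * v by ring.
have [_ /(_ c)] := b1; congr (_ <= _); last by ring.
congr `|_|; rewrite /avg_diff; apply: eq_Rintegral => x _.
by rewrite inner addrAC.
Qed.

End averaging.

Section finite_sums.
Context d (T : measurableType d) (R : realType) (mu : {measure set T -> \bar R}).

Lemma Rintegrable_sum (D : set T) (I : Type) (s : seq I) (f : I -> T -> R) :
  measurable D -> (forall i, mu.-integrable D (EFin \o f i)) ->
  mu.-integrable D (EFin \o (fun x => \sum_(i <- s) f i x)).
Proof.
move=> mD intf; elim: s => [|i s IH].
  by under eq_fun do rewrite big_nil; exact: integrable0.
by under eq_fun do rewrite big_cons; exact: (integrableD mD (intf i) IH).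
Qed.

Lemma Rintegral_sum (D : set T) (I : Type) (s : seq I) (f : I -> T -> R) :
  measurable D -> (forall i, mu.-integrable D (EFin \o f i)) ->
  \int[mu]_(x in D) (\sum_(i <- s) f i x) = \sum_(i <- s) \int[mu]_(x in D) f i x.
Proof.
move=> mD intf; elim: s => [|i s IH].
  by under eq_Rintegral do rewrite big_nil; rewrite Rintegral_cst// mul0r big_nil.
under eq_Rintegral do rewrite big_cons.
by rewrite RintegralD ?IH ?big_cons//; exact: Rintegrable_sum.
Qed.

Lemma exists_bounded_sequence (D : set T) (X : nat -> T -> R) (c : R) :
  measurable D -> (0 < mu D)%E -> (forall n, measurable_fun setT (X n)) ->
  (forall n x, D x -> 0 <= X n x) ->
  (forall n, mu.-integrable D (EFin \o X n)) ->
  (forall n, \sum_(i < n) \int[mu]_(x in D) X i x <= c) ->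
  exists2 x, D x & exists K, forall n, X n x <= K.
Proof.
move=> mD D0 mX X0 iX Xc.
pose f x := (\sum_(n <oo) (X n x)%:E)%E.
have f0 x : D x -> (0 <= f x)%E.
  by move=> Dx; apply: nneseries_ge0 => n _ _; rewrite lee_fin X0.
have intf : (\int[mu]_(x in D) f x <= c%:E)%E.
  have -> : (\int[mu]_(x in D) f x = \sum_(n <oo) \int[mu]_(x in D) (X n x)%:E)%E.
    apply: integral_nneseries => // n.
      by apply/measurable_EFinP/measurable_funTS.
  apply: lime_le.
    by apply: is_cvg_nneseries => n _ _; apply: integral_ge0 => x Dx; rewrite lee_fin X0.
  apply: nearW => n; rewrite big_mkord.
  have -> : (\sum_(i < n) \int[mu]_(x in D) (X i x)%:E = (\sum_(i < n) \int[mu]_(x in D) X i x)%:E)%E.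
    rewrite -sumEFin; apply: eq_bigr => i _; rewrite /Rintegral fineK//.
    exact: (integrable_fin_num mD (iX i)).
  by rewrite lee_fin.
have [x Dx fx] : exists2 x, D x & (f x < +oo)%E.
  apply: contrapT => nex.
  have foo x : D x -> f x = +oo%E.
    by move=> Dx; apply/eqP; rewrite -leye_eq leNgt; apply/negP => h; apply: nex; exists x.
  have : (\int[mu]_(x in D) f x = +oo)%E.
    rewrite (eq_integral (cst +oo%E)); last by move=> x; rewrite inE => /foo.
    by rewrite integral_cst// gt0_mulye.
  by move=> E; move: intf; rewrite E leye_eq.
exists x => //; exists (fine (f x)) => n.
have ffin : f x \is a fin_num by rewrite ge0_fin_numE// f0.
rewrite -lee_fin fineK//.
have le1 : (\sum_(0 <= i < n.+1) (X i x)%:E <= f x)%E.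
  by apply: nneseries_lim_ge => i _ _; rewrite lee_fin X0.
apply: le_trans le1; rewrite big_nat_recr//= leeDr//.
by apply: sume_ge0 => i _; rewrite lee_fin X0.
Qed.

End finite_sums.

Section smoothing.
Context (R : realType) d (Y : measurableType d).
Local Notation mR := (measurableTypeR R).
Local Notation lam := (@lebesgue_measure R).
Variable m : {sigma_finite_measure set Y -> \bar R}.
Variables (Yd : set Y) (o x1 x2 x3 : Y -> mR) (B : set (mR * Y)) (R0 C0 : R).
Hypotheses (mYd : measurable Yd) (Ydoo : (m Yd < +oo)%E).
Hypotheses (mo : measurable_fun setT o) (mx1 : measurable_fun setT x1).
Hypotheses (mx2 : measurable_fun setT x2) (mx3 : measurable_fun setT x3).
Hypothesis mB : measurable B.
Hypothesis BR : forall p, B p -> `|p.1| <= R0 /\ Yd p.2.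
Hypothesis YR : forall y, Yd y ->
  [/\ `|o y| <= R0, `|x1 y| <= R0, `|x2 y| <= R0 & `|x3 y| <= R0].
Hypothesis R00 : 0 <= R0.
Hypothesis C00 : 0 <= C0.
Hypothesis box : forall a1 a2 a3 d1 d2 d3, 0 <= d1 -> 0 <= d2 -> 0 <= d3 ->
  fine (m ([set y | [/\ `|a1 - x1 y| <= d1, `|a2 - x2 y| <= d2 & `|a3 - x3 y| <= d3]]
     `&` Yd)) <= C0 * (d1 * d2 * d3).

Let U : set mR := `[0, 1]%classic.
Let U3 : set (mR * (mR * mR)) := U `*` (U `*` U).
Let K := 5 * R0 + 4.
Let I : set mR := `[- K, K]%classic.
Let q (w : mR * (mR * mR)) (y : Y) : R :=
  o y + x1 y * w.1 + x2 y * w.2.1 + x3 y * w.2.2.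
Let mul := prod_measure lam m.
Let ell (w : mR * (mR * mR)) (p : mR * Y) : R := p.1 + q w p.2.
Let b (s : R) (y : Y) : R := \1_B (s, y).
Let f (w : mR * (mR * mR)) (s : R) : R := \int[m]_(y in Yd) b (s - q w y) y.

Let mI : measurable I. Proof. exact: measurable_itv. Qed.
Let Ioo : (lam I < +oo)%E. Proof. exact: lebesgue_itv_lty. Qed.
Let mU3 : measurable U3.
Proof. by apply: measurableX; [|apply: measurableX]; exact: measurable_itv. Qed.

Let inI s : I s <-> `|s| <= K.
Proof. by rewrite /I /= in_itv/= ler_norml. Qed.

Let b_norm s y : `|b s y| <= 1.
Proof. by rewrite /b indicE; case: (_ \in _); rewrite ?normr1 ?normr0. Qed.

Let b_supp s y : R0 < `|s| -> b s y = 0.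
Proof.
move=> sR; rewrite /b indicE memNset// => /BR[/= h _].
by move: (lt_le_trans sR h); rewrite ltxx.
Qed.

Let mq2 d' (T : measurableType d') (w1 w2 w3 : T -> mR) (c : T -> Y) :
  measurable_fun setT w1 -> measurable_fun setT w2 -> measurable_fun setT w3 ->
  measurable_fun setT c ->
  measurable_fun setT (fun t => q (w1 t, (w2 t, w3 t)) (c t) : mR).
Proof.
move=> h1 h2 h3 hc; apply: measurable_funD; [apply: measurable_funD; [apply: measurable_funD|]|].
- exact: measurableT_comp.
- by apply: measurable_funM => //; exact: measurableT_comp.
- by apply: measurable_funM => //; exact: measurableT_comp.
- by apply: measurable_funM => //; exact: measurableT_comp.
Qed.

Let mq w : measurable_fun setT (q w : Y -> mR).
Proof. by case: w => w1 [w2 w3]; exact: (mq2 (c := id)). Qed.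

Let mell w : measurable_fun setT (ell w : mR * Y -> mR).
Proof.
apply: measurable_funD; first exact: measurable_fst.
exact: (measurableT_comp (mq w) measurable_snd).
Qed.

Let mb d' (T : measurableType d') (a : T -> mR) (c : T -> Y) :
  measurable_fun setT a -> measurable_fun setT c ->
  measurable_fun setT (fun t => b (a t) (c t)).
Proof.
move=> ma mc.
have mBi : measurable_fun setT (\1_B : mR * Y -> R) by exact: measurable_indic.
by apply: (measurableT_comp mBi); exact: measurable_fun_pair.
Qed.

Let qR w y : U3 w -> Yd y -> `|q w y| <= 4 * R0.
Proof.
case: w => w1 [w2 w3] [/= h1 [/= h2 h3]] /YR[ho hx1 hx2 hx3].
have aux (x u : R) : `|x| <= R0 -> U u -> `|x * u| <= R0.
  rewrite /U/= in_itv/= => xR /andP[u0 u1]; rewrite normrM (ger0_norm u0).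
  by rewrite (le_trans _ xR)// ler_piMr.
have := aux _ _ hx1 h1; have := aux _ _ hx2 h2; have := aux _ _ hx3 h3.
rewrite /q/=; move: ho; rewrite !ler_norml; lra.
Qed.

Let fM := fine (m Yd).

Let f_norm w s : `|f w s| <= fM.
Proof.
rewrite -[leRHS]mul1r; apply: normr_Rintegral_le => //.
apply: mb => //; apply: measurable_funB => //; exact: mq.
Qed.

Let f_supp w s : U3 w -> 5 * R0 < `|s| -> f w s = 0.
Proof.
move=> w3 sR; rewrite /f (@eq_Rintegral _ _ _ m Yd (fun=> 0)).
  by rewrite Rintegral_cst// mul0r.
move=> y; rewrite inE => Yy; apply: b_supp.
have := qR w3 Yy; have := ler_distD 0 s (q w y).
rewrite subr0 sub0r normrN => h1 h2.
have h3 : `|s| <= `|s - q w y| + `|q w y|.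
  by rewrite -{1}(subrK (q w y) s) ler_normD.
lra.
Qed.

Let mf w : measurable_fun setT (f w : mR -> R).
Proof.
apply: (@measurable_Rintegral _ _ _ _ _ m Yd (fun p : mR * Y => b (p.1 - q w p.2) p.2) 1) => //.
  apply: mb; last exact: measurable_snd.
  apply: measurable_funB; first exact: measurable_fst.
  exact: (measurableT_comp (mq w) measurable_snd).
Qed.

Let IYdoo : (mul (I `*` Yd) < +oo)%E.
Proof.
exact: prod_measure_lty.
Qed.

Let BIY : B `<=` I `*` Yd.
Proof.
move=> p /BR[h1 h2]; split=> //=; apply/inI; rewrite (le_trans h1)//.
by move: R00; rewrite /K; lra.
Qed.

Let Boo : (mul B < +oo)%E.
Proof.
apply: le_lt_trans IYdoo; apply: le_measure => //; rewrite inE//.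
exact: measurableX.
Qed.

Let density_formula w (phi : R -> R) (M : R) : U3 w ->
  measurable_fun [set: mR] phi -> (forall x, `|phi x| <= M) ->
  \int[mul]_(p in B) phi (ell w p) = \int[lam]_(s in I) (phi s * f w s).
Proof.
move=> w3 mphi phiM; have M0 : 0 <= M := le_trans (normr_ge0 _) (phiM 0).
have bphi s t y : `|phi s * b t y| <= M.
  by rewrite normrM -[leRHS]mulr1 ler_pM.
pose F1 (p : mR * Y) : R := phi (p.1 + q w p.2) * b p.1 p.2.
pose F2 (p : mR * Y) : R := phi p.1 * b (p.1 - q w p.2) p.2.
have mF1 : measurable_fun setT F1.
  apply: measurable_funM; first exact: (measurableT_comp mphi (mell w)).
  by apply: mb; [exact: measurable_fst|exact: measurable_snd].
have mF2 : measurable_fun setT F2.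
  apply: measurable_funM; first exact: (measurableT_comp mphi measurable_fst).
  apply: mb; last exact: measurable_snd.
  apply: measurable_funB; first exact: measurable_fst.
  exact: (measurableT_comp (mq w) measurable_snd).
transitivity (\int[mul]_(p in I `*` Yd) F1 p).
  rewrite -{1}(setIidr BIY) Rintegral_mkcondr; apply: eq_Rintegral => -[s y] _.
  rewrite /patch /F1 /b indicE /ell /=; case: ifPn => _; by rewrite ?mulr1 ?mulr0.
transitivity (\int[mul]_(p in I `*` Yd) F2 p).
  rewrite (@Rfubini2 _ _ _ _ _ lam m I Yd F1 M mI mYd Ioo Ydoo mF1 (fun z _ => bphi _ _ _)).
  rewrite (@Rfubini2 _ _ _ _ _ lam m I Yd F2 M mI mYd Ioo Ydoo mF2 (fun z _ => bphi _ _ _)).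
  apply: eq_Rintegral => y; rewrite inE => Yy.
  have qy := qR w3 Yy.
  rewrite -[RHS](@Rintegral_supp_shift R I (fun s => phi s * b (s - q w y) y) (q w y))//.
  - by apply: eq_Rintegral => s _; rewrite /F1/= addrK.
  - apply: measurable_funM => //; apply: mb => //; exact: measurable_funB.
  - move=> x /inI/negP; rewrite -ltNge => xK; rewrite b_supp ?mulr0//.
    have h3 : `|x| <= `|x - q w y| + `|q w y| by rewrite -{1}(subrK (q w y) x) ler_normD.
    by move: xK h3 qy R00; rewrite /K; lra.
  - move=> x /inI/negP; rewrite -ltNge => xK; rewrite b_supp ?mulr0// addrK.
    by move: xK R00; rewrite /K; lra.
rewrite (@Rfubini1 _ _ _ _ _ lam m I Yd F2 M mI mYd Ioo Ydoo mF2 (fun z _ => bphi _ _ _)); apply: eq_Rintegral => s _.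
rewrite /F2/= RintegralZl//; apply: (bounded_integrable (M := 1)) => //.
by apply: mb => //; apply: measurable_funB => //; exact: mq.
Qed.

Let Df w h s : R := f w (s - 2 * h) - 2 * f w (s - h) + f w s.

Let mshift (g : R -> R) a : measurable_fun [set: mR] g ->
  measurable_fun [set: mR] (fun s : mR => g (s + a)).
Proof. by move=> mg; apply: (measurableT_comp mg); exact: measurable_funD. Qed.

Let fM0 : 0 <= fM. Proof. by rewrite fine_ge0. Qed.

Let Df_norm w h s : `|Df w h s| <= 4 * fM.
Proof.
rewrite /Df; have := f_norm w (s - 2 * h); have := f_norm w (s - h); have := f_norm w s.
rewrite !ler_norml; lra.
Qed.

Let mDf w h : measurable_fun [set: mR] (Df w h).
Proof.
apply: measurable_funD => //; apply: measurable_funB; first exact: mshift.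
by apply: measurable_funM => //; exact: mshift.
Qed.

Let bint (g : R -> R) (M : R) : measurable_fun [set: mR] g ->
  (forall x, `|g x| <= M) -> lam.-integrable I (EFin \o (g : mR -> R)).
Proof. by move=> mg gM; apply: (bounded_integrable (M := M)). Qed.

Let second_difference_formula w h (phi : R -> R) (M : R) : U3 w -> 0 <= h -> h <= 1 ->
  measurable_fun [set: mR] phi -> (forall x, `|phi x| <= M) ->
  \int[mul]_(p in B) (phi (ell w p + 2 * h) - 2 * phi (ell w p + h) + phi (ell w p)) =
  \int[lam]_(s in I) (phi s * Df w h s).
Proof.
move=> w3 h0 h1 mphi phiM; have M0 : 0 <= M := le_trans (normr_ge0 _) (phiM 0).
pose phi2 s := phi (s + 2 * h) - 2 * phi (s + h) + phi s.
have mphi2 : measurable_fun [set: mR] phi2.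
  apply: measurable_funD => //; apply: measurable_funB; first exact: mshift.
  by apply: measurable_funM => //; exact: mshift.
rewrite (@density_formula w phi2 (4 * M))//; last first.
  move=> x; rewrite /phi2; have := phiM (x + 2 * h); have := phiM (x + h); have := phiM x.
  rewrite !ler_norml; lra.
have shift a : 0 <= a -> a <= 2 ->
    \int[lam]_(s in I) (phi (s + a) * f w s) = \int[lam]_(s in I) (phi s * f w (s - a)).
  move=> a0 a2; pose u s := phi s * f w (s - a).
  have mu_ : measurable_fun [set: mR] u by apply: measurable_funM => //; exact: mshift.
  have u0 x : ~ I x -> u x = 0.
    move=> /inI/negP; rewrite -ltNge => xK; rewrite /u f_supp ?mulr0//.
    have h3 : `|x| <= `|x - a| + `|a| by rewrite -{1}(subrK a x) ler_normD.
    by move: xK h3 R00; rewrite (ger0_norm a0) /K; lra.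
  have ua0 x : ~ I x -> u (x + a) = 0.
    move=> /inI/negP; rewrite -ltNge => xK; rewrite /u f_supp ?mulr0// addrK.
    by move: xK R00; rewrite /K; lra.
  transitivity (\int[lam]_(s in I) u (s + a)).
    by apply: eq_Rintegral => s _; rewrite /u addrK.
  exact: Rintegral_supp_shift.
have intp a c : lam.-integrable I (EFin \o (fun s : mR => phi (s + a) * f w (s + c))).
  apply: (@bint _ (M * fM)) => [|x]; first by apply: measurable_funM; exact: mshift.
  by rewrite normrM ler_pM.
have intp0 c : lam.-integrable I (EFin \o (fun s : mR => phi s * f w (s + c))).
  by have := intp 0 c; apply: eq_integrable => // x _ /=; rewrite addr0.
have intp1 a : lam.-integrable I (EFin \o (fun s : mR => phi (s + a) * f w s)).
  by have := intp a 0; apply: eq_integrable => // x _ /=; rewrite addr0.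
have intp2 : lam.-integrable I (EFin \o (fun s : mR => phi s * f w s)).
  by have := intp1 0; apply: eq_integrable => // x _ /=; rewrite addr0.
have Zint (g : mR -> R) : lam.-integrable I (EFin \o g) -> lam.-integrable I (EFin \o (fun x => 2 * g x)).
  by move=> ig; have := integrableZl mI 2 ig.
have E1 : \int[lam]_(s in I) (phi2 s * f w s) = \int[lam]_(s in I) (phi (s + 2 * h) * f w s)
   - 2 * \int[lam]_(s in I) (phi (s + h) * f w s) + \int[lam]_(s in I) (phi s * f w s).
  rewrite -RintegralZl// -RintegralB//; last exact: Zint.
  rewrite -RintegralD//; last by have := integrableB mI (intp1 (2 * h)) (Zint _ (intp1 h)).
  by apply: eq_Rintegral => s _; rewrite /phi2; ring.
have h2 : 0 <= 2 * h <= 2 by lra.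
have /andP[h20 h22] := h2.
rewrite E1 (shift _ h20 h22) (shift _ h0 (le_trans h1 (ler1n _ 2))).
rewrite -RintegralZl// -RintegralB//; last exact: Zint.
rewrite -RintegralD//; last by have := integrableB mI (intp0 (- (2 * h))) (Zint _ (intp0 (- h))).
by apply: eq_Rintegral => s _; rewrite /Df; ring.
Qed.

Let J w h : R := \int[lam]_(s in I) (Df w h s ^+ 2).

(* AM-GM: [|phi D| <= (eps + D^2 / eps) / 2]. *)
Let second_difference_bound w h eps (phi : R -> R) : U3 w -> 0 <= h -> h <= 1 -> 0 < eps ->
  measurable_fun [set: mR] phi -> (forall x, `|phi x| <= 1) ->
  `|\int[mul]_(p in B) (phi (ell w p + 2 * h) - 2 * phi (ell w p + h) + phi (ell w p))|
    <= K * eps + J w h / (2 * eps).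
Proof.
move=> w3 h0 h1 e0 mphi phi1.
rewrite (second_difference_formula w3 h0 h1 mphi phi1).
have Kp : - K <= K by move: R00; rewrite /K; lra.
have mD2 : measurable_fun [set: mR] (fun s : mR => Df w h s ^+ 2) by exact: measurable_funX.
have iD2 : lam.-integrable I (EFin \o (fun s : mR => Df w h s ^+ 2)).
  apply: (@bint _ ((4 * fM) ^+ 2)) => // x.
  by rewrite normrX lerXn2r ?nnegrE// mulr_ge0.
have iZ : lam.-integrable I (EFin \o (fun s : mR => (2 * eps)^-1 * Df w h s ^+ 2)).
  by have := integrableZl mI (2 * eps)^-1 iD2.
have ic (c : R) : lam.-integrable I (EFin \o (fun s : mR => c)).
  by apply: (@bint _ `|c|).
have ip : lam.-integrable I (EFin \o (fun s : mR => phi s * Df w h s)).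
  apply: (@bint _ (1 * (4 * fM))) => [|x]; first exact: measurable_funM.
  by rewrite normrM ler_pM.
apply: (le_trans (le_normr_Rintegral mI ip)).
have -> : K * eps + J w h / (2 * eps) = \int[lam]_(s in I) (eps / 2 + (2 * eps)^-1 * Df w h s ^+ 2).
  rewrite RintegralD// (RintegralZl _ mI iD2) Rintegral_cst// (fine_lebesgue_itv true false Kp).
  by rewrite /J; field; rewrite gt_eqF.
apply: le_Rintegral => //.
- exact: integrable_norm.
- by have := integrableD mI (ic (eps / 2)) iZ.
move=> s _; rewrite normrM.
apply: (@le_trans _ _ `|Df w h s|); first by rewrite ler_piMl.
rewrite -[Df w h s ^+ 2]real_normK ?num_real//; exact: am_gm_bound.
Qed.

Let W3 := lebesgue3 R.
Let Z3 : {sigma_finite_measure set _ -> \bar R} := prod_measure mul m.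
Let G (t : (mR * (mR * mR)) * ((mR * Y) * Y)) (h : R) : R :=
  fourth_difference (fun s => b s t.2.2) h (ell t.1 t.2.1 - q t.1 t.2.2).

Let G_norm t h : `|G t h| <= 16.
Proof. by apply: fourth_difference_le => x; exact: b_norm. Qed.

Let mG h : measurable_fun setT (G ^~ h).
Proof.
pose a (t : (mR * (mR * mR)) * ((mR * Y) * Y)) : mR := ell t.1 t.2.1 - q t.1 t.2.2.
have mw1 : measurable_fun setT (fun t : (mR * (mR * mR)) * ((mR * Y) * Y) => t.1.1 : mR).
  exact: (measurableT_comp measurable_fst measurable_fst).
have mw2 : measurable_fun setT (fun t : (mR * (mR * mR)) * ((mR * Y) * Y) => t.1.2.1 : mR).
  exact: (measurableT_comp measurable_fst (measurableT_comp measurable_snd measurable_fst)).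
have mw3 : measurable_fun setT (fun t : (mR * (mR * mR)) * ((mR * Y) * Y) => t.1.2.2 : mR).
  exact: (measurableT_comp measurable_snd (measurableT_comp measurable_snd measurable_fst)).
have my : measurable_fun setT (fun t : (mR * (mR * mR)) * ((mR * Y) * Y) => t.2.2 : Y).
  exact: (measurableT_comp measurable_snd measurable_snd).
have my' : measurable_fun setT (fun t : (mR * (mR * mR)) * ((mR * Y) * Y) => t.2.1.2 : Y).
  exact: (measurableT_comp measurable_snd (measurableT_comp measurable_fst measurable_snd)).
have ms : measurable_fun setT (fun t : (mR * (mR * mR)) * ((mR * Y) * Y) => t.2.1.1 : mR).
  exact: (measurableT_comp measurable_fst (measurableT_comp measurable_fst measurable_snd)).
have ma : measurable_fun setT a.
  apply: measurable_funB; first (apply: measurable_funD => //).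
    exact: (mq2 mw1 mw2 mw3 my').
  exact: (mq2 mw1 mw2 mw3 my).
have mba c : measurable_fun setT (fun t => b (a t + c) t.2.2).
  by apply: mb => //; exact: measurable_funD.
have mba0 : measurable_fun setT (fun t => b (a t) t.2.2) by exact: mb.
have mZ c (g : (mR * (mR * mR)) * ((mR * Y) * Y) -> R) : measurable_fun setT g ->
    measurable_fun setT (fun t => c * g t) by move=> mg; exact: measurable_funM.
rewrite /G /fourth_difference; apply: measurable_funD => //.
apply: measurable_funB; last exact: mZ.
apply: measurable_funD; last exact: mZ.
by apply: measurable_funB => //; exact: mZ.
Qed.

Let mBYd : measurable (B `*` Yd). Proof. exact: measurableX. Qed.
Let BYdoo : (Z3 (B `*` Yd) < +oo)%E. Proof. exact: prod_measure_lty. Qed.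
Let U3oo : (W3 U3 < +oo)%E.
Proof.
apply: prod_measure_lty; [exact: measurable_itv|apply: measurableX; exact: measurable_itv| |].
- exact: lebesgue_itv_lty.
- by apply: prod_measure_lty; [exact: measurable_itv..| |]; exact: lebesgue_itv_lty.
Qed.

Let J_energy w h : U3 w -> 0 <= h -> h <= 1 ->
  J w h = \int[Z3]_(z in B `*` Yd) G (w, z) h.
Proof.
move=> w3 h0 h1.
have := second_difference_formula w3 h0 h1 (mDf w h) (Df_norm w h).
have -> : \int[lam]_(s in I) (Df w h s * Df w h s) = J w h.
  by apply: eq_Rintegral => s _; rewrite expr2.
move=> <-.
have mGw : measurable_fun setT (fun z => G (w, z) h).
  exact: (measurableT_comp (mG h) (measurable_pair1 w)).
rewrite (@Rfubini1 _ _ _ _ _ mul m B Yd (fun z => G (w, z) h) 16 mB mYd Boo Ydoo mGw (fun z _ => G_norm _ _)).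
apply: eq_Rintegral => p _.
have ib a : m.-integrable Yd (EFin \o (fun y => b (ell w p - q w y + a) y)).
  apply: (bounded_integrable (M := 1)) => //.
  by apply: mb => //; apply: measurable_funD => //; apply: measurable_funB => //; exact: mq.
have ib0 : m.-integrable Yd (EFin \o (fun y => b (ell w p - q w y) y)).
  by have := ib 0; apply: eq_integrable => // y _ /=; rewrite addr0.
have iZ c a : m.-integrable Yd (EFin \o (fun y => c * b (ell w p - q w y + a) y)).
  by have := integrableZl mYd c (ib a).
have iZ0 c : m.-integrable Yd (EFin \o (fun y => c * b (ell w p - q w y) y)).
  by have := integrableZl mYd c ib0.
have fE a : f w (ell w p + a) = \int[m]_(y in Yd) b (ell w p - q w y + a) y.
  by apply: eq_Rintegral => y _; rewrite addrAC.
have i1 := integrableB mYd (ib (2 * h)) (iZ 4 h).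
have i2 := integrableD mYd i1 (iZ0 6).
have i3 := integrableB mYd i2 (iZ 4 (- h)).
rewrite /G /fourth_difference /=.
rewrite RintegralD// RintegralB// RintegralD// RintegralB// !RintegralZl//.
rewrite -!fE /Df.
have -> : ell w p + 2 * h - 2 * h = ell w p by ring.
have -> : ell w p + 2 * h - h = ell w p + h by ring.
have -> : ell w p + h - 2 * h = ell w p - h by ring.
have -> : ell w p + h - h = ell w p by ring.
have -> : \int[m]_(y in Yd) b (ell w p - q w y) y = f w (ell w p) by [].
ring.
Qed.

Let mJ h : 0 <= h -> h <= 1 -> measurable_fun setT (fun w => \int[Z3]_(z in B `*` Yd) G (w, z) h).
Proof.
move=> h0 h1.
apply: (@measurable_Rintegral _ _ _ _ _ Z3 (B `*` Yd) (G ^~ h) 16) => //.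
Qed.

Let gam (n : nat) (z : R) (N : nat) : R :=
  \sum_(i < N) 2 * 2^-1 ^+ i * (`|z| <= 2 ^+ i * 2^-1 ^+ n)%R%:R.

Let gam_ge0 n z N : 0 <= gam n z N.
Proof. by apply: sumr_ge0 => i _; rewrite !mulr_ge0 ?exprn_ge0. Qed.

Let gam_cover n z N : `|z| <= 2 ^+ N * 2^-1 ^+ n ->
  2^-1 ^+ n <= `|z| * gam n z N.+1 \/ 1 <= gam n z N.+1.
Proof.
move=> zN.
have ex : exists i, `|z| <= 2 ^+ i * 2^-1 ^+ n by exists N.
case: (ex_minnP ex) => i zi imin.
have iN : (i <= N)%N by exact: imin.
have gi : 2 * 2^-1 ^+ i <= gam n z N.+1.
  have iN' : (i < N.+1)%N by rewrite ltnS.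
  rewrite /gam (bigD1 (Ordinal iN'))//= zi mulr1 lerDl.
  by apply: sumr_ge0 => j _; rewrite !mulr_ge0 ?exprn_ge0.
case: i zi imin iN gi => [|i] zi imin iN gi.
  by right; apply: le_trans gi; rewrite expr0; lra.
left; have : 2 ^+ i * 2^-1 ^+ n < `|z|.
  by rewrite ltNge; apply/negP => /imin; rewrite ltnn.
move=> /ltW zlt.
have p0 : 0 <= 2 ^+ i * 2^-1 ^+ n :> R by rewrite mulr_ge0 ?exprn_ge0.
apply: (@le_trans _ _ ((2 ^+ i * 2^-1 ^+ n) * (2 * 2^-1 ^+ i.+1))).
  by rewrite mulrAC exprS (mulrA 2) divff// mul1r -exprMn divff// expr1n mul1r.
by apply: ler_pM => //; rewrite mulr_ge0 ?exprn_ge0.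
Qed.

Let mbox (x : Y -> mR) (a e : R) : measurable_fun setT x ->
  measurable [set y | `|a - x y| <= e].
Proof.
move=> mx; have mI' : measurable (`[a - e, a + e]%classic : set mR) by exact: measurable_itv.
have := mx measurableT _ mI'; rewrite setTI; congr measurable.
by apply/seteqP; split=> y /=; rewrite in_itv/= ler_norml; lra.
Qed.

Let gam_integral n a1 a2 a3 N :
  \int[m]_(y in Yd) (gam n (a1 - x1 y) N * gam n (a2 - x2 y) N * gam n (a3 - x3 y) N)
  <= 8 * C0 * N%:R ^+ 3 * (2^-1 ^+ n) ^+ 3.
Proof.
pose A (i j k : nat) : set Y := [set y | [/\ `|a1 - x1 y| <= 2 ^+ i * 2^-1 ^+ n,
  `|a2 - x2 y| <= 2 ^+ j * 2^-1 ^+ n & `|a3 - x3 y| <= 2 ^+ k * 2^-1 ^+ n]].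
have mA i j k : measurable (A i j k).
  have -> : A i j k = [set y | `|a1 - x1 y| <= 2 ^+ i * 2^-1 ^+ n] `&`
     [set y | `|a2 - x2 y| <= 2 ^+ j * 2^-1 ^+ n] `&` [set y | `|a3 - x3 y| <= 2 ^+ k * 2^-1 ^+ n].
    by apply/seteqP; split=> y /=; [move=> []|move=> [[]]].
  by do 2 (apply: measurableI; last exact: mbox); exact: mbox.
pose c (i j k : nat) : R := 8 * (2^-1 ^+ i * 2^-1 ^+ j * 2^-1 ^+ k).
have iA i j k : m.-integrable Yd (EFin \o (fun y => \1_(A i j k) y : R)).
  apply: (bounded_integrable (M := 1)) => //; first exact: measurable_indic.
  by move=> y _; rewrite indicE; case: (_ \in _); rewrite ?normr1 ?normr0.
have icA i j k : m.-integrable Yd (EFin \o (fun y => c i j k * \1_(A i j k) y : R)).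
  by have := integrableZl mYd (c i j k) (iA i j k).
have i2 i j : m.-integrable Yd (EFin \o (fun y => \sum_(k < N) c i j k * \1_(A i j k) y : R)).
  by apply: (@Rintegrable_sum _ _ _ m Yd _ _ (fun (k : 'I_N) y => c i j k * \1_(A i j k) y)).
have i3 i : m.-integrable Yd (EFin \o (fun y => \sum_(j < N) \sum_(k < N) c i j k * \1_(A i j k) y : R)).
  by apply: (@Rintegrable_sum _ _ _ m Yd _ _ (fun (j : 'I_N) y => \sum_(k < N) c i j k * \1_(A i j k) y)).
have -> : \int[m]_(y in Yd) (gam n (a1 - x1 y) N * gam n (a2 - x2 y) N * gam n (a3 - x3 y) N) =
    \int[m]_(y in Yd) \sum_(i < N) \sum_(j < N) \sum_(k < N) c i j k * \1_(A i j k) y.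
  apply: eq_Rintegral => y _; rewrite /gam big_distrlr/= mulr_suml.
  apply: eq_bigr => i _; rewrite mulr_suml; apply: eq_bigr => j _.
  rewrite mulr_sumr; apply: eq_bigr => k _.
  have -> : \1_(A i j k) y = (`|a1 - x1 y| <= 2 ^+ i * 2^-1 ^+ n)%R%:R *
     (`|a2 - x2 y| <= 2 ^+ j * 2^-1 ^+ n)%R%:R * (`|a3 - x3 y| <= 2 ^+ k * 2^-1 ^+ n)%R%:R :> R.
    rewrite indicE -!natrM !mulnb; congr ((nat_of_bool _)%:R); apply/idP/idP.
      by rewrite inE => -[-> -> ->].
    by rewrite inE => /andP[/andP[? ?] ?]; split.
  by rewrite /c; move: (2^-1 ^+ i) (2^-1 ^+ j) (2^-1 ^+ k) => u v t; ring.
rewrite (@Rintegral_sum _ _ _ m Yd _ _ (fun (i : 'I_N) y => \sum_(j < N) \sum_(k < N) c i j k * \1_(A i j k) y))//.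
have -> : 8 * C0 * N%:R ^+ 3 * (2^-1 ^+ n) ^+ 3 = \sum_(i < N) \sum_(j < N) \sum_(k < N) (8 * C0 * (2^-1 ^+ n) ^+ 3).
  do 3 rewrite sumr_const card_ord -[_ *+ N]mulr_natr; ring.
apply: ler_sum => i _.
rewrite (@Rintegral_sum _ _ _ m Yd _ _ (fun (j : 'I_N) y => \sum_(k < N) c i j k * \1_(A i j k) y))//.
apply: ler_sum => j _.
rewrite (@Rintegral_sum _ _ _ m Yd _ _ (fun (k : 'I_N) y => c i j k * \1_(A i j k) y))//.
apply: ler_sum => k _.
rewrite (RintegralZl _ mYd (iA i j k)) Rintegral_indic//.
have p0 (l : nat) : 0 <= 2 ^+ l * 2^-1 ^+ n :> R by rewrite mulr_ge0 ?exprn_ge0.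
have c0 : 0 <= c i j k by rewrite /c !mulr_ge0 ?exprn_ge0.
apply: (le_trans (ler_wpM2l c0 (box a1 a2 a3 (p0 i) (p0 j) (p0 k)))).
rewrite le_eqVlt; apply/orP; left; apply/eqP.
have e (l : nat) : 2^-1 ^+ l * 2 ^+ l = 1 :> R by rewrite -exprMn mulVf// expr1n.
have := e i; have := e j; have := e k.
rewrite /c; move: (2^-1 ^+ i) (2^-1 ^+ j) (2^-1 ^+ k) (2 ^+ i) (2 ^+ j) (2 ^+ k) (2^-1 ^+ n) => u1 u2 u3 v1 v2 v3 h E3 E2 E1.
transitivity (8 * C0 * h ^+ 3 * (u1 * v1) * (u2 * v2) * (u3 * v3)); first by ring.
by rewrite E1 E2 E3; ring.
Qed.

Variable n0 : nat.
Hypothesis n0R : 2 * R0 <= 2 ^+ n0.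

Let energy_average n :
  \int[W3]_(w in U3) \int[Z3]_(z in B `*` Yd) G (w, z) (2^-1 ^+ n) <=
    128 * (8 * C0 * (n + n0).+1%:R ^+ 3 * (2^-1 ^+ n) ^+ 3) * fine (mul B).
Proof.
pose h : R := 2^-1 ^+ n; pose N := (n + n0).+1.
have h0 : 0 <= h by rewrite exprn_ge0.
rewrite -(@Rfubini1 _ _ _ _ _ W3 Z3 U3 (B `*` Yd) (G ^~ h) 16 mU3 mBYd U3oo BYdoo (mG h) (fun z _ => G_norm _ _)).
rewrite (@Rfubini2 _ _ _ _ _ W3 Z3 U3 (B `*` Yd) (G ^~ h) 16 mU3 mBYd U3oo BYdoo (mG h) (fun z _ => G_norm _ _)).
pose V (z : (mR * Y) * Y) : R := 128 * (gam n (x1 z.1.2 - x1 z.2) N * gam n (x2 z.1.2 - x2 z.2) N * gam n (x3 z.1.2 - x3 z.2) N).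
have mgam (x : Y -> mR) : measurable_fun setT x ->
    measurable_fun setT (fun z : (mR * Y) * Y => gam n (x z.1.2 - x z.2) N).
  move=> mx; apply: measurable_sum => i; apply: measurable_funM => //.
  have mX : measurable_fun setT (fun z : (mR * Y) * Y => `|x z.1.2 - x z.2| : mR).
    apply: measurableT_comp => //; apply: measurable_funB.
      exact: (measurableT_comp mx (measurableT_comp measurable_snd measurable_fst)).
    exact: (measurableT_comp mx measurable_snd).
  have -> : (fun z : (mR * Y) * Y => (`|x z.1.2 - x z.2| <= 2 ^+ i * 2^-1 ^+ n)%R%:R) =
     (\1_[set z : (mR * Y) * Y | `|x z.1.2 - x z.2| <= 2 ^+ i * 2^-1 ^+ n] : (mR * Y) * Y -> R).
    by apply/funext => z; rewrite indicE; congr ((nat_of_bool _)%:R); apply/idP/idP; rewrite inE.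
  apply: measurable_indic.
  have mI' : measurable (`]-oo, 2 ^+ i * 2^-1 ^+ n]%classic : set mR) by exact: measurable_itv.
  have := mX measurableT _ mI'; by rewrite setTI.
have mV : measurable_fun setT V.
  by apply: measurable_funM => //; do 2 (apply: measurable_funM; last exact: mgam); exact: mgam.
have gamM z : `|gam n z N| <= 2 * N%:R.
  rewrite ger0_norm ?gam_ge0// mulr_natr -[X in _ *+ X](card_ord N) -sumr_const.
  apply: ler_sum => i _; rewrite -[leRHS]mulr1 ler_pM ?mulr_ge0 ?exprn_ge0//.
    by rewrite ler_piMr// exprn_ile1 ?invr_ge0// invf_le1// ler1n.
  by case: (`|z| <= _)%R.
have VM z : `|V z| <= 128 * ((2 * N%:R) * (2 * N%:R) * (2 * N%:R)).
  rewrite /V normrM ger0_norm// ler_wpM2l// !normrM.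
  by apply: ler_pM => //; apply: ler_pM.
have iV : Z3.-integrable (B `*` Yd) (EFin \o V).
  by apply: (bounded_integrable (M := 128 * ((2 * N%:R) * (2 * N%:R) * (2 * N%:R)))).
have mGint : measurable_fun setT (fun z => \int[W3]_(w in U3) G (w, z) h).
  apply: (@measurable_Rintegral _ _ _ _ _ W3 U3 (fun t : ((mR * Y) * Y) * _ => G (t.2, t.1) h) 16) => //.
  exact: (measurableT_comp (mG h) (measurable_fun_pair measurable_snd measurable_fst)).
have GintM z : `|\int[W3]_(w in U3) G (w, z) h| <= 16 * fine (W3 U3).
  apply: normr_Rintegral_le => //.
  exact: (measurableT_comp (mG h) (measurable_pair2 z)).
apply: (@le_trans _ _ (\int[Z3]_(z in B `*` Yd) V z)).
  apply: le_Rintegral => //.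
    by apply: (bounded_integrable (M := 16 * fine (W3 U3))).
  move=> [[s y'] y] [/= By Yy]; have [_ Yy'] := BR By.
  apply: (le_trans (ler_norm _)); rewrite /V/= -mulrA.
  have [ho hx1 hx2 hx3] := YR Yy; have [ho' hx1' hx2' hx3'] := YR Yy'.
  have hz (u v : R) : `|u| <= R0 -> `|v| <= R0 -> `|u - v| <= 2 ^+ (n + n0) * 2^-1 ^+ n.
    move=> uR vR; rewrite exprD mulrAC -exprMn divff// expr1n mul1r.
    by apply: le_trans n0R; rewrite (le_trans (ler_normB _ _))// mulr_natl mulr2n lerD.
  have := @average_fourth_difference R (fun s => b s y) (s + o y' - o y) h
    (x1 y' - x1 y) (x2 y' - x2 y) (x3 y' - x3 y)
    (gam n (x1 y' - x1 y) N) (gam n (x2 y' - x2 y) N) (gam n (x3 y' - x3 y) N).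
  have mby : measurable_fun [set: mR] (fun s : mR => b s y) by exact: mb.
  move=> /(_ mby (fun s => b_norm s y) h0 (gam_ge0 _ _ _) (gam_ge0 _ _ _) (gam_ge0 _ _ _)).
  move=> /(_ (gam_cover (hz _ _ hx1' hx1)) (gam_cover (hz _ _ hx2' hx2)) (gam_cover (hz _ _ hx3' hx3))).
  rewrite -[X in _ <= _ * X -> _]mulrA; congr (`| _ | <= _).
  apply: eq_Rintegral => w _; rewrite /G; congr fourth_difference.
  by rewrite /ell /q/=; ring.
rewrite (@Rfubini1 _ _ _ _ _ mul m B Yd V _ mB mYd Boo Ydoo mV (fun z _ => VM _)).
rewrite -Rintegral_cst//; apply: le_Rintegral => //.
- apply: (bounded_integrable (M := 128 * ((2 * N%:R) * (2 * N%:R) * (2 * N%:R)) * fM)) => //.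
    exact: (@measurable_Rintegral _ _ _ _ _ m Yd V _ mYd Ydoo mV (fun x y _ => VM _)).
  move=> p _; apply: normr_Rintegral_le => //.
  exact: (measurableT_comp mV (measurable_pair1 p)).
- by apply: (bounded_integrable (M := `|128 * (8 * C0 * (n + n0).+1%:R ^+ 3 * (2^-1 ^+ n) ^+ 3)|)).
move=> p _; rewrite /V/= RintegralZl//.
  by rewrite ler_wpM2l// gam_integral.
have mVp : measurable_fun setT (fun y => V (p, y)) by exact: (measurableT_comp mV (measurable_pair1 p)).
have iVp : m.-integrable Yd (EFin \o (fun y => V (p, y))).
  by apply: (bounded_integrable (M := 128 * ((2 * N%:R) * (2 * N%:R) * (2 * N%:R)))).
have := integrableZl mYd 128^-1 iVp; apply: eq_integrable => // y _ /=.
by rewrite -EFinM /V/=; congr EFin; field.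
Qed.

Lemma smoothing_direction : exists w, U3 w /\ exists2 A, 0 <= A &
  forall n (phi : R -> R), measurable_fun [set: mR] phi -> (forall x, `|phi x| <= 1) ->
  `|\int[prod_measure lam m]_(p in B)
     (phi (ell w p + 2 * 2^-1 ^+ n) - 2 * phi (ell w p + 2^-1 ^+ n) + phi (ell w p))|
  <= A * (2 / 5) ^+ n.
Proof.
pose X n (w : mR * (mR * mR)) : R :=
  (25 / 4) ^+ n * \int[Z3]_(z in B `*` Yd) G (w, z) (2^-1 ^+ n).
have h0 n : 0 <= 2^-1 ^+ n :> R by rewrite exprn_ge0.
have h1 n : 2^-1 ^+ n <= 1 :> R by rewrite exprn_ile1 ?invr_ge0// invf_le1// ler1n.
have mGz n : measurable_fun setT (fun w => \int[Z3]_(z in B `*` Yd) G (w, z) (2^-1 ^+ n)).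
  exact: mJ.
have Gzi n : W3.-integrable U3
    (EFin \o (fun w => \int[Z3]_(z in B `*` Yd) G (w, z) (2^-1 ^+ n))).
  apply: (bounded_integrable (M := 16 * fine (Z3 (B `*` Yd)))) => // w _.
  apply: normr_Rintegral_le => //.
  exact: (measurableT_comp (mG _) (measurable_pair1 w)).
have mX n : measurable_fun setT (X n) by exact: measurable_funM.
have iX n : W3.-integrable U3 (EFin \o X n).
  by have := integrableZl mU3 ((25 / 4) ^+ n) (Gzi n).
have X0 n w : U3 w -> 0 <= X n w.
  move=> Uw; rewrite /X -J_energy// mulr_ge0 ?exprn_ge0//.
  by apply: Rintegral_ge0 => s _; exact: sqr_ge0.
have W30 : (0 < W3 U3)%E.
  have mU : measurable U by exact: measurable_itv.
  have := prod_measureE lam (prod_measure lam lam) mU (measurableX mU mU).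
  have E2 := prod_measureE lam lam mU mU => E1.
  have -> : W3 U3 = (lam U * (lam U * lam U))%E.
    by apply: etrans E1 _; congr (_ * _)%E; exact: E2.
  rewrite /U !lebesgue_measure_itv/= lte_fin ltr01 oppr0 !adde0.
  by rewrite !mule1.
have [c c0 sumc] := cubic_geometric_sum R n0.
pose k := 128 * 8 * C0 * fine (mul B).
have k0 : 0 <= k by rewrite !mulr_ge0// fine_ge0.
have sumX n : \sum_(i < n) \int[W3]_(w in U3) X i w <= k * c.
  apply: (le_trans _ (ler_wpM2l k0 (sumc n))); rewrite mulr_sumr; apply: ler_sum => i _.
  rewrite /X (RintegralZl _ mU3 (Gzi i)) mulrCA ler_wpM2l ?exprn_ge0//.
  by rewrite (le_trans (energy_average i))// /k le_eqVlt; apply/orP; left; apply/eqP; ring.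
have [w Uw [K' XK]] := exists_bounded_sequence mU3 W30 mX X0 iX sumX.
exists w; split=> //; exists (K + K' / 2).
  have := X0 0%N w Uw; have := XK 0%N; move: R00; rewrite /K; lra.
move=> n phi mphi phi1.
have e0 : 0 < (2 / 5) ^+ n :> R by rewrite exprn_gt0.
apply: (le_trans (second_difference_bound Uw (h0 n) (h1 n) e0 mphi phi1)).
rewrite [leRHS]mulrDl lerD2l J_energy//.
have XK' := XK n; rewrite /X in XK'; move: XK'; move: (\int[Z3]_(z in _) _) => J' XK'.
rewrite ler_pdivrMr ?mulr_gt0//.
have E : (25 / 4) ^+ n * ((2 / 5) ^+ n * (2 / 5) ^+ n) = 1 :> R.
  by rewrite -!exprMn (_ : 25 / 4 * _ = 1) ?expr1n//; field.
have -> : K' / 2 * (2 / 5) ^+ n * (2 * (2 / 5) ^+ n) = K' * ((2 / 5) ^+ n * (2 / 5) ^+ n).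
  by field.
have -> : J' = (25 / 4) ^+ n * J' * ((2 / 5) ^+ n * (2 / 5) ^+ n).
  by rewrite mulrAC E mul1r.
by rewrite ler_wpM2r// mulr_ge0// ltW.
Qed.

End smoothing.

Lemma smoothing (R : realType) d (Y : measurableType d)
    (m : {sigma_finite_measure set Y -> \bar R}) (Yd : set Y)
    (o x1 x2 x3 : Y -> measurableTypeR R) (B : set (measurableTypeR R * Y)) (R0 C0 : R) :
  measurable Yd -> (m Yd < +oo)%E ->
  measurable_fun setT o -> measurable_fun setT x1 -> measurable_fun setT x2 ->
  measurable_fun setT x3 -> measurable B ->
  (forall p, B p -> `|p.1| <= R0 /\ Yd p.2) ->
  (forall y, Yd y -> [/\ `|o y| <= R0, `|x1 y| <= R0, `|x2 y| <= R0 & `|x3 y| <= R0]) ->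
  0 <= R0 -> 0 <= C0 ->
  (forall a1 a2 a3 d1 d2 d3, 0 <= d1 -> 0 <= d2 -> 0 <= d3 ->
    fine (m ([set y | [/\ `|a1 - x1 y| <= d1, `|a2 - x2 y| <= d2 & `|a3 - x3 y| <= d3]]
      `&` Yd)) <= C0 * (d1 * d2 * d3)) ->
  exists w1 w2 w3 : R, [/\ 0 <= w1 <= 1, 0 <= w2 <= 1 & 0 <= w3 <= 1] /\
  let l (p : measurableTypeR R * Y) : R := p.1 + (o p.2 + x1 p.2 * w1 + x2 p.2 * w2 + x3 p.2 * w3) in
  exists2 A, 0 <= A & forall n (phi : R -> R),
    measurable_fun [set: measurableTypeR R] phi -> (forall x, `|phi x| <= 1) ->
    `|\int[prod_measure (@lebesgue_measure R) m]_(p in B)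
       (phi (l p + 2 * 2^-1 ^+ n) - 2 * phi (l p + 2^-1 ^+ n) + phi (l p))|
    <= A * (2 / 5) ^+ n.
Proof.
move=> mYd Ydoo mo mx1 mx2 mx3 mB BR YR R00 C00 box.
have [n0 n0R] : exists n0, 2 * R0 <= 2 ^+ n0.
  exists (Num.bound (2 * R0)); rewrite (le_trans (ltW (archi_boundP _)))// ?mulr_ge0//.
  by rewrite -natrX ler_nat ltnW// ltn_expl.
have [[w1 [w2 w3]] [[/= h1 [/= h2 h3]] [A A0 AP]]] :=
  smoothing_direction mYd Ydoo mo mx1 mx2 mx3 mB BR YR R00 C00 box n0R.
exists w1, w2, w3; split; last by exists A.
by move: h1 h2 h3; rewrite /= !in_itv.
Qed.

(** * Affine images of Lebesgue measurable sets *)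

Section tuple_affine.
Context (R : realType).
Local Notation mR := (measurableTypeR R).
Local Notation lam := (@lebesgue_measure R).

Definition tuple_affine n (r : R) (c : n.-tuple R) (t : n.-tuple mR) : n.-tuple mR :=
  [tuple r * tnth t i + tnth c i | i < n].

Lemma measurable_tuple_affine n (r : R) (c : n.-tuple R) :
  measurable_fun [set: n.-tuple mR] (tuple_affine r c).
Proof.
apply/measurable_fun_tnthP => i.
rewrite (_ : _ \o _ = (fun t : n.-tuple mR => r * tnth t i + tnth c i : mR)); last first.
  by apply/funext => t /=; rewrite tnth_mktuple.
apply: measurable_funD => //; apply: measurable_funM => //; exact: measurable_tnth.
Qed.

Lemma tuple_affine_cons n (r c s : R) (c' : n.-tuple R) (y : n.-tuple mR) :
  tuple_affine r [tuple of c :: c'] (tuple_cons (s : mR, y)) =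
  tuple_cons ((r * s + c : mR), tuple_affine r c' y).
Proof.
apply: eq_from_tnth => i; rewrite tnth_mktuple.
by case: (unliftP ord0 i) => [j|] ->; rewrite ?tnthS ?tnth_mktuple//= !tnth0.
Qed.

Lemma integral_affine (r c : R) (f : mR -> \bar R) : 0 < r ->
  measurable_fun setT f -> (forall x, (0 <= f x)%E) ->
  (\int[lam]_x f (r * x + c)%R = r^-1%:E * \int[lam]_x f x)%E.
Proof.
move=> r0 mf f0.
have ri0 : 0 <= r^-1 by rewrite invr_ge0 ltW.
transitivity (\int[image_measure lam (measurable_affine r c)]_x f x)%E.
  apply/esym; exact: (@ge0_integral_pushforward _ _ _ _ R _ (measurable_affine r c)
    lam setT f measurableT mf (fun x _ => f0 x)).
rewrite -(@ge0_integral_mscale _ _ R lam setT measurableT (NngNum ri0) f mf (fun x _ => f0 x)).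
apply: eq_measure_integral => A mA _.
by rewrite /pushforward /= /mscale/=; exact: lebesgue_measure_affine.
Qed.

Lemma lebesgue_tuple_affine n (r : R) (c : n.-tuple R) (A : set (n.-tuple mR)) :
  0 < r -> measurable A ->
  lebesgue_tuple R n (tuple_affine r c @^-1` A) = ((r^-1 ^+ n)%:E * lebesgue_tuple R n A)%E.
Proof.
move=> r0; elim: n c A => [|n IH] c A mA.
  rewrite expr0 mul1e; congr (lebesgue_tuple R 0 _).
  by apply/seteqP; split=> t /=; rewrite (_ : tuple_affine r c t = t)//; apply: eq_from_tnth => -[].
case/tupleP: c => c c'.
have mA' := tuple_cons_preimage mA.
rewrite /= /lebesgue_tuple_succ /pushforward /product_measure1.
have mF := measurable_fun_xsection (lebesgue_tuple R n) mA'.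
transitivity (\int[lam]_x ((r^-1 ^+ n)%:E *
    lebesgue_tuple R n (xsection (@tuple_cons R n @^-1` A) (r * x + c)%R))%E)%E.
  apply: eq_integral => s _; rewrite /= -(IH c'); last exact: measurable_xsection.
  congr (lebesgue_tuple R n _); apply/seteqP; split=> y; rewrite /xsection/= !inE/=;
    by rewrite tuple_affine_cons.
have mF2 : measurable_fun setT (fun s : mR => (lebesgue_tuple R n (xsection (@tuple_cons R n @^-1` A) s))) by exact: mF.
rewrite ge0_integralZl//; last first.
- by rewrite lee_fin exprn_ge0// invr_ge0 ltW.
- exact: (measurableT_comp mF2 (measurable_affine r c)).
rewrite (@integral_affine r c (fun s => lebesgue_tuple R n (xsection (@tuple_cons R n @^-1` A) s)) r0 mF2)//.
by rewrite muleA -EFinM -exprSr.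
Qed.

End tuple_affine.

Section measurable_hull.
Context d (T : measurableType d) (R : realType) (mu : {measure set T -> \bar R}).

Lemma measurable_hull (X : set T) : ((mu^*)%mu X < +oo)%E ->
  exists B, [/\ measurable B, X `<=` B & mu B = (mu^*)%mu X].
Proof.
move=> Xoo.
have Xfin : (mu^*)%mu X \is a fin_num by rewrite ge0_fin_numE// outer_measure_ge0.
have hn (n : nat) : exists B, [/\ measurable B, X `<=` B &
    (mu B <= (mu^*)%mu X + n.+1%:R^-1%:E)%E].
  have e0 : 0 < n.+1%:R^-1 :> R by rewrite invr_gt0.
  have [_ [F [mF XF] <-] Flt] := @lb_ereal_inf_adherent R _ _ e0 Xfin.
  exists (\bigcup_k F k); split=> //; first exact: bigcupT_measurable.
  apply: le_trans (ltW Flt); apply: measure_sigma_subadditive => //.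
  exact: bigcupT_measurable.
pose B n := projT1 (cid (hn n)).
have hB n : [/\ measurable (B n), X `<=` B n & (mu (B n) <= (mu^*)%mu X + n.+1%:R^-1%:E)%E].
  by rewrite /B; case: cid.
have mB : measurable (\bigcap_n B n) by apply: bigcapT_measurable => n; case: (hB n).
have XB : X `<=` \bigcap_n B n by move=> x Xx n _; case: (hB n) => _ /(_ _ Xx).
exists (\bigcap_n B n); split=> //; apply/eqP; rewrite eq_le; apply/andP; split; last first.
  by rewrite -[leRHS]measurable_mu_extE//; exact: le_mu_ext.
apply/lee_addgt0Pr => e e0.
have [n ne] : exists n : nat, n.+1%:R^-1 <= e.
  exists (Num.bound e^-1); rewrite -[leRHS]invrK lef_pV2 ?posrE ?invr_gt0//.
  by rewrite (le_trans (ltW (archi_boundP _))) ?ler_nat// invr_ge0 ltW.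
have [mBn XBn muBn] := hB n.
apply: (@le_trans _ _ (mu (B n))); first by apply: le_measure; rewrite ?inE// => x; exact.
by apply: (le_trans muBn); rewrite leeD2l// lee_fin.
Qed.

Lemma caratheodory_core (X : set T) : (mu^*)%mu.-cara.-measurable X ->
  ((mu^*)%mu X < +oo)%E ->
  exists A N, [/\ measurable A /\ measurable N, mu N = 0%E, A `<=` X, X `<=` A `|` N &
    mu A = (mu^*)%mu X].
Proof.
move=> cX Xoo.
have [B [mB XB muB]] := measurable_hull Xoo.
have BX : (mu^*)%mu (B `\` X) = 0%E.
  have : (mu^*)%mu B = ((mu^*)%mu (B `&` X) + (mu^*)%mu (B `&` ~` X))%E := cX B.
  rewrite (measurable_mu_extE mu mB) muB (setIidr XB) -setDE.
  have Xfin : (mu^*)%mu X \is a fin_num by rewrite ge0_fin_numE// outer_measure_ge0.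
  by move=> E; rewrite -[LHS](addeK _ Xfin) [X in (X - _)%E]addeC -E subee.
have [N [mN BN muN]] := measurable_hull (eq_ind_r (fun z => z < +oo)%E (ltry 0) BX).
rewrite BX in muN; exists (B `\` N), N; split=> //.
- by split=> //; exact: measurableD.
- by move=> x [Bx Nx]; apply: contrapT => Xx; apply: Nx; exact: BN.
- by move=> x /XB Bx; have [Nx|Nx] := pselect (N x); [right|left].
- have Boo : (mu B < +oo)%E by rewrite muB.
  rewrite measureD//.
  rewrite -[RHS]sube0 -muB; congr (_ - _)%E.
  apply/eqP; rewrite eq_le measure_ge0 andbT -muN.
  by apply: le_measure; rewrite ?inE//; exact: measurableI.
Qed.

End measurable_hull.
Section homothetic_measure.
Context (R : realType) (d : nat).
Local Notation mR := (measurableTypeR R).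
Local Notation N := (lebesgue_tuple R d).

Definition tuple_of_rV (x : 'rV[R]_d) : d.-tuple mR := [tuple x ord0 i | i < d].

Lemma rV_of_tupleK : cancel (@rV_of_tuple R d) tuple_of_rV.
Proof. by move=> t; apply: eq_from_tnth => i; rewrite tnth_mktuple mxE. Qed.

Lemma caratheodory_preimage_tuple (H : set (d.-tuple mR)) : measurable H ->
  lebesgue_rV.-cara.-measurable (tuple_of_rV @^-1` H).
Proof.
move=> mH; suff : forall X : set 'rV[R]_d, lebesgue_rV X =
    (lebesgue_rV (X `&` tuple_of_rV @^-1` H) + lebesgue_rV (X `&` ~` (tuple_of_rV @^-1` H)))%E by [].
have rVK S : @rV_of_tuple R d @^-1` (tuple_of_rV @^-1` S) = S.
  by apply/seteqP; split=> t /=; rewrite rV_of_tupleK.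
move=> X; rewrite /lebesgue_rV !preimage_setI preimage_setC !rVK.
have cH : (N^*)%mu.-cara.-measurable H by exact: caratheodory_measurable_mu_ext.
have : forall Z : set (d.-tuple mR),
  (N^*)%mu Z = ((N^*)%mu (Z `&` H) + (N^*)%mu (Z `&` ~` H))%E := cH.
exact.
Qed.

Lemma caratheodory_rV_of_tuple (E : set 'rV[R]_d) : lebesgue_rV.-cara.-measurable E ->
  (N^*)%mu.-cara.-measurable (@rV_of_tuple R d @^-1` E).
Proof.
move=> cE; suff : forall Z : set (d.-tuple mR), (N^*)%mu Z =
    ((N^*)%mu (Z `&` @rV_of_tuple R d @^-1` E) + (N^*)%mu (Z `&` ~` (@rV_of_tuple R d @^-1` E)))%E by [].
move=> Z; have : forall X : set 'rV[R]_d, lebesgue_rV X =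
    (lebesgue_rV (X `&` E) + lebesgue_rV (X `&` ~` E))%E := cE.
move=> /(_ (tuple_of_rV @^-1` Z)); rewrite /lebesgue_rV !preimage_setI preimage_setC.
have -> // : @rV_of_tuple R d @^-1` (tuple_of_rV @^-1` Z) = Z.
by apply/seteqP; split=> t /=; rewrite rV_of_tupleK.
Qed.

Lemma homothetic_measure (E : set 'rV[R]_d) : lebesgue_rV.-cara.-measurable E ->
  (lebesgue_rV E < +oo)%E ->
  exists A : set (d.-tuple mR), [/\ measurable A, A `<=` @rV_of_tuple R d @^-1` E,
    N A = lebesgue_rV E &
    forall r x (H : set (d.-tuple mR)), 0 < r -> measurable H ->
      lebesgue_rV (homothetic E r x `&` tuple_of_rV @^-1` H) =
      ((r ^+ d)%:E * N (A `&` tuple_affine r (tuple_of_rV x) @^-1` H))%E].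
Proof.
move=> cE Eoo.
have [A [Z [[mA mZ] Z0 AE EAZ NA]]] := caratheodory_core (caratheodory_rV_of_tuple cE) Eoo.
exists A; split=> // r x H r0 mH.
pose a := tuple_affine r (tuple_of_rV x).
pose g := tuple_affine r^-1 [tuple - (r^-1 * x ord0 i) | i < d].
have rn0 : r != 0 by rewrite gt_eqF.
have gK : cancel g a.
  move=> t; apply: eq_from_tnth => i; rewrite !tnth_mktuple; field; exact: rn0.
have ma : measurable (A `&` a @^-1` H).
  apply: measurableI => //; rewrite -[X in measurable X]setTI.
  exact: measurable_tuple_affine.
have mg (S : set (d.-tuple mR)) : measurable S -> measurable (g @^-1` S).
  by move=> mS; rewrite -[X in measurable X]setTI; exact: measurable_tuple_affine.
have Ng (S : set (d.-tuple mR)) : measurable S -> N (g @^-1` S) = ((r ^+ d)%:E * N S)%E.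
  by move=> mS; rewrite lebesgue_tuple_affine ?invr_gt0// invrK.
have -> : lebesgue_rV (homothetic E r x `&` tuple_of_rV @^-1` H) =
    (N^*)%mu (g @^-1` (@rV_of_tuple R d @^-1` E `&` a @^-1` H)).
  congr (mu_ext _ _); apply/seteqP; split=> t /=; rewrite rV_of_tupleK.
    move=> [[e Ee et] Ht]; rewrite gK; split=> //.
    suff -> : rV_of_tuple (g t) = e by [].
    apply/rowP => i; rewrite !mxE !tnth_mktuple.
    have /rowP/(_ i) := et; rewrite !mxE => <-; field; exact: rn0.
  rewrite gK => -[Eg Ht]; split=> //; exists (rV_of_tuple (g t)) => //.
  apply/rowP => i; rewrite !mxE !tnth_mktuple; field; exact: rn0.
rewrite -Ng//; apply/eqP; rewrite eq_le; apply/andP; split; last first.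
  rewrite -[leLHS]measurable_mu_extE; last exact: mg.
  by apply: le_mu_ext => t [At aHt]; split=> //; exact: AE.
apply: (@le_trans _ _ ((N^*)%mu (g @^-1` (A `&` a @^-1` H) `|` g @^-1` Z))).
  by apply: le_mu_ext => t [/EAZ[At|Zt] aHt]; [left|right].
rewrite measurable_mu_extE; last by apply: measurableU; exact: mg.
apply: le_trans (measureU2 _ _ _) _; [exact: mg..|].
by rewrite [X in (_ + X)%E]Ng// Z0 mule0 adde0.
Qed.

Lemma rV_norm_coord (x : 'rV[R]_d) i : `|x ord0 i| <= `|x|.
Proof.
rewrite (_ : `|x| = mx_norm x)// mx_normrE; apply/bigmax_geP; right => /=.
by exists (ord0, i).
Qed.

Lemma bounded_lebesgue_rV_lty (E : set 'rV[R]_d) : bounded_set E ->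
  (lebesgue_rV E < +oo)%E.
Proof.
move=> [M0 [_ EM0]]; pose M := M0 + 1.
have EM x : E x -> `|x| <= M by apply: EM0; rewrite /M ltrDl.
have box : E `<=` [set x | forall i, (`[- M, M]%classic : set mR) (x ord0 i)].
  by move=> x Ex i; rewrite /= in_itv/= -ler_norml (le_trans (rV_norm_coord x i))// EM.
apply: le_lt_trans (le_outer_measure lebesgue_rV _ _ box) _.
have E1 := @lebesgue_rV_rect R d (fun=> `[- M, M]%classic) (fun=> measurable_itv _).
rewrite [X in (X < _)%E]E1.
have [c c0 ->] : exists2 c : R, 0 <= c & @lebesgue_measure R `[- M, M] = c%:E.
  exists (fine (@lebesgue_measure R `[- M, M])); first exact: fine_ge0.
  by rewrite fineK// ge0_fin_numE// lebesgue_itv_lty.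
by rewrite prodEFin ltry.
Qed.

End homothetic_measure.

(** * The test directions *)

(* The [i]-th direction is [(1, w, 0, ..., 0) + 4 e_i], without the second summand
   for [i = 0]. *)
Definition direction (R : realType) (w1 w2 w3 : R) (i j : nat) : R :=
  nth 0 [:: 1; w1; w2; w3] j + 4 * ((0 < i) && (j == i))%N%:R.

Lemma direction_sum (R : realType) k (w1 w2 w3 : R) (i : 'I_k.+4) (y : 'I_k.+4 -> R) :
  let s := lift (ord0 : 'I_k.+4) in
  \sum_(j < k.+4) direction w1 w2 w3 i j * y j =
  y ord0 + w1 * y (s ord0) + w2 * y (s (lift ord0 ord0)) +
  w3 * y (s (lift ord0 (lift ord0 ord0))) + 4 * (0 < i)%N%:R * y i.
Proof.
rewrite /direction /=; under eq_bigr do rewrite mulrDl.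
rewrite big_split /= [X in _ + X](bigD1 i)//= eqxx andbT [X in _ + (_ + X)]big1.
  rewrite addr0 4!big_ord_recl big1 => [|j _]; last by rewrite /= nth_nil mul0r.
  by rewrite /= mul1r addr0 !addrA.
move=> j ji; have /negbTE -> : (nat_of_ord j != i) by [].
by rewrite andbF mulr0 mul0r.
Qed.

(* The three coordinates multiplied by the [w]'s are small perturbations: with
   [s] the sum of their absolute values, subtracting the equation of direction [0]
   from those of directions 1, 2, 3 and adding up gives [4 s <= 3 s]. *)
Lemma direction_independent (R : realType) k (w1 w2 w3 : 'I_k.+4 -> R) (y : 'I_k.+4 -> R) :
  (forall i, [/\ 0 <= w1 i <= 1, 0 <= w2 i <= 1 & 0 <= w3 i <= 1]) ->
  (forall i, \sum_(j < k.+4) direction (w1 i) (w2 i) (w3 i) i j * y j = 0) ->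
  forall i, y i = 0.
Proof.
move=> w01 H; have := fun i => etrans (esym (direction_sum _ _ _ i y)) (H i).
move=> /= {}H.
set i1 := lift ord0 ord0 in H; set i2 := lift ord0 (lift ord0 ord0) in H.
set i3 := lift ord0 (lift ord0 (lift ord0 ord0)) in H.
have H0 := H ord0; rewrite mulr0 mul0r addr0 in H0.
have perturb (u v z : R) : 0 <= u <= 1 -> 0 <= v <= 1 -> `|(u - v) * z| <= `|z|.
  move=> u01 v01; rewrite normrM ler_piMl// ler_norml; move: u01 v01; lra.
have bound (i : 'I_k.+4) : (0 < i)%N -> 4 * `|y i| <= `|y i1| + `|y i2| + `|y i3|.
  move=> i0; have := H i; rewrite i0 mulr1 => Hi.
  have [a1 a2 a3] := w01 ord0; have [b1 b2 b3] := w01 i.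
  have E : 4 * y i = (w1 ord0 - w1 i) * y i1 + (w2 ord0 - w2 i) * y i2 + (w3 ord0 - w3 i) * y i3.
    by move: H0 Hi; lra.
  rewrite -[4]ger0_norm// -normrM E (le_trans (ler_normD _ _))// lerD//; last exact: perturb.
  by rewrite (le_trans (ler_normD _ _))// lerD//; exact: perturb.
have := bound i1 isT; have := bound i2 isT; have := bound i3 isT => h3 h2 h1.
have p1 := normr_ge0 (y i1); have p2 := normr_ge0 (y i2); have p3 := normr_ge0 (y i3).
have y1 : y i1 = 0 by apply/eqP; rewrite -normr_le0; lra.
have y2 : y i2 = 0 by apply/eqP; rewrite -normr_le0; lra.
have y3 : y i3 = 0 by apply/eqP; rewrite -normr_le0; lra.
move=> i; case: (unliftP ord0 i) => [j|] ->; last by move: H0; rewrite y1 y2 y3; lra.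
have := bound (lift ord0 j) isT; rewrite y1 y2 y3 normr0 !addr0 => h.
apply/eqP; rewrite -normr_le0; lra.
Qed.

Section tuple_test_direction.
Context (R : realType) (k : nat).
Local Notation mR := (measurableTypeR R).
Local Notation lam := (@lebesgue_measure R).
Local Notation Y := (k.+3.-tuple mR).
Local Notation m := (lebesgue_tuple R k.+3).

Let j0 : 'I_k.+3 := ord0.
Let j1 : 'I_k.+3 := lift ord0 ord0.
Let j2 : 'I_k.+3 := lift ord0 (lift ord0 ord0).

Definition tuple_cube (R0 : R) : set Y := [set y | forall j, `|tnth y j| <= R0].

Let tuple_cubeE R0 : tuple_cube R0 = [set y | forall j, (`[- R0, R0]%classic : set mR) (tnth y j)].
Proof. by apply/seteqP; split=> y h j; have := h j; rewrite /= in_itv/= ler_norml. Qed.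

Lemma measurable_tuple_cube R0 : measurable (tuple_cube R0).
Proof.
by rewrite tuple_cubeE; apply: (@measurable_tuple_rect R k.+3 (fun=> `[- R0, R0]%classic)).
Qed.

Lemma lebesgue_tuple_cube_lty R0 : (m (tuple_cube R0) < +oo)%E.
Proof.
rewrite tuple_cubeE (@lebesgue_tuple_rect R k.+3 (fun=> `[- R0, R0]%classic))//.
have [c ->] : exists c : R, lam `[- R0, R0] = c%:E.
  exists (fine (lam `[- R0, R0])).
  by rewrite fineK// ge0_fin_numE// lebesgue_itv_lty.
by rewrite prodEFin ltry.
Qed.

Lemma lebesgue_tuple_box (R0 a1 a2 a3 d1 d2 d3 : R) : 0 <= R0 ->
  0 <= d1 -> 0 <= d2 -> 0 <= d3 ->
  fine (m ([set y | [/\ `|a1 - tnth y j0| <= d1, `|a2 - tnth y j1| <= d2 &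
    `|a3 - tnth y j2| <= d3]] `&` tuple_cube R0)) <= 8 * (2 * R0) ^+ k * (d1 * d2 * d3).
Proof.
move=> R00 d10 d20 d30.
pose I (c r : R) : set mR := `[c - r, c + r]%classic.
have inI c r x : I c r x <-> `|c - x| <= r.
  by rewrite /I /= in_itv/= ler_norml; split; lra.
have mI c r : measurable (I c r) by exact: measurable_itv.
have lamI c r : 0 <= r -> lam (I c r) = (2 * r)%:E.
  move=> r0; rewrite -[LHS]fineK; last by rewrite ge0_fin_numE// lebesgue_itv_lty.
  by rewrite fine_lebesgue_itv; [congr EFin|]; lra.
pose F (j : 'I_k.+3) : set mR :=
  nth (I 0 R0) [:: I a1 d1; I a2 d2; I a3 d3] j.
have mF j : measurable (F j).
  by rewrite /F; case: j => [[|[|[|j]]] h]//=; rewrite nth_nil.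
have NF : m [set y | forall j, F j (tnth y j)] = (8 * (2 * R0) ^+ k * (d1 * d2 * d3))%:E.
  rewrite (lebesgue_tuple_rect mF) !big_ord_recl /F /= !lamI//.
  under eq_bigr => j _ do rewrite nth_nil lamI//.
  rewrite prodEFin prodr_const card_ord -!EFinM; congr EFin; ring.
have sub : [set y | [/\ `|a1 - tnth y j0| <= d1, `|a2 - tnth y j1| <= d2 &
    `|a3 - tnth y j2| <= d3]] `&` tuple_cube R0 `<=` [set y | forall j, F j (tnth y j)].
  move=> y [[/= h1 h2 h3] h] j; rewrite /F.
  case: (unliftP ord0 j) => [j'|] ->; last exact/inI.
  case: (unliftP ord0 j') => [j''|] ->; last exact/inI.
  case: (unliftP ord0 j'') => [j3|] ->; last exact/inI.
  by rewrite /= nth_nil; apply/inI; rewrite sub0r normrN.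
have mset : measurable ([set y : Y | [/\ `|a1 - tnth y j0| <= d1, `|a2 - tnth y j1| <= d2 &
    `|a3 - tnth y j2| <= d3]] `&` tuple_cube R0).
  apply: measurableI; last exact: measurable_tuple_cube.
  pose F' (j : 'I_k.+3) : set mR :=
    nth setT [:: I a1 d1; I a2 d2; I a3 d3] j.
  have mF' j : measurable (F' j).
    by rewrite /F'; case: j => [[|[|[|j]]] h]//=; rewrite nth_nil.
  rewrite (_ : mkset _ = [set y | forall j, F' j (tnth y j)]); first exact: measurable_tuple_rect.
  apply/seteqP; split=> y /=.
    move=> [h1 h2 h3] j; rewrite /F'.
    case: (unliftP ord0 j) => [j'|] ->; last exact/inI.
    case: (unliftP ord0 j') => [j''|] ->; last exact/inI.
    case: (unliftP ord0 j'') => [j3|] ->; last exact/inI.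
    by rewrite /= nth_nil.
  by move=> h; split; apply/inI; [exact: (h j0)|exact: (h j1)|exact: (h j2)].
move: (_ `&` tuple_cube R0) mset sub => Q mQ QF.
have le : (m Q <= (8 * (2 * R0) ^+ k * (d1 * d2 * d3))%:E)%E.
  by rewrite -NF; apply: le_measure => //; rewrite inE//; exact: measurable_tuple_rect.
by rewrite -lee_fin fineK// ge0_fin_numE//; exact: le_lt_trans le (ltry _).
Qed.

Let offset (i : 'I_k.+4) (y : Y) : mR :=
  if unlift ord0 i is Some j then 4 * tnth y j else 0.

Let directionE w1 w2 w3 (i : 'I_k.+4) (p : mR * Y) :
  \sum_(j < k.+4) direction w1 w2 w3 i j * tnth (tuple_cons p) j =
  p.1 + (offset i p.2 + tnth p.2 j0 * w1 + tnth p.2 j1 * w2 + tnth p.2 j2 * w3).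
Proof.
case: p => s y; have -> : offset i y = 4 * (0 < i)%N%:R * tnth (tuple_cons (s, y)) i.
  rewrite /offset; case: unliftP => [j|] ->; last by rewrite mulr0 mul0r.
  by rewrite mulr1 tnthS.
rewrite (direction_sum w1 w2 w3 i (fun j => tnth (tuple_cons (s, y)) j : R)) /= !tnthS.
have -> : tnth (tuple_cons (s, y)) ord0 = s by rewrite tnth0.
move: (tnth (tuple_cons (s, y)) i : R) (tnth y j0 : R) (tnth y j1 : R) (tnth y j2 : R) => *.
ring.
Qed.

Lemma test_direction (i : 'I_k.+4) (A : set (k.+4.-tuple mR)) (R0 : R) :
  measurable A -> (forall t, A t -> forall j, `|tnth t j| <= R0) -> 0 <= R0 ->
  (0 < lebesgue_tuple R k.+4 A)%E ->
  exists w1 w2 w3 : R, [/\ 0 <= w1 <= 1, 0 <= w2 <= 1 & 0 <= w3 <= 1] /\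
  exists S : set mR, measurable S /\ forall r t t', 1 <= r -> t < t' ->
    fine (lebesgue_tuple R k.+4 (A `&` [set e | S (t + r *
      \sum_(j < k.+4) direction w1 w2 w3 i j * tnth e j)])) <
    fine (lebesgue_tuple R k.+4 (A `&` [set e | S (t' + r *
      \sum_(j < k.+4) direction w1 w2 w3 i j * tnth e j)])).
Proof.
move=> mA AR R00 A0.
pose B := @tuple_cons R k.+3 @^-1` A.
have mB : measurable B by exact: tuple_cons_preimage.
have BR p : B p -> `|p.1| <= R0 /\ tuple_cube R0 p.2.
  move=> Bp; split; first by have := AR _ Bp ord0; rewrite tnth0.
  by move=> j; have := AR _ Bp (lift ord0 j); rewrite tnthS.
have R04 : R0 <= 4 * R0 by rewrite ler_peMl// ler1n.
have mo : measurable_fun setT (offset i).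
  rewrite /offset; case: unlift => [j|]; last exact: measurable_cst.
  by apply: measurable_funM => //; exact: measurable_tnth.
have mt j : measurable_fun setT (fun y : Y => tnth y j : mR) by exact: measurable_tnth.
have YR y : tuple_cube R0 y -> [/\ `|offset i y| <= 4 * R0, `|tnth y j0| <= 4 * R0,
    `|tnth y j1| <= 4 * R0 & `|tnth y j2| <= 4 * R0].
  move=> h; split; [|exact: le_trans (h _) R04..].
  rewrite /offset; case: unlift => [j|]; last by rewrite normr0 mulr_ge0.
  by rewrite normrM ger0_norm// ler_wpM2l.
have R40 : 0 <= 4 * R0 by rewrite mulr_ge0.
have C40 : 0 <= 8 * (2 * R0) ^+ k by rewrite mulr_ge0// exprn_ge0// mulr_ge0.
have [w1 [w2 [w3 [w01 [C C0 Reg]]]]] := smoothing (measurable_tuple_cube R0)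
  (lebesgue_tuple_cube_lty R0) mo (mt j0) (mt j1) (mt j2) mB
  (fun p Bp => conj (le_trans (BR p Bp).1 R04) (BR p Bp).2) YR R40 C40
  (fun a1 a2 a3 d1 d2 d3 => @lebesgue_tuple_box R0 a1 a2 a3 d1 d2 d3 R00).
exists w1, w2, w3; split=> //.
pose l (p : mR * Y) : R :=
  p.1 + (offset i p.2 + tnth p.2 j0 * w1 + tnth p.2 j1 * w2 + tnth p.2 j2 * w3).
have ml : measurable_fun setT (l : mR * Y -> mR).
  have mt2 j : measurable_fun setT (fun p : mR * Y => tnth p.2 j : mR).
    exact: (measurableT_comp (mt j) measurable_snd).
  apply: measurable_funD; first exact: measurable_fst.
  do 3 (apply: measurable_funD; last by apply: measurable_funM => //; exact: mt2).
  exact: (measurableT_comp mo measurable_snd).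
have Boo : (prod_measure lam m B < +oo)%E.
  have mI : measurable (`[- R0, R0]%classic : set mR) by exact: measurable_itv.
  have mC := measurable_tuple_cube R0.
  apply: (@le_lt_trans _ _ (prod_measure lam m (`[- R0, R0]%classic `*` tuple_cube R0))).
    apply: le_measure; rewrite ?inE//; first exact: measurableX.
    by move=> p /BR[pR Yp]; split=> //=; rewrite in_itv/= -ler_norml.
  by apply: prod_measure_lty => //; [exact: lebesgue_itv_lty|exact: lebesgue_tuple_cube_lty].
have lC p : B p -> `|l p| <= 17 * R0.
  move=> /BR[p1 /[dup]/YR[ho _ _ _] h]; rewrite /l.
  have aux (x w : R) : `|x| <= R0 -> 0 <= w <= 1 -> `|x * w| <= R0.
    move=> xR /andP[w0 w1']; rewrite normrM (ger0_norm w0).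
    by rewrite (le_trans _ xR)// ler_piMr.
  case: w01 => h1 h2 h3.
  have := aux _ _ (h j0) h1; have := aux _ _ (h j1) h2; have := aux _ _ (h j2) h3.
  move: p1 ho R00; rewrite !ler_norml; lra.
have B0 : 0 < fine (prod_measure lam m B).
  by rewrite fine_gt0// Boo andbT; exact: A0.
have R170 : 0 <= 17 * R0 by rewrite mulr_ge0.
have [S [mS Sl]] := monotone_test_set mB Boo ml lC C0 Reg B0 R170.
exists S; split; first exact: mS.
move=> r t t' r1 tt'.
have E u : lebesgue_tuple R k.+4 (A `&` [set e | S (u + r *
      \sum_(j < k.+4) direction w1 w2 w3 i j * tnth e j)]) =
    prod_measure lam m (B `&` [set p | S (u + r * l p)]).
  rewrite /= /lebesgue_tuple_succ /pushforward; congr (_ _).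
  by apply/seteqP; split=> p /=; rewrite directionE.
by rewrite [X in fine X < _]E [X in _ < fine X]E; exact: (Sl r t t' r1 tt').
Qed.

End tuple_test_direction.
Theorem corollary6p7 (R : realType) (d : nat) (hd : (4 <= d)%N)
    (E : set 'rV[R]_d) (bE : bounded_set E)
    (mE : lebesgue_rV.-cara.-measurable E) (posE : (0 < lebesgue_rV E)%E) :
  exists T : 'I_d.+1 -> set 'rV[R]_d,
    (forall i, lebesgue_rV.-cara.-measurable (T i)) /\
    forall (x x' : 'rV[R]_d) (r r' : R), 1 <= r -> 1 <= r' ->
      (x, r) <> (x', r') ->
      exists i : 'I_d.+1,
        lebesgue_rV (homothetic E r x `&` T i) <>
        lebesgue_rV (homothetic E r' x' `&` T i).
Proof.
case: d hd E bE mE posE => [|[|[|[|k]]]]// _ E bE mE posE.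
pose mR := measurableTypeR R.
have Eoo := bounded_lebesgue_rV_lty bE.
have [A [mA AE NA hA]] := homothetic_measure mE Eoo.
have [M M0 AM] : exists2 M : R, 0 <= M & forall t, A t -> forall j, `|tnth t j| <= M.
  have [M1 [_ EM1]] := bE; exists (`|M1| + 1); first by rewrite addr_ge0.
  move=> t /AE Et j; have M1lt : M1 < `|M1| + 1 by rewrite (le_lt_trans (ler_norm _))// ltrDl.
  have := rV_norm_coord (rV_of_tuple t) j; rewrite mxE => h.
  exact: le_trans h (EM1 _ M1lt _ Et).
have A0 : (0 < lebesgue_tuple R k.+4 A)%E by rewrite NA.
have Aoo : (lebesgue_tuple R k.+4 A < +oo)%E by rewrite NA.
have /choice[w1 /choice[w2 /choice[w3 wH]]] := fun i => test_direction i mA AM M0 A0.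
have w01 i := (wH i).1; have /choice[S SH] := fun i => (wH i).2.
move: (lebesgue_tuple R k.+4) NA hA A0 Aoo SH => N NA hA A0 Aoo SH {wH}.
pose l i (t : k.+4.-tuple mR) : R :=
  \sum_(j < k.+4) direction (w1 i) (w2 i) (w3 i) i j * tnth t j.
pose H i : set (k.+4.-tuple mR) := [set t | S i (l i t)].
have mH i : measurable (H i).
  have ml : measurable_fun setT (l i : k.+4.-tuple mR -> mR).
    apply: measurable_sum => j; apply: measurable_funM => //; exact: measurable_tnth.
  have [mS _] := SH i; rewrite -[X in measurable X]setTI; exact: ml.
have l_affine i r x t : l i (tuple_affine r (tuple_of_rV x) t) =
    l i (tuple_of_rV x) + r * l i t.
  rewrite /l mulr_sumr -big_split; apply: eq_bigr => j _ /=; rewrite !tnth_mktuple; ring.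
pose T (i : 'I_k.+4.+1) : set 'rV[R]_k.+4 :=
  @tuple_of_rV R k.+4 @^-1` (if unlift ord0 i is Some j then H j else setT).
have mT i : measurable (if unlift ord0 i is Some j then H j else setT).
  by case: unlift => [j|]; [exact: mH|exact: measurableT].
exists T; split=> [i|x x' r r' r1 r1' neq].
  by apply: caratheodory_preimage_tuple; exact: mT.
apply: contrapT => nex.
have eqT i : lebesgue_rV (homothetic E r x `&` T i) = lebesgue_rV (homothetic E r' x' `&` T i).
  by apply: contrapT => h; apply: nex; exists i.
have r0 : 0 < r by apply: lt_le_trans r1.
have r0' : 0 < r' by apply: lt_le_trans r1'.
have fN Z : measurable Z -> N (A `&` Z) \is a fin_num.
  move=> mZ; rewrite ge0_fin_numE//; apply: le_lt_trans Aoo.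
  by apply: le_measure; rewrite ?inE//; exact: measurableI.
have rr' : r = r'.
  have := eqT ord0; rewrite /T unlift_none !hA// preimage_setT setIT.
  have := fN setT measurableT; rewrite setIT => NAfin.
  rewrite -(fineK NAfin) -!EFinM => -[] /(mulIf _) E1.
  have {}E1 : r ^+ k.+4 = r' ^+ k.+4 by apply: E1; rewrite gt_eqF// fine_gt0// Aoo andbT.
  by move: E1 => /eqP; rewrite eqrXn2// ?ltW// => /eqP.
subst r'; apply: neq; congr pair; apply/rowP => j0.
suff y0 j : x ord0 j - x' ord0 j = 0 by apply/eqP; rewrite -subr_eq0 y0.
move: j; apply: (direction_independent w01) => i.
have lE z : l i (tuple_of_rV z) =
    \sum_(j < k.+4) direction (w1 i) (w2 i) (w3 i) i j * z ord0 j.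
  by apply: eq_bigr => j _; rewrite tnth_mktuple.
under eq_bigr do rewrite mulrBr.
rewrite sumrB -!lE.
have mHa z : measurable (tuple_affine r (tuple_of_rV z) @^-1` H i).
  by rewrite -[X in measurable X]setTI; apply: measurable_tuple_affine.
have := eqT (lift ord0 i); rewrite /T liftK !hA//.
rewrite -(fineK (fN _ (mHa x))) -(fineK (fN _ (mHa x'))) -!EFinM => -[] /mulfI.
rewrite gt_eqF ?exprn_gt0// => /(_ isT).
have HE z : tuple_affine r (tuple_of_rV z) @^-1` H i =
    [set e | S i (l i (tuple_of_rV z) + r * l i e)].
  by apply/seteqP; split=> t; rewrite /H /= l_affine.
rewrite !HE => eqN; have [_ Si] := SH i.
apply/eqP; rewrite subr_eq0; apply/eqP.
case: (ltgtP (l i (tuple_of_rV x)) (l i (tuple_of_rV x'))) => // /(Si r _ _ r1).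
  by rewrite -/(l i) eqN ltxx.
by rewrite -/(l i) eqN ltxx.
Qed.
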